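(* If $(G,X)$ is a contracting self-similar group, then the group $\mathcal{V}_G$ is finitely presented.
   Context: Let $X$ be a finite set with $d=|X|\ge 2$. $X^*$ denotes the set of finite words over $X$ (including the empty word), viewed as a rooted tree in which each word $v$ is joined to $vx$ for $x\in X$; $X^\omega$ is the space of right-infinite sequences $x_1x_2\ldots$ with the product topology. A complete antichain is a finite set $A\subset X^*$ of words, none a prefix of another, such that $X^\omega=\bigsqcup_{v\in A}vX^\omega$. A self-similar group $(G,X)$ is a group $G$ acting faithfully by automorphisms of the rooted tree $X^*$ (hence by homeomorphisms of $X^\omega$) such that for every $g\in G$ and $x\in X$ there exist $h\in G$, $y\in X$ with $g(xw)=yh(w)$ for all $w$. For $g\in G$ and $v\in X^*$ the section $g|_v\in G$ is the unique element with $g(vw)=g(v)g|_v(w)$ for all $w\in X^\omega$. $(G,X)$ is contracting if there is a finite set $\mathcal{N}\subset G$ such that for every $g\in G$ there is $n$ with $g|_v\in\mathcal{N}$ for all $v\in X^*$ with $|v|\ge n$. $\mathcal{V}_G$ is the group of all homeomorphisms $g$ of $X^\omega$ for which there exist complete antichains $A_1,A_2$, a bijection $\alpha:A_1\to A_2$ and elements $g_v\in G$ ($v\in A_1$) such that $g(vw)=\alpha(v)g_v(w)$ for all $v\in A_1$, $w\in X^\omega$. *)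

(* Defs.v *)
From Stdlib Require List.
From mathcomp Require Import all_boot.
Set Implicit Arguments. Unset Strict Implicit. Unset Printing Implicit Defensive.

Section SelfSimilar.
Variable X : finType.

Definition oseq := nat -> X.

Definition cat_seq (v : seq X) (w : oseq) : oseq :=
  fun n => if n < size v then nth (w 0) v n else w (n - size v).

Definition tree_aut (g : seq X -> seq X) : Prop :=
  bijective g /\
  (forall v, size (g v) = size v) /\
  (forall v w, take (size v) (g (v ++ w)) = g v).

Definition tree_aut_group (G : (seq X -> seq X) -> Prop) : Prop :=
  (forall g, G g -> tree_aut g) /\
  G id /\
  (forall g h, G g -> G h -> G (g \o h)) /\
  (forall g, G g -> exists2 h, G h & cancel g h /\ cancel h g).

(* (G,X) is a self-similar group (faithful since G consists of tree automorphisms). *)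
Definition self_similar (G : (seq X -> seq X) -> Prop) : Prop :=
  tree_aut_group G /\
  forall g x, G g -> exists h y, G h /\ forall w, g (x :: w) = y :: h w.

(* Contracting: there is a finite N ⊂ G such that for every g, all sections
   g|_v with |v| >= n lie in N.  "g|_v = h" means g(vw) = g(v) h(w) for all w. *)
Definition contracting (G : (seq X -> seq X) -> Prop) : Prop :=
  exists N : seq (seq X -> seq X),
    (forall h, List.In h N -> G h) /\
    forall g, G g -> exists n, forall v, n <= size v ->
      exists h, List.In h N /\ forall w, g (v ++ w) = g v ++ h w.

Definition act (g : seq X -> seq X) (xi : oseq) : oseq :=
  fun n => nth (xi 0) (g (mkseq xi n.+1)) n.

Definition complete_antichain (A : seq (seq X)) : Prop :=
  uniq A /\
  (forall u v, u \in A -> v \in A -> prefix u v -> u = v) /\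
  (forall xi : oseq, exists2 v, v \in A & mkseq xi (size v) = v).

Definition V_G (G : (seq X -> seq X) -> Prop) (f : oseq -> oseq) : Prop :=
  exists (A1 A2 : seq (seq X)) (alpha : seq X -> seq X)
         (gv : seq X -> (seq X -> seq X)),
    [/\ complete_antichain A1, complete_antichain A2,
        [/\ (forall v, v \in A1 -> alpha v \in A2),
             {in A1 &, injective alpha} &
             (forall u, u \in A2 -> exists2 v, v \in A1 & alpha v = u)],
        (forall v, v \in A1 -> G (gv v)) &
        (forall v, v \in A1 -> forall xi : oseq, mkseq xi (size v) = v ->
           forall n, f xi n =
             cat_seq (alpha v) (act (gv v) (fun k => xi (k + size v))) n)].

End SelfSimilar.

(* words over generators: a letter (i, true) is generator i, (i, false) its inverse *)
Definition gword := seq (nat * bool).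

Definition inv_letter (a : nat * bool) : nat * bool := (a.1, ~~ a.2).

Inductive pres_eq (R : seq gword) : gword -> gword -> Prop :=
  | pe_refl w : pres_eq R w w
  | pe_sym u v : pres_eq R u v -> pres_eq R v u
  | pe_trans u v w : pres_eq R u v -> pres_eq R v w -> pres_eq R u w
  | pe_free u v a : pres_eq R (u ++ a :: inv_letter a :: v) (u ++ v)
  | pe_rel u v r : r \in R -> pres_eq R (u ++ r ++ v) (u ++ v).

(* A group H (given as a subset of a monoid (T, mul, one) with equality eqv)
   is finitely presented: there are finitely many generators (with inverses)
   in H generating H, and finitely many relators such that a word evaluates
   to the identity iff it is a consequence of the relators. *)
Definition finitely_presented (T : Type) (H : T -> Prop) (mul : T -> T -> T)
    (one : T) (eqv : T -> T -> Prop) : Prop :=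
  exists (gens : seq (T * T)) (R : seq gword),
    let valid (w : gword) := all (fun a => a.1 < size gens) w in
    let letter (a : nat * bool) :=
        let p := nth (one, one) gens a.1 in if a.2 then p.1 else p.2 in
    let eval (w : gword) := foldr (fun a t => mul (letter a) t) one w in
    [/\ (forall i, i < size gens ->
           let p := nth (one, one) gens i in
           [/\ H p.1, H p.2, eqv (mul p.1 p.2) one & eqv (mul p.2 p.1) one]),
        (forall h, H h -> exists2 w, valid w & eqv (eval w) h),
        all valid R &
        (forall w, valid w -> (eqv (eval w) one <-> pres_eq R w [::]))].

Definition ext_eq (X : Type) (f g : (nat -> X) -> (nat -> X)) : Prop :=
  forall xi n, f xi n = g xi n.

(* Main.v *)
(* Write d = e + 1 for the number of letters and consider the right vines, the
   trees with k * e + 1 leaves obtained by splitting the last leaf k times.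
   An element of V_G is a product c_A h c_B^-1, where c_A maps the leaves of a
   vine to those of a tree A, in order, and h permutes the leaves of the vine
   and acts on each of them by an element of the nucleus. So V_G is generated
   by the splittings Y i (c_A for the vine with its i-th leaf split), by the
   adjacent transpositions of the leaves of the vines, and by the nucleus
   elements placed at these leaves.

   A strand system is a group with such letters satisfying the evident local
   relations. These suffice to bring any word to the form c_A h c_B^-1, with a
   single nucleus element on each leaf: a product of two nucleus elements is
   split until contraction makes its sections elements of the nucleus. If the
   value in V_G is trivial then A = B, the permutation is trivial (so its
   Coxeter word is), and the labels are trivial; hence the word is trivial in
   every strand system.

   Finiteness comes from conjugation by Y 0, which shifts the leaves of a vine
   by e: as for Thompson's group F, the relations of bounded level imply all
   the others. Thus all the true relations of bounded length between letters of
   bounded level present V_G. *)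
From HB Require Import structures.
From Stdlib Require List.
Require Import Defs.
From mathcomp Require Import all_boot.
From mathcomp Require Import zify boolp.
Set Implicit Arguments. Unset Strict Implicit. Unset Printing Implicit Defensive.

(** A normal form in an abstract strand system says nothing about [V_G] unless both use the same
    data. Words are therefore normalized in the product of an arbitrary strand system with that of
    homeomorphisms: trees, permutation and labels are common to both factors, become trivial by
    looking at the second, and so collapse the first. The obstacle is that the nucleus is not closed
    under products: [lmul] is a relation, the depth at which a product becomes a label depends on
    the strand, and termination rests on a weight that drops at each splitting. [Y i] is one element
    for all levels [k] with [i < k * e], because a further splitting of the last leaf is shared by
    source and target; a decoration of the last strands is altered by such a splitting, hence [D]
    carries its level. The group given by the presentation satisfies only the axioms of low level.
    Letters of higher level are defined in it by conjugation and shown to satisfy all axioms, so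
    that the comparison with [V_G] applies to this group. Taking every true short relation as a
    relator dispenses with an explicit list: the axioms of low level only have to be among them. *)

Definition swap_at i q := if q == i then i.+1 else if q == i.+1 then i else q.

Definition swaps_at (t : seq nat) q := foldr swap_at q t.

(** Generic in [child] because the same operation is applied to the leaves of a tree, to frames of
    the Cantor set, to label functions and to depth bounds. *)
Definition split_at e T (child : T -> nat -> T) j (phi : nat -> T) q :=
  if q < j then phi q
  else if q < j + e.+1 then child (phi j) (q - j) else phi (q - e).

Lemma swap_atK i : involutive (swap_at i).
Proof. by rewrite /swap_at => q; do !case: eqP => //; lia. Qed.

Lemma swap_atL i : swap_at i i = i.+1.
Proof. by rewrite /swap_at eqxx. Qed.

Lemma swap_atR i : swap_at i i.+1 = i.
Proof. by rewrite /swap_at eqxx ifF //; lia. Qed.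

Lemma swap_atD i q : q != i -> q != i.+1 -> swap_at i q = q.
Proof. by rewrite /swap_at => /negPf -> /negPf ->. Qed.

Lemma swap_at_braid i q : swap_at i (swap_at i.+1 (swap_at i q)) =
  swap_at i.+1 (swap_at i (swap_at i.+1 q)).
Proof.
have E1 : swap_at i.+1 i = i by rewrite swap_atD //; lia.
have E2 : swap_at i i.+2 = i.+2 by rewrite swap_atD //; lia.
case: (q =P i) => [->|h0]; first by rewrite E1 !swap_atL E2.
case: (q =P i.+1) => [->|h1]; first by rewrite swap_atR E1 !swap_atL E2 swap_atR.
case: (q =P i.+2) => [->|h2]; first by rewrite E2 !swap_atR E1.
by rewrite !swap_atD //; lia.
Qed.

Lemma swaps_at_cat t t' q : swaps_at (t ++ t') q = swaps_at t (swaps_at t' q).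
Proof. by rewrite /swaps_at foldr_cat. Qed.

Lemma swaps_at_rev t : cancel (swaps_at t) (swaps_at (rev t)).
Proof.
elim: t => [|i t IH] q //=.
by rewrite rev_cons -cats1 swaps_at_cat /= swap_atK IH.
Qed.

Lemma swaps_at_lt n t q : all (fun i => i.+1 < n) t -> q < n -> swaps_at t q < n.
Proof.
elim: t => [|i t IH] //= /andP[it /IH{}IH] /IH; rewrite /swap_at.
by do !case: eqP => //; lia.
Qed.

Lemma swaps_at_shift j t q :
  swaps_at [seq j + i | i <- t] (j + q) = j + swaps_at t q.
Proof.
by elim: t => [|i t IH] //=; rewrite IH /swap_at; do !case: eqP => //; lia.
Qed.

Lemma swaps_at_out j n t q : all (fun i => i < n) t -> (q < j) || (j + n < q) ->
  swaps_at [seq j + i | i <- t] q = q.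
Proof.
elim: t => [|i t IH] //= /andP[it /IH{}IH] hq.
by rewrite IH // /swap_at; do !case: eqP => //; lia.
Qed.

(** The Thompson relation for indexed families: once the earlier entry [i] is split, the entry [j]
    sits at [j + e]. *)
Lemma split_atC e T (child : T -> nat -> T) i j (phi : nat -> T) : i < j ->
  split_at e child i (split_at e child j phi) =1
  split_at e child (j + e) (split_at e child i phi).
Proof.
move=> ij q; rewrite /split_at.
case: (ltnP q i) => h1.
  have -> : q < j by lia.
  by have -> : q < j + e by lia.
case: (ltnP q (i + e.+1)) => h2.
  rewrite ij; by have -> : q < j + e by lia.
case: (ltnP q (j + e)) => h3; first by have -> : q - e < j by lia.
have -> : (q - e < j) = false by lia.
have -> : (q - e < j + e.+1) = (q < j + e + e.+1) by lia.
case: ifP => h4.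
  have -> : (j + e < i) = false by lia.
  have -> : (j + e < i + e.+1) = false by lia.
  by rewrite addnK; congr (child _ _); lia.
have -> : (q - e < i) = false by lia.
by have -> : (q - e < i + e.+1) = false by lia.
Qed.

(** * Strand systems *)

(* Abstract nucleus over an alphabet with e + 1 letters: lmul a b c means ab = c,
   lperm a and lsec a describe the action of a on the first level, lswaps a
   writes lperm a as a product of adjacent transpositions, and ldepth n a b
   means that the sections of ab at depth at least n are labels. *)
Record labels (e : nat) := Labels {
  lab : finType;
  lone : lab;
  linv : lab -> lab;
  lmul : lab -> lab -> lab -> Prop;
  lperm : lab -> nat -> nat;
  lswaps : lab -> seq nat;
  lsec : lab -> nat -> lab;
  ldepth : nat -> lab -> lab -> Prop;
  lmul11 : lmul lone lone lone;
  lmulV : forall a, lmul a (linv a) lone;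
  lswaps_lt : forall a, all (fun i => i < e) (lswaps a);
  lswapsE : forall a r, r <= e -> swaps_at (lswaps a) r = lperm a r;
  lperm_le : forall a r, r <= e -> lperm a r <= e;
  ldepth0 : forall a b, ldepth 0 a b -> exists c, lmul a b c;
  ldepthS : forall n a b r, ldepth n.+1 a b -> r <= e ->
     ldepth n (lsec a (lperm b r)) (lsec b r);
  ldepth_ex : forall a b, exists n, ldepth n a b }.

Section Letters.
Variables (e : nat) (L : labels e).
Notation I := (lab L).

Definition width (c : option I) := if c is None then 2 else 1.

(* (h, a, None) stands for the splitting of strand i + a at level k + h, and
   (h, a, Some c) for the decoration c there, relative to a base point (k, i). *)
Definition rletter := (nat * nat * option (option I))%type.
Definition rY h a : rletter := (h, a, None).
Definition rS h a : rletter := (h, a, Some None).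
Definition rL h a g : rletter := (h, a, Some (Some g)).

(** The index is the number of adjacent strands that a relation occupies, so it can be placed at [i]
    as soon as [i + W] strands exist. Letters with [h = 1] stand after a splitting, hence one level
    higher. *)
Inductive local_rel : nat -> seq rletter -> seq rletter -> Prop :=
  | lr_swap_split :
      local_rel 2 [:: rS 0 0; rY 0 0] (rY 0 1 :: [seq rS 1 r | r <- iota 0 e.+1])
  | lr_label_split g :
      local_rel 1 [:: rL 0 0 g; rY 0 0]
        (rY 0 0 :: [seq rS 1 r | r <- lswaps g]
           ++ [seq rL 1 r (lsec g r) | r <- iota 0 e.+1])
  | lr_swapK : local_rel 2 [:: rS 0 0; rS 0 0] [::]
  | lr_braid : local_rel 3 [:: rS 0 0; rS 0 1; rS 0 0] [:: rS 0 1; rS 0 0; rS 0 1]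
  | lr_swap_label g : local_rel 2 [:: rS 0 0; rL 0 0 g] [:: rL 0 1 g; rS 0 0]
  | lr_mul a b c : lmul a b c -> local_rel 1 [:: rL 0 0 a; rL 0 0 b] [:: rL 0 0 c].

End Letters.
Arguments rY {e L}. Arguments rS {e L}. Arguments rL {e L}.

Section Eval.
Variables (e : nat) (L : labels e) (Q : groupType).
Variables (Y : nat -> Q) (D : nat -> nat -> option (lab L) -> Q).

Definition ysplit k i : Q := if i < k * e then Y i else 1%g.

Definition reval k i (l : rletter L) : Q :=
  let: (h, a, c) := l in
  if c is Some c then D (k + h) (i + a) c else ysplit (k + h) (i + a).

Lemma reval_rY k i h a : reval k i (rY h a) = ysplit (k + h) (i + a).
Proof. by []. Qed.

Lemma reval_rS k i h a : reval k i (rS h a) = D (k + h) (i + a) None.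
Proof. by []. Qed.

Lemma reval_rL k i h a g : reval k i (rL h a g) = D (k + h) (i + a) (Some g).
Proof. by []. Qed.

Definition revalE := (reval_rY, reval_rS, reval_rL).

Definition reval_word k i w : Q := (\prod_(l <- w) reval k i l)%g.

(* Axioms at level k; the vine of level k has k * e + 1 strands and the
   splitting of its last strand is trivial. *)
Record strand_axioms_at (k : nat) : Prop := StrandAxiomsAt {
  ax_YY : forall i j, i < j -> j <= k * e ->
    (ysplit k j * ysplit k.+1 i = ysplit k i * ysplit k.+1 (j + e))%g;
  ax_DYl : forall i j c, j < i -> i + width c <= (k * e).+1 ->
    (D k i c * ysplit k j = ysplit k j * D k.+1 (i + e) c)%g;
  ax_DYr : forall i j c, i + width c <= j -> j <= k * e ->
    (D k i c * ysplit k j = ysplit k j * D k.+1 i c)%g;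
  ax_DD : forall i j c c', i + width c <= j -> j + width c' <= (k * e).+1 ->
    (D k i c * D k j c' = D k j c' * D k i c)%g;
  ax_loc : forall W u v i, local_rel W u v -> i + W <= (k * e).+1 ->
    reval_word k i u = reval_word k i v }.

End Eval.

Record strand (e : nat) (L : labels e) := Strand {
  sgrp :> groupType;
  sY : nat -> sgrp;
  sD : nat -> nat -> option (lab L) -> sgrp;
  sax : forall k, strand_axioms_at sY sD k }.

Section StrandTheory.
Variables (e : nat) (L : labels e) (Q : strand L).
Notation I := (lab L).
Notation y := (ysplit e (sY Q)).
Notation D := (sD Q).

Definition valid_swaps k t := all (fun i => i < k * e) t.
Definition swaps k t : Q := (\prod_(i <- t) D k i None)%g.
Definition labs k f : Q := (\prod_(0 <= q < (k * e).+1) D k q (Some (f q)))%g.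

Lemma swaps_cat k t t' : swaps k (t ++ t') = (swaps k t * swaps k t')%g.
Proof. by rewrite /swaps big_cat. Qed.

Lemma swaps_cons k i t : swaps k (i :: t) = (D k i None * swaps k t)%g.
Proof. by rewrite /swaps big_cons. Qed.

Lemma yY k i j : i < j -> j <= k * e ->
  (y k j * y k.+1 i = y k i * y k.+1 (j + e))%g.
Proof. exact: ax_YY (sax Q k) _ _. Qed.

Lemma Dyl k i j c : j < i -> i + width c <= (k * e).+1 ->
  (D k i c * y k j = y k j * D k.+1 (i + e) c)%g.
Proof. exact: ax_DYl (sax Q k) _ _ _. Qed.

Lemma Dyr k i j c : i + width c <= j -> j <= k * e ->
  (D k i c * y k j = y k j * D k.+1 i c)%g.
Proof. exact: ax_DYr (sax Q k) _ _ _. Qed.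

Lemma DD k i j c c' : i + width c <= j -> j + width c' <= (k * e).+1 ->
  (D k i c * D k j c' = D k j c' * D k i c)%g.
Proof. exact: ax_DD (sax Q k) _ _ _ _. Qed.

Lemma swap_split k i : i < k * e ->
  (D k i None * y k i = y k i.+1 * swaps k.+1 (iota i e.+1))%g.
Proof.
move=> hi; have := ax_loc (sax Q k) (i := i) (lr_swap_split L).
rewrite addn2 => /(_ hi); rewrite /reval_word [LHS]big_cons big_seq1 big_cons.
rewrite !revalE !addn0 addn1 => ->; congr (_ * _)%g.
have -> : iota i e.+1 = [seq i + r | r <- iota 0 e.+1] by rewrite -iotaDl addn0.
rewrite /swaps !big_map; apply: eq_bigr => r _.
by rewrite revalE addn1.
Qed.

Lemma label_split k i g : i <= k * e ->
  (D k i (Some g) * y k i =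
   y k i * (swaps k.+1 [seq i + r | r <- lswaps g]
     * \prod_(r <- iota 0 e.+1) D k.+1 (i + r) (Some (lsec g r))))%g.
Proof.
move=> hi; have := ax_loc (sax Q k) (i := i) (lr_label_split g).
rewrite addn1 ltnS => /(_ hi); rewrite /reval_word [LHS]big_cons big_seq1 big_cons.
rewrite !revalE !addn0 => ->; congr (_ * _)%g.
rewrite big_cat !big_map /swaps big_map.
by congr (_ * _)%g; apply: eq_bigr => r _; rewrite revalE addn1.
Qed.

Lemma swapK k i : i < k * e -> (D k i None * D k i None = 1)%g.
Proof.
move=> hi; have := ax_loc (sax Q k) (i := i) (lr_swapK L).
rewrite addn2 => /(_ hi); rewrite /reval_word !big_cons !big_nil mulg1.
by rewrite !revalE !addn0.
Qed.

Lemma braid k i : i.+1 < k * e ->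
  (D k i None * (D k i.+1 None * D k i None) =
   D k i.+1 None * (D k i None * D k i.+1 None))%g.
Proof.
move=> hi; have := ax_loc (sax Q k) (i := i) (lr_braid L).
rewrite addn3 => /(_ hi); rewrite /reval_word !big_cons !big_nil !mulg1.
by rewrite !revalE !addn0 !addn1.
Qed.

Lemma swap_label k i g : i < k * e ->
  (D k i None * D k i (Some g) = D k i.+1 (Some g) * D k i None)%g.
Proof.
move=> hi; have := ax_loc (sax Q k) (i := i) (lr_swap_label g).
rewrite addn2 => /(_ hi); rewrite /reval_word !big_cons !big_nil !mulg1.
by rewrite !revalE !addn0 !addn1.
Qed.

Lemma label_mul k i a b c : i <= k * e -> lmul a b c ->
  (D k i (Some a) * D k i (Some b) = D k i (Some c))%g.
Proof.
move=> hi abc; have := ax_loc (sax Q k) (i := i) (lr_mul abc).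
rewrite addn1 => /(_ hi); rewrite /reval_word !big_cons !big_nil !mulg1.
by rewrite !revalE !addn0.
Qed.

(** The inverse form of [swap_split]: the swap is an involution, and reversing a word of swaps
    inverts it. *)
Lemma swap_split' k i : i < k * e ->
  (D k i None * y k i.+1 = y k i * swaps k.+1 (rev (iota i e.+1)))%g.
Proof.
move=> hi.
have key t : valid_swaps k.+1 t -> (swaps k.+1 t * swaps k.+1 (rev t) = 1)%g.
  elim: t => [|j t IH] /=; first by rewrite /swaps /rev /= big_nil mulg1.
  case/andP=> hj /IH{}IH; rewrite swaps_cons rev_cons -cats1 swaps_cat.
  rewrite -mulgA (mulgA (swaps _ t)) IH mul1g swaps_cons /swaps big_nil mulg1.
  exact: swapK.
have hv : valid_swaps k.+1 (iota i e.+1).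
  apply/allP => j; rewrite mem_iota mulSn; lia.
apply: (@mulgI _ (D k i None)); rewrite mulgA swapK // mul1g.
by rewrite mulgA swap_split // -mulgA key // mulg1.
Qed.

(** This collects splittings on the left: a splitting passes each transposition at the cost of a
    word of swaps at the next level. *)
Lemma swaps_y k t j : valid_swaps k t -> j <= k * e ->
  exists2 t', valid_swaps k.+1 t' &
    (swaps k t * y k j = y k (swaps_at t j) * swaps k.+1 t')%g.
Proof.
move=> + hj; elim: t => [|i t IH] /=.
  by exists [::] => //; rewrite /swaps !big_nil mulg1 mul1g.
case/andP=> hi ht; have [t' ht' E] := IH ht.
have hj' : swaps_at t j <= k * e by rewrite -ltnS swaps_at_lt // ltnS.
rewrite swaps_cons -mulgA E mulgA.
move: (swaps_at t j) hj' => {E}j' hj'.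
suff [t'' ht'' ->] : exists2 t'', valid_swaps k.+1 t'' &
    (D k i None * y k j' = y k (swap_at i j') * swaps k.+1 t'')%g.
  exists (t'' ++ t'); last by rewrite swaps_cat mulgA.
  by rewrite /valid_swaps all_cat; apply/andP.
have hv : valid_swaps k.+1 (iota i e.+1).
  by apply/allP => r; rewrite mem_iota mulSn; lia.
rewrite /swap_at; case: (j' =P i) => [->|ne1].
  by exists (iota i e.+1); [|exact: swap_split].
case: (j' =P i.+1) => [->|ne2].
  exists (rev (iota i e.+1)); last exact: swap_split'.
  by rewrite /valid_swaps all_rev.
case: (ltnP j' i) => hij.
  exists [:: i + e]; first by rewrite /valid_swaps /= mulSn; lia.
  by rewrite /swaps big_seq1 Dyl //= addn2 ltnS.
exists [:: i]; first by rewrite /valid_swaps /= mulSn; lia.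
by rewrite /swaps big_seq1 Dyr //= addn2; lia.
Qed.

End StrandTheory.

Lemma prod_intertwine (G : groupType) (J : eqType) (s : seq J) (a : G) F F' :
  (forall q, q \in s -> F q * a = a * F' q)%g ->
  ((\prod_(q <- s) F q) * a = a * \prod_(q <- s) F' q)%g.
Proof.
elim: s => [|q s IH] h; first by rewrite !big_nil mulg1 mul1g.
rewrite !big_cons -mulgA IH => [|q' hq']; last by rewrite h // inE hq' orbT.
by rewrite !mulgA h // inE eqxx.
Qed.

Section Products.
Variables (e : nat) (L : labels e) (Q : strand L).
Notation I := (lab L).
Notation y := (ysplit e (sY Q)).
Notation D := (sD Q).

Lemma swaps_valid_shift k j (a : I) : j <= k * e ->
  valid_swaps e k.+1 [seq j + i | i <- lswaps a].
Proof.
move=> hj; rewrite /valid_swaps all_map; apply: sub_all (lswaps_lt a) => i /=.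
rewrite mulSn; lia.
Qed.

Lemma swapsV k t : valid_swaps e k t -> ((swaps Q k t)^-1 = swaps Q k (rev t))%g.
Proof.
move=> ht; apply: mulg1_eq; elim: t ht => [|j t IH] /=.
  by rewrite /swaps /rev /= big_nil mulg1.
case/andP=> hj /IH{}IH; rewrite swaps_cons rev_cons -cats1 swaps_cat.
rewrite -mulgA (mulgA (swaps _ _ t)) IH mul1g swaps_cons /swaps big_nil mulg1.
exact: swapK.
Qed.

Lemma labs_swap k i f : i < k * e ->
  (labs Q k f * D k i None = D k i None * labs Q k (f \o swap_at i))%g.
Proof.
move=> hi; pose n := (k * e).+1.
have E g : labs Q k g = ((\prod_(0 <= q < i) D k q (Some (g q))) *
    (D k i (Some (g i)) * (D k i.+1 (Some (g i.+1)) *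
    \prod_(i.+2 <= q < n) D k q (Some (g q)))))%g.
  rewrite /labs (@big_cat_nat _ _ _ i) //=; last by lia.
  by congr (_ * _)%g; rewrite big_ltn 1?big_ltn //; lia.
have hA : (\prod_(0 <= q < i) D k q (Some (f q)) * D k i None =
    D k i None * \prod_(0 <= q < i) D k q (Some ((f \o swap_at i) q)))%g.
  apply: prod_intertwine => q; rewrite mem_index_iota => /andP[_ hq] /=.
  rewrite /swap_at; do 2![case: eqP => [?|_]; first by lia].
  by apply: DD => /=; lia.
have hB : (\prod_(i.+2 <= q < n) D k q (Some (f q)) * D k i None =
    D k i None * \prod_(i.+2 <= q < n) D k q (Some ((f \o swap_at i) q)))%g.
  apply: prod_intertwine => q; rewrite mem_index_iota => /andP[hq hq'] /=.
  rewrite /swap_at; do 2![case: eqP => [?|_]; first by lia].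
  by symmetry; apply: DD => /=; lia.
have s1 : swap_at i i = i.+1 by rewrite /swap_at eqxx.
have s2 : swap_at i i.+1 = i by rewrite /swap_at eqxx; case: eqP => //; lia.
have c1 : (D k i.+1 (Some (f i.+1)) * D k i None =
           D k i None * D k i (Some (f i.+1)))%g by rewrite swap_label.
have c2 : (D k i (Some (f i)) * D k i None =
           D k i None * D k i.+1 (Some (f i)))%g.
  apply: (@mulgI _ (D k i None)); rewrite !mulgA swapK // mul1g.
  by rewrite swap_label // -mulgA swapK // mulg1.
rewrite !E /= s1 s2 -!mulgA hB !mulgA -(mulgA _ (D k i.+1 _) (D k i None)) c1.
rewrite mulgA -(mulgA _ (D k i _) (D k i None)) c2 mulgA hA -!mulgA.
congr (_ * (_ * _))%g; rewrite !mulgA; congr (_ * _)%g.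
by symmetry; apply: DD => /=; lia.
Qed.

Lemma labs_swaps k t f : valid_swaps e k t ->
  (labs Q k f * swaps Q k t = swaps Q k t * labs Q k (f \o swaps_at t))%g.
Proof.
elim: t f => [|i t IH] f /=.
  by rewrite /swaps big_nil mulg1 mul1g.
case/andP=> hi ht; rewrite swaps_cons mulgA labs_swap // -mulgA IH // mulgA.
by [].
Qed.

(** Labels on different strands commute, so the two products can be interleaved and multiplied
    strand by strand. *)
Lemma labs_mul k (f g h : nat -> I) :
  (forall q, q <= k * e -> lmul (f q) (g q) (h q)) ->
  (labs Q k f * labs Q k g = labs Q k h)%g.
Proof.
move=> hm; rewrite /labs.
rewrite [RHS](eq_big_nat _ _
  (F2 := fun q => (D k q (Some (f q)) * D k q (Some (g q)))%g)); last first.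
  by move=> q hq; rewrite (label_mul Q _ (hm q _)).
(* The number of strands in the products is generalized for the induction; the inequality keeps
   every index within level [k]. *)
have: (k * e).+1 <= (k * e).+1 by [].
elim: {1 3 4 5}(_.+1) => [|n IH] hn; first by rewrite !big_nil mulg1.
rewrite !big_nat_recr //= -IH 1?ltnW // -!mulgA; congr (_ * _)%g.
rewrite !mulgA; congr (_ * _)%g; symmetry; apply: prod_intertwine => q.
rewrite mem_index_iota => /andP[_ hq].
by apply: DD => /=; lia.
Qed.

(** By [lmul11] this product is idempotent, and an idempotent of a group is trivial. *)
Lemma labs1 k : labs Q k (fun=> lone L) = 1%g.
Proof.
have := @labs_mul k (fun=> lone L) (fun=> lone L) (fun=> lone L).
move=> /(_ (fun _ _ => lmul11 L)) E; apply: (@mulgI _ (labs Q k (fun=> lone L))).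
by rewrite E mulg1.
Qed.

Lemma labsV k f : ((labs Q k f)^-1 = labs Q k (fun q => linv (f q)))%g.
Proof.
apply: mulg1_eq; rewrite -(labs1 k); apply: labs_mul => q _; exact: lmulV.
Qed.

(** The labels left of [j] keep their index, those to the right move by [e], and the label at [j]
    becomes a permutation of the new strands followed by its sections. The left labels then commute
    with that permutation, which moves only strands to their right. *)
Lemma labs_y k j f : j <= k * e ->
  (labs Q k f * y k j = y k j *
     (swaps Q k.+1 [seq j + i | i <- lswaps (f j)] *
      labs Q k.+1 (split_at e (lsec (l:=L)) j f)))%g.
Proof.
move=> hj; pose n := (k * e).+1; pose f' := split_at e (lsec (l:=L)) j f.
pose t := [seq j + i | i <- lswaps (f j)].
have hE : labs Q k f = ((\prod_(0 <= q < j) D k q (Some (f q))) *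
    (D k j (Some (f j)) * \prod_(j.+1 <= q < n) D k q (Some (f q))))%g.
  rewrite /labs (@big_cat_nat _ _ _ j) //=; last by lia.
  by congr (_ * _)%g; rewrite big_ltn //; lia.
have hE' : labs Q k.+1 f' = ((\prod_(0 <= q < j) D k.+1 q (Some (f q))) *
    ((\prod_(r <- iota 0 e.+1) D k.+1 (j + r) (Some (lsec (f j) r))) *
     \prod_(j.+1 <= q < n) D k.+1 (q + e) (Some (f q))))%g.
  rewrite /labs (@big_cat_nat _ _ _ j) //=; last by rewrite mulSn; lia.
  congr (_ * _)%g.
    by apply: eq_big_nat => q /andP[_ hq]; rewrite /f' /split_at hq.
  rewrite (@big_cat_nat _ _ _ (j + e.+1)) //=; try (rewrite ?mulSn; lia).
  congr (_ * _)%g.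
    rewrite -{1}[j]add0n big_addn addKn /index_iota subn0 [LHS]big_seq [RHS]big_seq.
    apply: eq_bigr => r; rewrite mem_iota => hr; rewrite (addnC r).
    congr (D _ _ (Some _)); rewrite /f' /split_at ifF ?ifT ?addKn //; lia.
  rewrite (_ : j + e.+1 = j.+1 + e); last by lia.
  rewrite big_addn (_ : (k.+1 * e).+1 - e = n); last by rewrite /n mulSn; lia.
  apply: eq_big_nat => q /andP[hq hq']; congr (D _ _ (Some _)).
  by rewrite /f' /split_at ifF ?ifF ?addnK //; lia.
have hB : (\prod_(j.+1 <= q < n) D k q (Some (f q)) * y k j =
    y k j * \prod_(j.+1 <= q < n) D k.+1 (q + e) (Some (f q)))%g.
  by apply: prod_intertwine => q; rewrite mem_index_iota => hq; apply: Dyl => /=; lia.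
have hA : (\prod_(0 <= q < j) D k q (Some (f q)) * y k j =
    y k j * \prod_(0 <= q < j) D k.+1 q (Some (f q)))%g.
  by apply: prod_intertwine => q; rewrite mem_index_iota => hq; apply: Dyr => /=; lia.
have hT : ((\prod_(0 <= q < j) D k.+1 q (Some (f q))) * swaps Q k.+1 t =
    swaps Q k.+1 t * \prod_(0 <= q < j) D k.+1 q (Some (f q)))%g.
  apply: prod_intertwine => q; rewrite mem_index_iota => hq.
  symmetry; apply: prod_intertwine => i /mapP[r hr ->].
  have := allP (lswaps_lt (f j)) _ hr => {}hr.
  by symmetry; apply: DD => /=; rewrite ?mulSn; lia.
rewrite hE hE' -!mulgA hB (mulgA (D k j _)) label_split // -!mulgA.
rewrite mulgA hA -!mulgA; congr (_ * _)%g.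
by rewrite [in LHS]mulgA hT -!mulgA.
Qed.

(** * Coxeter presentation of the symmetric group *)

(* The word of the insertion sort of l, with positions counted from o. *)
Fixpoint sort_word o (l : seq nat) : seq nat :=
  if l is x :: l' then
    rev (iota o (count (fun z => z < x) l')) ++ sort_word o.+1 l'
  else [::].

Fixpoint swap_list i (l : seq nat) : seq nat :=
  match i, l with
  | 0, x :: z :: m => z :: x :: m
  | i.+1, x :: m => x :: swap_list i m
  | _, _ => l
  end.

Lemma size_swap_list i l : size (swap_list i l) = size l.
Proof. by elim: i l => [|i IH] [|x [|z m]] //=; rewrite ?IH //; case: (i). Qed.

Lemma perm_swap_list i l : perm_eq (swap_list i l) l.
Proof.
elim: i l => [|i IH] [|x l] //=; last by rewrite perm_cons.
by case: l => [|z m] //; rewrite -(perm_cat2r [::]) !cats0; apply/permP => p /=; lia.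
Qed.

Lemma nth_swap_list i l q : i.+1 < size l ->
  nth 0 (swap_list i l) q = nth 0 l (swap_at i q).
Proof.
elim: i l q => [|i IH] [|x [|z m]] //=.
  by case=> [|[|q]].
case=> [|q] //= hi; rewrite IH // /swap_at !eqSS.
by case: eqP => // _; case: eqP.
Qed.

Lemma nth_foldl_swap_list t l q : all (fun i => i.+1 < size l) t ->
  nth 0 (foldl (fun l i => swap_list i l) l t) q = nth 0 l (swaps_at t q).
Proof.
elim: t l => [|i t IH] l //= /andP[hi ht].
by rewrite IH ?size_swap_list // nth_swap_list.
Qed.

Lemma far_swaps k i t : (forall j, j \in t -> i.+1 < j < k * e) ->
  (swaps Q k t * D k i None = D k i None * swaps Q k t)%g.
Proof.
move=> h; apply: prod_intertwine => j /h hj.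
by symmetry; apply: DD => /=; lia.
Qed.

(** The letter [i.+1] commutes with the letters below [i], the braid relation turns it into [i] when
    it meets [i.+1, i], and [i] commutes with the remaining larger letters. *)
Lemma run_swap k o b i : o <= i < o + b -> o + b < k * e ->
  (swaps Q k (rev (iota o b.+1)) * D k i.+1 None =
   D k i None * swaps Q k (rev (iota o b.+1)))%g.
Proof.
have rec m : rev (iota o m.+1) = (o + m) :: rev (iota o m).
  by rewrite -addn1 iotaD rev_cat.
have far m j : o + m < j.+1 < k * e ->
    (swaps Q k (rev (iota o m)) * D k j.+1 None =
     D k j.+1 None * swaps Q k (rev (iota o m)))%g.
  move=> hj; apply: prod_intertwine => r; rewrite mem_rev mem_iota => hr.
  by apply: DD => /=; lia.
elim: b => [|b IH] hi hb; first by lia.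
rewrite rec swaps_cons -mulgA.
case: (ltnP i (o + b)) => hib.
  rewrite IH; try lia.
  by rewrite !mulgA; congr (_ * _)%g; symmetry; apply: DD => /=; lia.
have -> : i = o + b by lia.
rewrite addnS rec swaps_cons -mulgA far; try lia.
by rewrite !mulgA; congr (_ * _)%g; rewrite -!mulgA braid //; lia.
Qed.

(** By repeated [run_swap]. It exchanges the insertion runs of the first two entries of a list when
    these entries are swapped. *)
Lemma run_run k o a b : a <= b -> o + b < k * e ->
  (swaps Q k (rev (iota o b.+1)) * swaps Q k (rev (iota o.+1 a)) =
   swaps Q k (rev (iota o a)) * swaps Q k (rev (iota o b.+1)))%g.
Proof.
have rec p m : rev (iota p m.+1) = (p + m) :: rev (iota p m).
  by rewrite -addn1 iotaD rev_cat.
elim: a => [|a IH] hab hb; first by rewrite /swaps !big_nil mulg1 mul1g.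
rewrite !(rec _ a) !swaps_cons mulgA addSn run_swap; try lia.
by rewrite -!mulgA IH //; lia.
Qed.

Lemma mem_sort_word o l i : i \in sort_word o l -> o <= i /\ i.+1 < o + size l.
Proof.
elim: l o => [|x l IH] o //=; rewrite mem_cat mem_rev mem_iota.
have := count_size (fun z => z < x) l; move=> hc /orP[|/IH]; lia.
Qed.

(** The Coxeter relations suffice to follow the sorting word under one swap: swapping two adjacent
    entries multiplies it by one generator on the right. *)
Lemma swaps_sort_word k o l i : uniq l -> i.+1 < size l ->
  o + size l <= (k * e).+1 ->
  swaps Q k (sort_word o (swap_list i l)) =
  (swaps Q k (sort_word o l) * D k (o + i) None)%g.
Proof.
elim: i o l => [|i IH] o [|x l] //=; last first.
  move=> /andP[_ ul] hi ho; rewrite !swaps_cat IH ?addSnnS //.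
  rewrite mulgA; congr (swaps _ _ (rev (iota _ _)) * _ * _)%g.
  by have /permP -> := perm_swap_list i l.
(* If [m] has [a] entries below [z] and [b] below [z'], then [a <= b]. The larger entry in front
   gives runs of lengths [b.+1] and [a]; [run_run] exchanges them, and the last letter [o] of the
   long run is the extra generator. *)
have core z z' m : z < z' -> o + (size m).+2 <= (k * e).+1 ->
    swaps Q k (sort_word o (z' :: z :: m)) =
    (swaps Q k (sort_word o (z :: z' :: m)) * D k o None)%g.
  move=> zz' ho /=; rewrite zz' (_ : (z' < z) = false) ?add0n; last by lia.
  rewrite !swaps_cat -!mulgA far_swaps; last by move=> j /mem_sort_word; lia.
  have hab : count (fun q => q < z) m <= count (fun q => q < z') m.
    by apply: sub_count => q /=; lia.
  have hb := count_size (fun q => q < z') m.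
  rewrite !mulgA add1n run_run //; last by lia.
  congr (_ * _)%g; rewrite -mulgA; congr (_ * _)%g.
  by rewrite /= rev_cons -cats1 swaps_cat /swaps big_seq1.
case: l => [|x' m] // /andP[+ _] _; rewrite inE negb_or addn0 => /andP[ne _] ho.
case: (ltnP x x') => h; first exact: core.
rewrite (core x' x) //; last by rewrite ltn_neqAle eq_sym ne.
by rewrite -mulgA swapK ?mulg1 //; move: ho => /=; lia.
Qed.

(** Completeness of the Coxeter relations. Letting [t] act on a sorted list multiplies its sorting
    word by [swaps Q k t]; a trivial permutation leaves the list as it was, so this factor is 1. *)
Lemma swaps_trivial k t : valid_swaps e k t ->
  (forall q, q <= k * e -> swaps_at t q = q) -> swaps Q k t = 1%g.
Proof.
move=> ht triv; pose n := (k * e).+1.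
have main l : uniq l -> size l = n ->
    swaps Q k (sort_word 0 (foldl (fun l i => swap_list i l) l t)) =
    (swaps Q k (sort_word 0 l) * swaps Q k t)%g.
  elim: t ht {triv} l => [|i t IH] /= ht l ul hl.
    by rewrite [swaps _ _ [::]]big_nil mulg1.
  case/andP: ht => hi ht; rewrite IH ?size_swap_list //; last first.
    by rewrite (perm_uniq (perm_swap_list i l)).
  by rewrite swaps_sort_word ?hl // swaps_cons mulgA.
have E : foldl (fun l i => swap_list i l) (iota 0 n) t = iota 0 n.
  have sz l : size (foldl (fun l i => swap_list i l) l t) = size l.
    by elim: (t) l => [|i t' IH] l //=; rewrite IH size_swap_list.
  apply: (@eq_from_nth _ 0); rewrite sz // size_iota => q hq.
  by rewrite nth_foldl_swap_list ?size_iota // triv.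
have := main _ (iota_uniq 0 n) (size_iota 0 n); rewrite E => h.
by apply: (@mulgI _ (swaps Q k (sort_word 0 (iota 0 n)))); rewrite -h mulg1.
Qed.

End Products.

(** * Trees and normal forms *)

Section Paths.
Variable e : nat.

(** A tree is encoded by successive splittings, each at the index of a leaf of the tree built so
    far. Several paths describe one tree; [path_refine] shows that their values agree. *)
Fixpoint valid_path k (p : seq nat) :=
  if p is i :: p' then (i <= k * e) && valid_path k.+1 p' else true.

Definition split_path T (child : T -> nat -> T) (A : nat -> T) p :=
  foldl (fun A i => split_at e child i A) A p.

Lemma valid_path_cat k p q :
  valid_path k (p ++ q) = valid_path k p && valid_path (k + size p) q.
Proof.
elim: p k => [|i p IH] k /=; first by rewrite addn0.
by rewrite IH andbA addnS.
Qed.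

Lemma split_path_cat T (child : T -> nat -> T) A p q :
  split_path child A (p ++ q) = split_path child (split_path child A p) q.
Proof. by rewrite /split_path foldl_cat. Qed.

(** Each leaf has a budget that its children inherit diminished by one, and only leaves with
    positive budget are split. The weight [mu] drops because one summand [e.+2 ^ n.+1] is replaced
    by [e.+1] summands [e.+2 ^ n]. *)
Lemma refinement_ind (P : nat -> (nat -> nat) -> Prop) :
  (forall k j, (forall i, i <= k * e -> 0 < j i ->
     P k.+1 (split_at e (fun v _ => v.-1) i j)) -> P k j) ->
  forall k j, P k j.
Proof.
move=> step k j.
pose mu k (j : nat -> nat) := \sum_(0 <= q < (k * e).+1) e.+2 ^ j q.
have [n] := ubnP (mu k j); elim: n k j => // n IH k j; rewrite ltnS => hn.
apply: step => i hi ji; apply: IH; apply: leq_trans hn.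
rewrite /mu [ltnRHS](@big_cat_nat _ _ _ i) //=; last by lia.
rewrite [ltnLHS](@big_cat_nat _ _ _ i) //=; last by rewrite mulSn; lia.
rewrite -addnS leq_add //.
  rewrite leq_eqVlt; apply/orP; left; apply/eqP; apply: eq_big_nat => q hq.
  by rewrite /split_at ifT //; lia.
rewrite [leqRHS]big_ltn //.
rewrite (@big_cat_nat _ _ _ (i + e.+1)) //=; try (rewrite ?mulSn; lia).
rewrite -addSn leq_add //.
  rewrite (@eq_big_nat _ _ _ _ _ _ (fun=> e.+2 ^ (j i).-1)); last first.
    by move=> q hq; rewrite /split_at ifF ?ifT //; lia.
  rewrite sum_nat_const_nat addKn -[in leqRHS](prednK ji) expnS.
  by rewrite (mulSn e.+1) -add1n leq_add2r expn_gt0.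
rewrite (_ : i + e.+1 = i.+1 + e); last by lia.
rewrite big_addn (_ : (k.+1 * e).+1 - e = (k * e).+1); last by rewrite mulSn; lia.
rewrite leq_eqVlt; apply/orP; left; apply/eqP; apply: eq_big_nat => q hq.
by rewrite /split_at ifF ?ifF ?addnK //; lia.
Qed.

End Paths.

Section PathValue.
Variables (e : nat) (L : labels e) (Q : strand L).
Notation y := (ysplit e (sY Q)).

Fixpoint path_value k p : Q :=
  if p is i :: p' then (y k i * path_value k.+1 p')%g else 1%g.

Lemma path_value_cat k p q :
  path_value k (p ++ q) = (path_value k p * path_value (k + size p) q)%g.
Proof.
elim: p k => [|i p IH] k /=; first by rewrite mul1g addn0.
by rewrite IH mulgA addnS.
Qed.

(** As [A i] is absent at the end, the path splits it at some moment. Until then it is only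
    displaced by splittings to its left, and the Thompson relation brings its own splitting to the
    front. *)
Lemma split_first T (child : T -> nat -> T) p k A i :
  valid_path e k p -> i <= k * e ->
  (forall q, q <= (k + size p) * e -> split_path e child A p q <> A i) ->
  exists p', [/\ valid_path e k.+1 p', size p = (size p').+1,
    split_path e child A p = split_path e child (split_at e child i A) p' &
    path_value k p = (y k i * path_value k.+1 p')%g].
Proof.
elim: p k A i => [|j p IH] k A i /=.
  by move=> _ hi /(_ i); rewrite addn0 => /(_ hi).
case/andP=> hj hp hi hn.
case: (ltngtP i j) => hij; last first.
- by exists p; rewrite hij.
- have Ai : split_at e child j A (i + e) = A i.
    by rewrite /split_at ifF ?ifF ?addnK //; lia.
  have [|q hq|p' [hp' sp' Ep' vp']] := IH k.+1 (split_at e child j A) (i + e) hp.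
  + by rewrite mulSn; lia.
  + by rewrite Ai; apply: hn; rewrite -addSnnS.
  exists (j :: p'); split => /=.
  + by rewrite hp' andbT mulSn; lia.
  + by rewrite sp'.
  + rewrite Ep' /= (_ : split_at e child j (split_at e child i A) =
      split_at e child (i + e) (split_at e child j A)) //.
    by apply: funext => q; rewrite split_atC.
  + by rewrite vp' mulgA -yY // mulgA.
have Ai : split_at e child j A i = A i by rewrite /split_at hij.
have [|q hq|p' [hp' sp' Ep' vp']] := IH k.+1 (split_at e child j A) i hp.
- by rewrite mulSn; lia.
- by rewrite Ai; apply: hn; rewrite -addSnnS.
exists (j + e :: p'); split => /=.
- by rewrite hp' andbT mulSn; lia.
- by rewrite sp'.
- rewrite Ep' /= (_ : split_at e child (j + e) (split_at e child i A) =
    split_at e child i (split_at e child j A)) //.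
  by apply: funext => q; rewrite [RHS]split_atC.
- by rewrite vp' !mulgA yY.
Qed.

End PathValue.

Section Words.
Variables (e : nat) (X : eqType) (x : nat -> X).
Hypothesis x_inj : forall r s, r <= e -> s <= e -> x r = x s -> r = s.

Definition child (u : seq X) r := rcons u (x r).
Notation split := (split_at e child).
Notation leaves := (split_path e child).

Definition prefix_free n (A : nat -> seq X) :=
  forall q q', q < n -> q' < n -> prefix (A q) (A q') -> q = q'.

Definition origin j q := if q < j then q else if q < j + e.+1 then j else q - e.

Lemma origin_le k j q : j <= k * e -> q <= k.+1 * e -> origin j q <= k * e.
Proof. by rewrite /origin mulSn; do !case: ifP => //; lia. Qed.

Lemma origin_prefix j A q : prefix (A (origin j q)) (split j A q).
Proof.
rewrite /origin /split_at; do !case: ifP => _ //; try exact: prefix_refl.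
by rewrite /child prefix_rcons.
Qed.

Lemma prefix_common (u v w : seq X) :
  prefix u w -> prefix v w -> prefix u v || prefix v u.
Proof.
rewrite !prefixE => /eqP hu /eqP hv.
case: (leqP (size u) (size v)) => h.
  by rewrite -hv take_takel // hu eqxx.
by rewrite -hu take_takel ?hv ?eqxx ?orbT // ltnW.
Qed.

Lemma prefix_size_eq (u v : seq X) : prefix u v -> size v <= size u -> u = v.
Proof. by rewrite prefixE => /eqP E h; rewrite -[LHS]E take_oversize. Qed.

(** Comparable leaves have comparable, hence equal, parents; siblings have equal length and differ
    in the last letter. *)
Lemma prefix_free_split k j A : j <= k * e ->
  prefix_free (k * e).+1 A -> prefix_free (k.+1 * e).+1 (split j A).
Proof.
move=> hj hA q q' hq hq' hp.
have ho : origin j q = origin j q'.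
  have [oq oq'] : origin j q < (k * e).+1 /\ origin j q' < (k * e).+1.
    by rewrite !ltnS !origin_le.
  case/orP: (prefix_common (prefix_trans (origin_prefix j A q) hp)
    (origin_prefix j A q')) => h; first exact: hA.
  by apply/esym; apply: hA.
move: hp ho; rewrite /origin /split_at; do !case: ifP => //; try lia.
move=> h1 h2 h3 h4 hp _.
have := prefix_size_eq hp; rewrite /child !size_rcons leqnn => /(_ isT).
case/rcons_inj => hx; have : q - j = q' - j by apply: x_inj hx; lia.
lia.
Qed.

Lemma prefix_free_path k p A : valid_path e k p ->
  prefix_free (k * e).+1 A -> prefix_free ((k + size p) * e).+1 (leaves A p).
Proof.
elim: p k A => [|j p IH] k A /=; first by rewrite addn0.
case/andP=> hj hp hA; rewrite -addSnnS; apply: IH => //.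
exact: prefix_free_split.
Qed.

(** The last hypothesis says that no leaf of [r] is a proper prefix of a leaf of [p]: the tree of
    [r] refines that of [p]. Every splitting of [p] then occurs in [r], and [split_first] moves it
    to the front. *)
Lemma path_refine (L : labels e) (Q : strand L) p r k A :
  valid_path e k p -> valid_path e k r -> prefix_free (k * e).+1 A ->
  (forall q q', q <= (k + size p) * e -> q' <= (k + size r) * e ->
     prefix (leaves A r q') (leaves A p q) -> leaves A r q' = leaves A p q) ->
  exists s, [/\ valid_path e (k + size p) s, size p + size s = size r,
    leaves (leaves A p) s = leaves A r &
    path_value Q k r = (path_value Q k p * path_value Q (k + size p) s)%g].
Proof.
elim/last_ind: p => [|p i IH] hp hr hA hle.
  by exists r; rewrite addn0 add0n /= mul1g.
have /andP[{}hp /andP[hi _]] : valid_path e k p && ((i <= (k + size p) * e) && true).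
  by move: hp; rewrite -cats1 valid_path_cat.
have E : leaves A (rcons p i) = split i (leaves A p).
  by rewrite -cats1 split_path_cat.
have szp : (k + size (rcons p i)) * e = (k + size p) * e + e.
  by rewrite size_rcons addnS mulSn addnC.
have h0 : split i (leaves A p) i = child (leaves A p i) 0.
  by rewrite /split_at ltnn ifT ?subnn //; lia.
have hi' : i <= (k + size (rcons p i)) * e by rewrite szp; lia.
(* The leaf split by the last step of [p] is a proper prefix of its child at index [i], so it cannot
   be a leaf of [r]. *)
have gone q' : q' <= (k + size r) * e -> leaves A r q' <> leaves A p i.
  move=> hq' h; have := hle i q' hi' hq'.
  rewrite E h0 h /child prefix_rcons => /(_ isT)/(congr1 size).
  by rewrite size_rcons; lia.
have [|s [hs ss Es vs]] := IH hp hr hA.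
  move=> q q' hq hq' hpre; case: (ltngtP q i) => hqi.
  - by have := hle q q'; rewrite E szp /split_at hqi; apply => //; lia.
  - have := hle (q + e) q'; rewrite E szp /split_at.
    by rewrite ifF ?ifF ?addnK; [|lia..]; apply => //; lia.
  - have := hle i q' hi' hq'; rewrite E h0; rewrite hqi in hpre *.
    move=> /(_ (prefix_trans hpre (prefix_rcons _ _))) H.
    by have := size_prefix hpre; rewrite H /child ?size_rcons; lia.
have [q hq|s' [hs' ss' Es' vs']] := split_first Q (A := leaves A p) (child := child) hs hi.
  by rewrite Es; apply: gone; rewrite -ss addnA.
exists s'; rewrite size_rcons addnS; split => //.
- by rewrite -ss ss' addnS addSn.
- by rewrite E -Es' Es.
- by rewrite vs vs' -cats1 path_value_cat /= mulg1 mulgA.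
Qed.

Definition root (q : nat) : seq X := [::].

Lemma prefix_free_root : prefix_free (0 * e).+1 root.
Proof. by move=> q q'; rewrite mul0n; lia. Qed.

Lemma deep_path m k A : exists2 p, valid_path e k p &
  forall q, q <= (k + size p) * e -> m <= size (leaves A p q).
Proof.
pose P k j := forall A : nat -> seq X, (forall q, j q = m - size (A q)) ->
  exists2 p, valid_path e k p &
    forall q, q <= (k + size p) * e -> m <= size (leaves A p q).
suff: P k (fun q => m - size (A q)) by apply.
apply: (@refinement_ind e P) => {k A} k j IH A hj.
have [[i hi]|none] := pselect (exists2 i, i <= k * e & 0 < j i); last first.
  exists [::] => //; rewrite addn0 /= => q hq.
  by rewrite leqNgt; apply/negP => h; apply: none; exists q => //; rewrite hj subn_gt0.
move=> ji; have [|p hp hd] := IH i hi ji (split i A).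
  move=> q; rewrite /split_at /child; do 2!case: ifP => // _.
  by rewrite size_rcons hj subnS.
by exists (i :: p); rewrite /= ?hi //; move=> q hq; apply: hd; rewrite addSnnS.
Qed.

(** Once the leaves of an extension of [p] are at least as long as all leaves of [q], the extended
    tree refines that of [q]. *)
Lemma common_refinement (L : labels e) (Q : strand L) p q :
  valid_path e 0 p -> valid_path e 0 q ->
  exists s s', [/\ valid_path e (size p) s, valid_path e (size q) s',
    size (p ++ s) = size (q ++ s') &
    path_value Q 0 (p ++ s) = path_value Q 0 (q ++ s')].
Proof.
move=> hp hq; pose m := \max_(r < (size q * e).+1) size (leaves root q r).
have [s hs hd] := deep_path m (size p) (leaves root p).
have hps : valid_path e 0 (p ++ s) by rewrite valid_path_cat hp.
have [r r' hr hr'|s' [hs' ss' _ vs']] :=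
    path_refine Q hq hps prefix_free_root (A := root).
  rewrite split_path_cat => hpre; apply: prefix_size_eq => //.
  apply: leq_trans (hd _ _); last by rewrite -size_cat.
  exact: (leq_bigmax (Ordinal (hr : r < (size q * e).+1))).
exists s, s'; split=> //; first by rewrite [RHS]size_cat ss'.
by rewrite vs' path_value_cat.
Qed.

(** Equal sets of leaves make [q] a refinement of [p], by an empty path since the sizes agree. The
    two lists of leaves then coincide in order, and prefix-freeness leaves no room for a
    permutation. *)
Lemma leaves_perm_eq (L : labels e) (Q : strand L) p q t :
  valid_path e 0 p -> valid_path e 0 q -> size p = size q ->
  valid_swaps e (size p) t ->
  (forall r, r <= size p * e -> leaves root p (swaps_at t r) = leaves root q r) ->
  path_value Q 0 p = path_value Q 0 q /\ forall r, r <= size p * e -> swaps_at t r = r.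
Proof.
move=> hp hq spq ht E.
have fp := prefix_free_path hp prefix_free_root.
have fq := prefix_free_path hq prefix_free_root.
have st r : r <= size p * e -> swaps_at t r <= size p * e.
  by move=> hr; rewrite -ltnS swaps_at_lt // ltnS.
have [r r' hr hr' hpre|s [_ ss Es vs]] :=
    path_refine Q hp hq prefix_free_root (A := root).
  have htr : valid_swaps e (size p) (rev t) by rewrite /valid_swaps all_rev.
  pose r0 := swaps_at (rev t) r.
  have hr0 : r0 <= size p * e by rewrite -ltnS swaps_at_lt // ltnS.
  have er : swaps_at t r0 = r.
    by rewrite /r0 -{1}[t]revK swaps_at_rev.
  rewrite -er E // in hpre *; rewrite (fq _ _ _ _ hpre) //.
  by rewrite add0n -spq ltnS.
have s0 : s = [::] by apply: size0nil; lia.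
subst s; rewrite /= in Es; split; first by rewrite vs mulg1.
move=> r hr; apply: fp; rewrite ?ltnS ?st //.
by rewrite E // -Es prefix_refl.
Qed.

End Words.

(** * Normal forms in a strand system *)

Section NormalForm.
Variables (e : nat) (L : labels e) (Q : strand L).
Notation I := (lab L).
Notation y := (ysplit e (sY Q)).
Notation D := (sD Q).
Notation swaps := (swaps Q).
Notation labs := (labs Q).
Notation path_value := (path_value Q).

Lemma swaps_labs_y k t f i : valid_swaps e k t -> i <= k * e ->
  exists i' t' f', [/\ i' <= k * e, valid_swaps e k.+1 t' &
   (swaps k t * labs k f * y k i = y k i' * swaps k.+1 t' * labs k.+1 f')%g].
Proof.
move=> ht hi; have [t' ht' Et] := swaps_y Q ht hi.
exists (swaps_at t i), (t' ++ [seq i + r | r <- lswaps (f i)]).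
exists (split_at e (lsec (l:=L)) i f); split.
- by rewrite -ltnS swaps_at_lt // ltnS.
- by rewrite /valid_swaps all_cat; apply/andP; split => //; apply: swaps_valid_shift.
by rewrite -mulgA labs_y // mulgA Et swaps_cat !mulgA.
Qed.

Lemma swaps_labs_path p k t f : valid_swaps e k t -> valid_path e k p ->
  exists p' t' f', [/\ valid_path e k p', size p' = size p,
    valid_swaps e (k + size p) t' &
    (swaps k t * labs k f * path_value k p =
     path_value k p' * swaps (k + size p) t' * labs (k + size p) f')%g].
Proof.
elim: p k t f => [|i p IH] k t f ht /=.
  by exists [::], t, f; rewrite addn0 mulg1 mul1g.
case/andP=> hi hp; have [i' [t1 [f1 [hi' ht1 E]]]] := swaps_labs_y f ht hi.
have [p' [t' [f' [hp' sp' ht' E']]]] := IH k.+1 t1 f1 ht1 hp.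
exists (i' :: p'), t', f'; rewrite /= hi' hp' sp' addnS -addSn; split => //.
by rewrite mulgA E -!mulgA; congr (_ * _)%g; rewrite !mulgA E'.
Qed.

(* The only use of contraction, through ldepth. *)
Lemma labs_contract k t f g : valid_swaps e k t ->
  exists p p' t' f', [/\ valid_path e k p, valid_path e k p', size p = size p',
    valid_swaps e (k + size p) t' &
    (swaps k t * labs k f * labs k g * path_value k p =
     path_value k p' * swaps (k + size p) t' * labs (k + size p) f')%g].
Proof.
pose P k j := forall t f g, valid_swaps e k t ->
  (forall q, q <= k * e -> ldepth (j q) (f q) (g q)) ->
  exists p p' t' f', [/\ valid_path e k p, valid_path e k p', size p = size p',
    valid_swaps e (k + size p) t' &
    (swaps k t * labs k f * labs k g * path_value k p =
     path_value k p' * swaps (k + size p) t' * labs (k + size p) f')%g].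
have [j hj] := choice (fun q => ldepth_ex (f q) (g q)).
suff H : P k j by move=> ht; apply: H.
move=> {hj}; apply: (@refinement_ind e P) => {k t f g} k {}j IH t f g ht hj.
have [[i hi ji]|none] := pselect (exists2 i, i <= k * e & 0 < j i); last first.
  (* No strand has budget left, so every product of labels is itself a label by [ldepth0]. *)
  have /choice[h hh] q : exists c, q <= k * e -> lmul (f q) (g q) c.
    case: (leqP q (k * e)) => hq; last by exists (lone L).
    have j0 : j q = 0.
      by case: (posnP (j q)) => // jq; case: none; exists q.
    by have := hj q hq; rewrite j0 => /ldepth0[c hc]; exists c.
  exists [::], [::], t, h; rewrite addn0 /= mulg1 mul1g; split => //.
  by rewrite -!mulgA (labs_mul Q hh).
have [t0 ht0 Et] := swaps_y Q ht hi.
pose sf := split_at e (lsec (l:=L)) i.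
pose tf := [seq i + r | r <- lswaps (f i)].
pose tg := [seq i + r | r <- lswaps (g i)].
have hi' : swaps_at t i <= k * e by rewrite -ltnS swaps_at_lt // ltnS.
have vtf : valid_swaps e k.+1 tf by apply: swaps_valid_shift.
have vtg : valid_swaps e k.+1 tg by apply: swaps_valid_shift.
(* The sections of [f] must pass the permutation [tg] created by [g]. Strand [i + r] thus carries
   the pair [lsec (f i) (lperm (g i) r)], [lsec (g i) r], which is the pair in [ldepthS]. *)
have E : (swaps k t * labs k f * labs k g * y k i = y k (swaps_at t i) *
    (swaps k.+1 (t0 ++ tf ++ tg) * labs k.+1 (sf f \o swaps_at tg) *
     labs k.+1 (sf g)))%g.
  rewrite -!mulgA (labs_y Q g hi) (mulgA (labs k f)) (labs_y Q f hi) -!mulgA.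
  rewrite mulgA Et !swaps_cat -!mulgA; congr (_ * (_ * (_ * _)))%g.
  by rewrite [LHS]mulgA (labs_swaps Q (sf f) vtg) -!mulgA.
have [||p [p' [t' [f' [hp hp' spp ht' E']]]]] :=
    IH i hi ji (t0 ++ tf ++ tg) (sf f \o swaps_at tg) (sf g).
- by rewrite /valid_swaps !all_cat; apply/and3P.
- move=> q hq /=; rewrite /sf /split_at.
  case: (ltnP q i) => hqi.
    rewrite (@swaps_at_out i e) ?hqi //; last exact: lswaps_lt.
    by apply: hj; lia.
  case: (ltnP q (i + e.+1)) => hqe.
    have hr : q - i <= e by lia.
    have -> : swaps_at tg q = i + lperm (g i) (q - i).
      by rewrite -{1}(subnKC hqi) swaps_at_shift lswapsE.
    have hl := lperm_le (g i) hr; rewrite ifF ?ifT; [|lia..].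
    by rewrite addKn; apply: ldepthS => //; rewrite prednK //; apply: hj.
  rewrite (@swaps_at_out i e); [|exact: lswaps_lt|by lia].
  rewrite ifF ?ifF; [|lia..].
  by apply: hj; move: hq; rewrite mulSn; lia.
exists (i :: p), (swaps_at t i :: p'), t', f'; rewrite /= hi hi' hp hp' spp.
rewrite addnS -addSn -spp; split => //.
by rewrite mulgA E -!mulgA; congr (_ * _)%g; rewrite !mulgA E'.
Qed.

Definition normal_form (x : Q) := exists p q t f,
  [/\ valid_path e 0 p, valid_path e 0 q, size p = size q,
    valid_swaps e (size p) t &
    x = (path_value 0 p * swaps (size p) t * labs (size p) f
         / path_value 0 q)%g].

(** The value of [s] is inserted together with its inverse, and the first copy is pushed to the left
    through the labels and the permutation. *)
Lemma normal_form_expand p q t f s :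
  valid_path e 0 p -> valid_path e (size q) s -> size p = size q ->
  valid_swaps e (size p) t ->
  exists p' t' f', [/\ valid_path e 0 p', size p' = size (q ++ s),
    valid_swaps e (size p') t' &
    (path_value 0 p * swaps (size p) t * labs (size p) f / path_value 0 q =
     path_value 0 p' * swaps (size p') t' * labs (size p') f'
       / path_value 0 (q ++ s))%g].
Proof.
move=> hp hs spq ht; rewrite -spq in hs.
have [s' [t' [f' [hs' ss' ht' E]]]] := swaps_labs_path f ht hs.
have sz : size (p ++ s') = size p + size s by rewrite size_cat ss'.
exists (p ++ s'), t', f'; rewrite sz size_cat -spq; split => //.
  by rewrite valid_path_cat hp.
rewrite !path_value_cat add0n -spq -!mulgA; congr (_ * _)%g.
by rewrite !mulgA -E invgM -!mulgA mulVKg.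
Qed.

(** With a common refinement as denominator the denominators cancel. The labels of both factors are
    moved to the right of the permutations, and [labs_contract] multiplies them after both remaining
    trees have been extended. Products and inverses are special cases of quotients. *)
Lemma normal_form_div x z : normal_form x -> normal_form z -> normal_form (x / z)%g.
Proof.
move=> [p [q [t [f [hp hq spq ht ->]]]]] [p' [q' [t' [f' [hp' hq' spq' ht' ->]]]]].
have [s [s' [hs hs' sz E]]] :=
  common_refinement id Q hq hq'.
have [p1 [t1 [f1 [hp1 sp1 ht1 ->]]]] := normal_form_expand f hp hs spq ht.
have [p2 [t2 [f2 [hp2 sp2 ht2 ->]]]] := normal_form_expand f' hp' hs' spq' ht'.
pose n := size p1; have en : size p2 = n by rewrite /n sp1 sp2.
rewrite E !invgM invgK -!mulgA mulKg en; rewrite en in ht2.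
have v2 : valid_swaps e n (rev t2) by rewrite /valid_swaps all_rev.
pose g1 := f1 \o swaps_at (rev t2); pose g2 := (fun q => linv (f2 q)) \o swaps_at (rev t2).
have v12 : valid_swaps e n (t1 ++ rev t2) by rewrite /valid_swaps all_cat; apply/andP.
have [r [r' [t3 [f3 [hr hr' srr ht3 E3]]]]] := labs_contract g1 g2 v12.
exists (p1 ++ r'), (p2 ++ r), t3, f3.
rewrite size_cat -srr -/n; split.
- by rewrite valid_path_cat hp1.
- by rewrite valid_path_cat hp2 en.
- by rewrite size_cat en.
- by [].
rewrite !path_value_cat !add0n en -/n -!mulgA; congr (_ * _)%g.
have E4 : (swaps n t1 * labs n f1 * (labs n f2)^-1 * (swaps n t2)^-1 =
    swaps n (t1 ++ rev t2) * labs n g1 * labs n g2)%g.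
  rewrite labsV swapsV // -!mulgA (labs_swaps Q _ v2) (mulgA (labs n f1)).
  by rewrite (labs_swaps Q _ v2) swaps_cat -!mulgA.
rewrite invgM !mulgA -E3 -E4 -!mulgA; congr (_ * (_ * (_ * (_ * _))))%g.
by rewrite mulVKg.
Qed.

Lemma normal_form1 : normal_form 1%g.
Proof.
exists [::], [::], [::], (fun=> lone L); split => //=.
by rewrite /swaps big_nil labs1 !mul1g invg1.
Qed.

Lemma normal_formM x z : normal_form x -> normal_form z -> normal_form (x * z)%g.
Proof.
move=> hx hz; rewrite -[z]invgK -[z^-1%g]mul1g.
by apply: normal_form_div => //; apply: normal_form_div => //; apply: normal_form1.
Qed.

Lemma normal_formV x : normal_form x -> normal_form (x^-1)%g.
Proof. by move=> hx; rewrite -[x^-1%g]mul1g; apply: normal_form_div => //; apply: normal_form1. Qed.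

Definition vine k := [seq r * e | r <- iota 0 k].

Lemma size_vine k : size (vine k) = k.
Proof. by rewrite size_map size_iota. Qed.

Lemma vineS k : vine k.+1 = rcons (vine k) (k * e).
Proof. by rewrite /vine -addn1 iotaD map_cat cats1. Qed.

Lemma valid_vine k : valid_path e 0 (vine k).
Proof.
elim: k => [|k IH] //.
by rewrite vineS -cats1 valid_path_cat IH /= size_vine add0n leqnn.
Qed.

Lemma vine_value k : path_value 0 (vine k) = 1%g.
Proof.
elim: k => [|k IH] //; rewrite vineS -cats1 path_value_cat IH /= size_vine add0n.
by rewrite /ysplit ltnn !mulg1.
Qed.

Lemma normal_formY k i : i < k * e -> normal_form (sY Q i).
Proof.
move=> hi; exists (rcons (vine k) i), (vine k.+1), [::], (fun=> lone L).
rewrite valid_vine size_rcons !size_vine vine_value; split => //.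
  by rewrite -cats1 valid_path_cat valid_vine /= size_vine add0n ltnW.
rewrite /swaps big_nil labs1 invg1 !mulg1 -cats1 path_value_cat vine_value /=.
by rewrite size_vine add0n mul1g mulg1 /ysplit hi.
Qed.

Lemma normal_formD k i c : i + width c <= (k * e).+1 -> normal_form (D k i c).
Proof.
move=> hi; exists (vine k), (vine k).
case: c hi => [g|] /= hi.
  exists [::], (fun q => if q == i then g else lone L).
  rewrite valid_vine size_vine vine_value mul1g invg1 mulg1; split => //.
  rewrite /swaps big_nil mul1g /labs (@big_cat_nat _ _ _ i) //=; last by lia.
  have l1 q : q <= k * e -> D k q (Some (lone L)) = 1%g.
    move=> hq; apply: (@mulgI _ (D k q (Some (lone L)))).
    by rewrite (label_mul Q hq (lmul11 L)) mulg1.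
  rewrite big_nat big1 ?mul1g; last first.
    by move=> q hq; rewrite ifF ?l1 //; lia.
  rewrite big_ltn; last by lia.
  rewrite eqxx big_nat big1 ?mulg1 // => q hq.
  by rewrite ifF ?l1 //; lia.
exists [:: i], (fun=> lone L).
rewrite valid_vine size_vine vine_value mul1g invg1 mulg1 labs1 mulg1; split => //.
  by rewrite /valid_swaps /=; lia.
by rewrite /swaps big_seq1.
Qed.

End NormalForm.

Lemma conjg_eq (G : groupType) (x y z : G) : (x ^ y = z)%g <-> (x * y = y * z)%g.
Proof. by rewrite conjgC; split=> [->|/mulgI]. Qed.

Section LocalWindow.
Variables (e : nat) (L : labels e).

(** A window of [W] strands has [W + e] strands after a splitting inside it. This is all that the
    extension to higher levels uses about the shape of local relations. *)
Definition in_window W (l : rletter L) :=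
  let: (h, a, c) := l in
  (h <= 1) && (a + (if c is Some c then width c else 1) <= W + h * e).

Lemma local_rel_window W u v : local_rel W u v ->
  [/\ W <= 3, all (in_window W) u & all (in_window W) v].
Proof.
have hi w a n (f : nat -> rletter L) :
    (forall r, a <= r < a + n -> in_window w (f r)) ->
    all (in_window w) [seq f r | r <- iota a n].
  by move=> H; rewrite all_map; apply/allP => r; rewrite mem_iota => /H.
case=> *; split => //=; first by apply: hi => r hr /=; lia.
rewrite all_cat; apply/andP; split.
  by rewrite all_map; apply: sub_all (lswaps_lt _) => r /=; lia.
by apply/andP; split; [rewrite /=; lia|apply: hi => r hr /=; lia].
Qed.

End LocalWindow.

(** * Extension of a bounded strand system *)

(* Letters of high level are conjugates, by powers of Y 0, of letters of level
   at most J. When two strands are far apart, their relation follows from that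
   of closer strands by conjugating with a splitting in the gap between them;
   J >= 8 leaves room for this gap. *)
Section Extension.
Variables (e : nat) (L : labels e) (Q : groupType).
Variables (Y : nat -> Q) (D : nat -> nat -> option (lab L) -> Q) (J : nat).
Hypotheses (e0 : 0 < e) (J8 : 8 <= J).
Hypothesis base : forall k, k < J -> strand_axioms_at Y D k.
Notation y0 := (Y 0).

(** Here [n] is fuel: the index falls by [e > 0] at each step, so [n = i] suffices. *)
Fixpoint extY_rec n i : Q :=
  if n is n'.+1 then if i < J * e then Y i else (extY_rec n' (i - e) ^ y0)%g
  else Y i.

Definition extY i := extY_rec i i.

(** The test is [e < i] because the strand [i - e] has to lie to the right of strand 0, which [Y 0]
    splits. Decorations further left keep their value when the level grows. *)
Fixpoint extD k i c : Q :=
  if k is k'.+1 then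
    if k' < J then D k i c
    else if e < i then (extD k' (i - e) c ^ y0)%g else extD k' i c
  else D k i c.

Lemma extY_base i : i < J * e -> extY i = Y i.
Proof. by rewrite /extY; case: i => //= i ->. Qed.

Lemma extD_base k i c : k <= J -> extD k i c = D k i c.
Proof. by case: k => //= k ->. Qed.

Lemma extD_step k i c : J <= k ->
  extD k.+1 i c = if e < i then (extD k (i - e) c ^ y0)%g else extD k i c.
Proof. by move=> hk; rewrite /= ltnNge hk. Qed.

Lemma extY_step i : J * e <= i -> extY i = (extY (i - e) ^ y0)%g.
Proof.
have irr n m j : j <= n -> j <= m -> extY_rec n j = extY_rec m j.
  elim: n m j => [|n IH] [|m] j //=; rewrite ?leqn0; try by move=> /eqP ->; case: ifP => //; rewrite muln_gt0; lia.
    by move=> _ /eqP ->; case: ifP => //; rewrite muln_gt0; lia.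
  by move=> hn hm; case: ifP => // hj; congr (_ ^ _)%g; apply: IH; lia.
move=> hi; have J0 : 0 < J * e by rewrite muln_gt0; lia.
case: i hi => [|i] hi; first by lia.
rewrite {1}/extY [LHS]/= ifF; last by lia.
by congr (_ ^ _)%g; apply: irr; lia.
Qed.

Lemma baseYY i j : i < j -> j < J.-1 * e -> (Y j ^ Y i)%g = Y (j + e).
Proof.
move=> ij hj; apply/conjg_eq.
have := ax_YY (base (k := J.-1) _) ij (ltnW hj).
have -> : J.-1.+1 = J by lia.
have hJ : J * e = J.-1 * e + e by case: (J) J8 => // n _; rewrite mulSn addnC.
by rewrite /ysplit hj !ifT; try lia; apply; lia.
Qed.

Lemma Jn n : n <= J -> J * e = (J - n) * e + n * e.
Proof. by move=> h; rewrite -mulnDl subnK. Qed.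

Lemma extY0 : extY 0 = y0. Proof. by []. Qed.

Lemma extY_shift j : 0 < j -> (extY j ^ y0)%g = extY (j + e).
Proof.
move=> hj; have := Jn (n := 1) ltac:(lia); rewrite subn1 mul1n => hJ.
case: (ltnP j (J.-1 * e)) => h.
  by rewrite !extY_base ?baseYY //; lia.
by rewrite [RHS]extY_step ?addnK //; lia.
Qed.

Lemma extYY_shift i j : 0 < i -> i < j ->
  (extY j ^ extY i)%g = extY (j + e) ->
  (extY (j + e) ^ extY (i + e))%g = extY (j + e + e).
Proof.
move=> hi hj E; have j0 : 0 < j by lia.
rewrite -(extY_shift hi) -{1}(extY_shift j0) -conjJg E extY_shift //; lia.
Qed.

Lemma extYY i j : i < j -> (extY j ^ extY i)%g = extY (j + e).
Proof.
have h1 := Jn (n := 1) ltac:(lia); rewrite subn1 mul1n in h1.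
have h3 := Jn (n := 4) ltac:(lia).
have h4 : 4 * 1 <= (J - 4) * e by apply: leq_mul; lia.
elim/ltn_ind: j i => j IH i ij.
case: (posnP i) => [->|i0]; first by rewrite extY0 extY_shift //; lia.
case: (ltnP e i) => hei.
  have E := IH (j - e) ltac:(lia) (i - e) ltac:(lia).
  have := extYY_shift _ _ E; rewrite !subnK; try lia.
  by apply; lia.
case: (ltnP j (J.-1 * e)) => hj.
  by rewrite !extY_base ?baseYY //; lia.
(* Now [0 < i <= e] and [j] is large, so [e.+1] lies in the gap. [Y j] is the conjugate of
   [Y (j - e)] by [Y e.+1]; conjugation by [Y i] moves both by [e], and a shifted instance of the
   hypothesis concludes. *)
have E1 := IH (j - e) ltac:(lia) e.+1 ltac:(lia).
have E2 := IH e.+1 ltac:(lia) i ltac:(lia).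
have E3 := IH (j - e) ltac:(lia) i ltac:(lia).
rewrite subnK in E1; last by lia.
rewrite subnK in E3; last by lia.
rewrite -{1}E1 conjJg E2 E3.
have := @extYY_shift e.+1 (j - e); rewrite subnK; last by lia.
by apply => //; lia.
Qed.

Lemma extD_shift k i c : 0 < i -> i + width c <= (k * e).+1 ->
  extD k.+1 (i + e) c = (extD k i c ^ y0)%g.
Proof.
move=> hi hw; case: (ltnP k J) => hk; last first.
  by rewrite extD_step // ifT ?addnK //; lia.
rewrite !extD_base //; last by lia.
have k0 : 0 < k * e by case: (c) hw => /=; lia.
by symmetry; apply/conjg_eq; have := ax_DYl (base hk) hi hw; rewrite /ysplit k0.
Qed.

(** Below level [J] this is [ax_DYr] at the last strand, whose splitting is trivial; above, the
    definition and [extD_shift] propagate it. *)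
Lemma extD_stable k i c : i + width c <= k * e -> extD k.+1 i c = extD k i c.
Proof.
have wc : 0 < width c by case: (c).
have b0 k' i' : k' < J -> i' + width c <= k' * e -> D k'.+1 i' c = D k' i' c.
  move=> hk hw; have := ax_DYr (base hk) hw (leqnn _).
  by rewrite /ysplit ltnn mulg1 mul1g.
elim: k i => [|k IH] i hw; first by lia.
case: (ltnP k.+1 J) => hk; first by rewrite !extD_base; [exact: b0|lia..].
rewrite extD_step //; case: ifP => // hi.
have [hk' hw'] : 0 < i - e /\ i - e + width c <= k * e.
  by move: hw; rewrite mulSn; lia.
by rewrite IH // -extD_shift ?subnK //; lia.
Qed.

Lemma extD_left_shift k i j c : 0 < j -> j < i -> i + width c <= (k * e).+1 ->
  extD k.+1 (i + e) c = (extD k i c ^ extY j)%g ->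
  extD k.+2 (i + e + e) c = (extD k.+1 (i + e) c ^ extY (j + e))%g.
Proof.
move=> hj hi hw E; rewrite extD_shift ?mulSn; try lia.
rewrite {1}E (extD_shift _ hw) 1?(ltn_trans hj) //.
by rewrite -extY_shift // conjJg.
Qed.

Lemma extD_left k i j c : j < i -> i + width c <= (k * e).+1 ->
  extD k.+1 (i + e) c = (extD k i c ^ extY j)%g.
Proof.
have wc : 0 < width c <= 2 by case: (c).
have h6 := Jn (n := 6) ltac:(lia).
have h7 : 2 * e <= (J - 6) * e by rewrite leq_mul2r; lia.
elim/ltn_ind: k i j => k IH i j ij hw.
case: (posnP j) => [->|j0]; first by rewrite extY0 extD_shift //; lia.
case: (ltnP k J) => hk.
  rewrite !extD_base //; try lia.
  have hkJ : k * e <= J.-1 * e by rewrite leq_mul2r; lia.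
  have := Jn (n := 1) ltac:(lia); rewrite subn1 mul1n => hJ.
  rewrite extY_base; last by lia.
  symmetry; apply/conjg_eq; have := ax_DYl (base hk) ij hw.
  by rewrite /ysplit ifT //; lia.
have hkk : J * e <= k * e by rewrite leq_mul2r hk orbT.
have hk1 : k.-1.+1 = k by lia.
have hk1e : k * e = k.-1 * e + e by rewrite -{1}hk1 mulSn addnC.
case: (ltnP e j) => hej.
  have E := IH k.-1 ltac:(lia) (i - e) (j - e) ltac:(lia) ltac:(lia).
  have := extD_left_shift _ _ _ E; rewrite hk1 !subnK; try lia.
  by apply; lia.
case: (leqP (i + width c) (k.-1 * e)) => hb.
  have := IH k.-1 ltac:(lia) i j ij ltac:(lia); rewrite hk1 => E.
  rewrite extD_stable ?E; last by lia.
  by rewrite -{2}hk1 extD_stable.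
(* The decoration is at the right end while [0 < j <= e]: it is written as a conjugate by the
   splitting [e.+1] in the gap, as for splittings. *)
have E1 := IH k.-1 ltac:(lia) (i - e) e.+1 ltac:(lia) ltac:(lia).
have E3 := IH k.-1 ltac:(lia) (i - e) j ltac:(lia) ltac:(lia).
rewrite hk1 subnK in E1; last by lia.
rewrite hk1 subnK in E3; last by lia.
rewrite {1}E1 conjJg extYY; last by lia.
rewrite -E3.
have := @extD_left_shift k.-1 (i - e) e.+1 c; rewrite hk1 subnK; try lia.
by apply => //; lia.
Qed.

Lemma extD_right k i j c : i + width c <= j -> j < k * e ->
  (extD k i c ^ extY j)%g = extD k i c.
Proof.
have wc : 0 < width c <= 2 by case: (c).
have h6 := Jn (n := 6) ltac:(lia).
have h7 : 2 * e <= (J - 6) * e by rewrite leq_mul2r; lia.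
elim/ltn_ind: k i j => k IH i j ij hw.
case: (ltnP k J) => hk.
  have hkJ : k * e <= J.-1 * e by rewrite leq_mul2r; lia.
  have := Jn (n := 1) ltac:(lia); rewrite subn1 mul1n => hJ.
  rewrite extY_base; last by lia.
  apply/conjg_eq; have := ax_DYr (base hk) ij (ltnW hw).
  rewrite /ysplit ifT // extD_base; last by lia.
  move=> ->; rewrite -(extD_base (k := k.+1)) // extD_stable ?extD_base //; lia.
have hkk : J * e <= k * e by rewrite leq_mul2r hk orbT.
have hk1 : k.-1.+1 = k by lia.
have hk1e : k * e = k.-1 * e + e by rewrite -{1}hk1 mulSn addnC.
case: (ltnP e i) => hei.
  have E := IH k.-1 ltac:(lia) (i - e) (j - e) ltac:(lia) ltac:(lia).
  have := @extD_shift k.-1 (i - e) c; rewrite hk1 subnK; last by lia.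
  move=> ->; try lia.
  have := @extY_shift (j - e); rewrite subnK; last by lia.
  by move=> <-; [rewrite -conjJg E|lia].
case: (ltnP j (k.-1 * e)) => hj.
  by rewrite -hk1 extD_stable; [apply: IH|]; lia.
(* The splitting at [i + width c], just right of the decoration, lies in the gap. [Y j] is the
   conjugate by it of [Y (j - e)], and the decoration commutes with both. *)
have Em : (extD k i c ^ extY (i + width c))%g = extD k i c.
  by rewrite -hk1 extD_stable; [apply: IH|]; lia.
have Ej : (extD k i c ^ extY (j - e))%g = extD k i c.
  by rewrite -hk1 extD_stable; [apply: IH|]; lia.
have := @extYY (i + width c) (j - e); rewrite subnK; last by lia.
move=> <-; last by lia.
rewrite -{1}Em -conjJg Ej; exact: Em.
Qed.

Lemma extDD k i j c c' : i + width c <= j -> j + width c' <= (k * e).+1 ->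
  commute (extD k i c) (extD k j c').
Proof.
have wc : 0 < width c <= 2 by case: (c).
have wc' : 0 < width c' <= 2 by case: (c').
have h6 := Jn (n := 6) ltac:(lia).
have h7 : 2 * e <= (J - 6) * e by rewrite leq_mul2r; lia.
elim/ltn_ind: k i j => k IH i j ij hw.
case: (ltnP k J) => hk.
  by rewrite !extD_base; [exact: ax_DD (base hk) _ _ _ _ ij hw|lia..].
have hkk : J * e <= k * e by rewrite leq_mul2r hk orbT.
have hk1 : k.-1.+1 = k by lia.
have hk1e : k * e = k.-1 * e + e by rewrite -{1}hk1 mulSn addnC.
have cJ (a b z : Q) : commute a b -> commute (a ^ z)%g (b ^ z)%g.
  by rewrite /commute -!conjMg => ->.
case: (ltnP e i) => hei.
  have E := IH k.-1 ltac:(lia) (i - e) (j - e) ltac:(lia) ltac:(lia).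
  have := @extD_shift k.-1 (i - e) c; rewrite hk1 subnK; last by lia.
  move=> ->; try lia.
  have := @extD_shift k.-1 (j - e) c'; rewrite hk1 subnK; last by lia.
  by move=> ->; [apply: cJ|lia|lia].
case: (leqP (j + width c') (k.-1 * e)) => hj.
  by rewrite -hk1 !extD_stable; [apply: IH|..]; lia.
(* Conjugation by the splitting at [i + width c] moves the right decoration by [e] and fixes the
   left one, which reduces the claim to level [k.-1]. *)
have := @extD_left k.-1 (j - e) (i + width c) c'; rewrite hk1 subnK; last by lia.
move=> ->; try lia.
rewrite -hk1 extD_stable; last by lia.
rewrite -(@extD_right k.-1 i (i + width c)) //; last by lia.
by apply: cJ; apply: IH; lia.
Qed.

Lemma ext_loc_shift k i W u : 0 < i -> i + W <= (k * e).+1 ->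
  all (in_window W) u ->
  reval_word (L := L) extY extD k.+1 (i + e) u =
    (reval_word extY extD k i u ^ y0)%g.
Proof.
move=> hi hw; elim: u => [|[[h a] c] u IH] /=.
  by rewrite /reval_word !big_nil conj1g.
case/andP=> /andP[hh ha] /IH{}IH; rewrite /reval_word !big_cons conjMg.
congr (_ * _)%g; last exact: IH.
have hm : (k + h) * e = k * e + h * e by rewrite mulnDl.
rewrite /reval addSn addnAC; case: c ha => [c|] ha.
  by rewrite extD_shift //; lia.
rewrite /ysplit mulSn; case: ifP => h1; case: ifP => h2; try lia.
  by rewrite extY_shift //; lia.
by rewrite conj1g.
Qed.

Lemma ext_loc_stable k i W u : i + W <= k * e -> all (in_window W) u ->
  reval_word (L := L) extY extD k.+1 i u = reval_word extY extD k i u.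
Proof.
move=> hw; elim: u => [|[[h a] c] u IH] /=.
  by rewrite /reval_word !big_nil.
case/andP=> /andP[hh ha] /IH{}IH; rewrite /reval_word !big_cons.
congr (_ * _)%g; last exact: IH.
have hm : (k + h) * e = k * e + h * e by rewrite mulnDl.
rewrite /reval addSn; case: c ha => [c|] ha.
  by rewrite extD_stable //; lia.
by rewrite /ysplit mulSn !ifT //; lia.
Qed.

Lemma ext_loc_base k i W u : k < J -> i + W <= (k * e).+1 ->
  all (in_window W) u ->
  reval_word (L := L) extY extD k i u = reval_word Y D k i u.
Proof.
move=> hk hw; elim: u => [|[[h a] c] u IH] /=.
  by rewrite /reval_word !big_nil.
case/andP=> /andP[hh ha] /IH{}IH; rewrite /reval_word !big_cons.
congr (_ * _)%g; last exact: IH.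
have hm : (k + h) * e <= J * e by rewrite leq_mul2r; lia.
rewrite /reval; case: c ha => [c|] ha; first by rewrite extD_base //; lia.
by rewrite /ysplit; case: ifP => // h1; rewrite extY_base //; lia.
Qed.

(** A local relation occupies at most three strands, so no gap is involved: right of strand [e] it
    is the [Y 0]-conjugate of one at a lower level, and near the left end lowering the level does
    not change it. *)
Lemma ext_loc W u v k i : local_rel W u v -> i + W <= (k * e).+1 ->
  reval_word (L := L) extY extD k i u = reval_word extY extD k i v.
Proof.
move=> huv; have [W3 hu hv] := local_rel_window huv.
have h6 := Jn (n := 6) ltac:(lia).
have h7 : 2 * 1 <= (J - 6) * e by apply: leq_mul; lia.
elim: k i => [|k IH] i hw; last case: (ltnP k.+1 J) => hk.
- have J0 : 0 < J by lia.
  by rewrite !(ext_loc_base J0 hw) //; exact: ax_loc (base J0) _ _ _ _ huv hw.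
- by rewrite !(ext_loc_base hk hw) //; exact: ax_loc (base hk) _ _ _ _ huv hw.
have hkk : J * e <= k.+1 * e by rewrite leq_mul2r hk orbT.
rewrite mulSn in hw hkk.
case: (ltnP e i) => hi.
  have E := IH (i - e) ltac:(lia).
  by rewrite -(subnK (ltnW hi)) !(@ext_loc_shift _ _ W) ?E //; lia.
by rewrite !(@ext_loc_stable _ _ W) //; [apply: IH|..]; lia.
Qed.

Lemma ext_axioms k : strand_axioms_at extY extD k.
Proof.
split.
- move=> i j ij hj; rewrite /ysplit mulSn.
  have -> : i < k * e by lia.
  have -> : i < e + k * e by lia.
  case: (ltnP j (k * e)) => h; last by rewrite ifF ?mulg1 ?mul1g //; lia.
  by rewrite ifT; [apply/conjg_eq/extYY|lia].
- move=> i j c ij hw; have hk : j < k * e by case: (c) hw => /=; lia.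
  by rewrite /ysplit hk; apply/conjg_eq; rewrite -extD_left.
- move=> i j c ij hj; rewrite /ysplit extD_stable; last by lia.
  case: ifP => h; last by rewrite mulg1 mul1g.
  by apply/conjg_eq/extD_right.
- by move=> i j c c' ij hj; apply: extDD.
- by move=> W u v i; apply: ext_loc.
Qed.

Definition extension := Strand ext_axioms.

End Extension.

(** * Permutations of a set as a group *)

(** The inverse map is stored because a presentation needs a function for the inverse of each
    generator. *)
Record bijection (T : Type) := Bijection {
  fw :> T -> T; bw : T -> T; fwK : cancel fw bw; bwK : cancel bw fw }.

Section BijectionGroup.
Variable T : Type.

HB.instance Definition _ := gen_eqMixin (bijection T).
HB.instance Definition _ := gen_choiceMixin (bijection T).

Lemma bijection_eq (a b : bijection T) : fw a =1 fw b -> a = b.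
Proof.
move=> /funext E; case: a b E => f f' fK f'K [g g' gK g'K] /= E; subst g.
have E' : f' = g' by apply: funext => t; rewrite -[LHS]gK f'K.
by subst g'; congr Bijection; apply: Prop_irrelevance.
Qed.

Definition bijection1 := @Bijection T id id (fun _ => erefl) (fun _ => erefl).
Definition bijectionM (a b : bijection T) :=
  Bijection (can_comp (fwK a) (fwK b) : cancel (fw a \o fw b) (bw b \o bw a))
            (can_comp (bwK b) (bwK a)).
Definition bijectionV (a : bijection T) := Bijection (bwK a) (fwK a).

Lemma bijection_mulA : associative bijectionM.
Proof. by move=> a b c; apply: bijection_eq. Qed.
Lemma bijection_mul1 : left_id bijection1 bijectionM.
Proof. by move=> a; apply: bijection_eq. Qed.
Lemma bijection_mulr1 : right_id bijection1 bijectionM.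
Proof. by move=> a; apply: bijection_eq. Qed.
Lemma bijection_mulV : left_inverse bijection1 bijectionV bijectionM.
Proof. by move=> a; apply: bijection_eq => t /=; rewrite fwK. Qed.
Lemma bijection_mulrV : right_inverse bijection1 bijectionV bijectionM.
Proof. by move=> a; apply: bijection_eq => t /=; rewrite bwK. Qed.

HB.instance Definition _ := isGroup.Build (bijection T)
  bijection_mulA bijection_mul1 bijection_mulr1 bijection_mulV bijection_mulrV.

End BijectionGroup.

(** * Infinite sequences *)

Section Sequences.
Variable X : finType.
Implicit Types (u v : seq X) (w xi : oseq X) (g h : seq X -> seq X).

Lemma cat_seq_nil w : cat_seq [::] w = w.
Proof. by apply: funext => n; rewrite /cat_seq subn0. Qed.

Lemma cat_seq_lt u w n : n < size u -> forall d, cat_seq u w n = nth d u n.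
Proof. by move=> hn d; rewrite /cat_seq hn; apply: set_nth_default. Qed.

Lemma cat_seq_ge u w n : size u <= n -> cat_seq u w n = w (n - size u).
Proof. by rewrite /cat_seq ltnNge => ->. Qed.

Lemma cat_seq_add u w n : cat_seq u w (n + size u) = w n.
Proof. by rewrite cat_seq_ge ?leq_addl // addnK. Qed.

Lemma cat_seq_cat u v w : cat_seq (u ++ v) w = cat_seq u (cat_seq v w).
Proof.
apply: funext => n; case: (ltnP n (size u)) => hn.
  rewrite !(cat_seq_lt _ _ (w 0)) ?size_cat ?ltn_addr //.
  by rewrite nth_cat hn.
rewrite [RHS]cat_seq_ge //; case: (ltnP n (size (u ++ v))) => hn'.
  rewrite (cat_seq_lt _ hn' (w 0)) nth_cat ltnNge hn /=.
  by rewrite (cat_seq_lt _ _ (w 0)) // -(ltn_add2l (size u)) subnKC -?size_cat.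
have hv : size v <= n - size u by move: hn'; rewrite size_cat; lia.
by rewrite !cat_seq_ge // size_cat subnDA.
Qed.

Lemma cat_seq_inj u : injective (cat_seq u : oseq X -> oseq X).
Proof.
move=> w w' E; apply: funext => n.
by rewrite -(cat_seq_add u w) E cat_seq_add.
Qed.

Lemma mkseq_cat_seq u w n : mkseq (cat_seq u w) (size u + n) = u ++ mkseq w n.
Proof.
apply: (@eq_from_nth _ (w 0)) => [|i]; rewrite size_mkseq ?size_cat ?size_mkseq //.
move=> hi; rewrite nth_mkseq // nth_cat; case: ltnP => h.
  exact: cat_seq_lt.
by rewrite cat_seq_ge // nth_mkseq //; lia.
Qed.

Lemma mkseq_cat_seq0 u w : mkseq (cat_seq u w) (size u) = u.
Proof. by rewrite -[size u]addn0 mkseq_cat_seq cats0. Qed.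

Lemma cat_seq_mkseq xi n : cat_seq (mkseq xi n) (fun k => xi (k + n)) = xi.
Proof.
apply: funext => i; case: (ltnP i n) => hi.
  by rewrite (cat_seq_lt _ _ (xi 0)) ?nth_mkseq ?size_mkseq.
by rewrite cat_seq_ge size_mkseq // subnK.
Qed.

Lemma cat_seq_comparable u v w w' : size u <= size v ->
  cat_seq u w = cat_seq v w' -> exists2 v', v = u ++ v' & w = cat_seq v' w'.
Proof.
move=> hs E.
have Ev : v = u ++ drop (size u) v.
  have: v = mkseq (cat_seq u w) (size u + (size v - size u)).
    by rewrite subnKC // E mkseq_cat_seq0.
  by rewrite mkseq_cat_seq => {2}->; rewrite drop_size_cat // -mkseq_cat_seq subnKC // E mkseq_cat_seq0.
exists (drop (size u) v) => //; apply: (@cat_seq_inj u).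
by rewrite -cat_seq_cat -Ev.
Qed.

Lemma size_tree_aut g v : tree_aut g -> size (g v) = size v.
Proof. by case=> _ [-> _]. Qed.

Lemma take_tree_aut g v u : tree_aut g -> take (size v) (g (v ++ u)) = g v.
Proof. by case=> _ [_ ->]. Qed.

Lemma mkseq_act g xi m : tree_aut g -> mkseq (act g xi) m = g (mkseq xi m).
Proof.
move=> hg; apply: (@eq_from_nth _ (xi 0)); rewrite ?size_tree_aut ?size_mkseq //.
move=> n hn; rewrite nth_mkseq // /act -(subnKC hn) {2}/mkseq iotaD map_cat.
rewrite -(take_tree_aut _ [seq xi i | i <- iota n.+1 (m - n.+1)] hg) size_mkseq.
by rewrite nth_take.
Qed.

Lemma act_cat_seq g h v w : tree_aut g -> tree_aut h ->
  (forall u, g (v ++ u) = g v ++ h u) ->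
  act g (cat_seq v w) = cat_seq (g v) (act h w).
Proof.
move=> hg hh E; apply: funext => n.
have hn : n < size v + n.+1 by lia.
rewrite -(nth_mkseq (w 0) (act g _) hn) mkseq_act // mkseq_cat_seq E.
rewrite -(mkseq_act _ _ hh) nth_cat; case: ltnP => h'.
  by rewrite (cat_seq_lt _ h' (w 0)).
by rewrite cat_seq_ge // nth_mkseq //; rewrite size_tree_aut // in h' *; lia.
Qed.

Lemma act_id xi : act id xi = xi.
Proof. by apply: funext => n; rewrite /act nth_mkseq. Qed.

Lemma act_comp g h xi : tree_aut g -> tree_aut h ->
  act (g \o h) xi = act g (act h xi).
Proof.
move=> hg hh; apply: funext => n; rewrite /act (mkseq_act _ _ hh) /comp.
by apply: set_nth_default; rewrite (size_tree_aut _ hg) (size_tree_aut _ hh) size_mkseq.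
Qed.

Lemma act_inj g : tree_aut g -> injective (act g : oseq X -> oseq X).
Proof.
move=> hg w w' E; apply: funext => n.
have : mkseq w n.+1 = mkseq w' n.+1.
  have [/bij_inj inj _] := hg; apply: inj.
  by rewrite -!(mkseq_act _ _ hg) E.
by move/(congr1 (nth (w 0) ^~ n)); rewrite !nth_mkseq.
Qed.

End Sequences.

(** * The strand system of homeomorphisms of the Cantor set *)

(** More than [contracting] grants: the finite set contains the identity and is closed under
    inverses and sections. [nu_absorb] serves to put elements of [V_G] in normal form, [nu_contract]
    to multiply labels. *)
Record nucleus (X : finType) (G : (seq X -> seq X) -> Prop) := Nucleus {
  ncl : finType;
  nu : ncl -> seq X -> seq X;
  none : ncl;
  ninv : ncl -> ncl;
  npi : ncl -> X -> X;
  nsec : ncl -> X -> ncl;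
  nuG : forall a, G (nu a);
  nu_none : nu none = id;
  nu_inv : forall a v, nu a (nu (ninv a) v) = v;
  nu_cons : forall a y v, nu a (y :: v) = npi a y :: nu (nsec a y) v;
  npi_inj : forall a, injective (npi a);
  nu_absorb : forall g, G g -> exists n, forall v, n <= size v ->
    exists c, forall w, g (v ++ w) = g v ++ nu c w;
  nu_contract : forall a b, exists n, forall v, n <= size v ->
    exists c, forall w, nu a (nu b (v ++ w)) = nu a (nu b v) ++ nu c w }.

(** Bubble sort: the word [c] carries the image of the last index to the top, and induction handles
    the other indices. *)
Lemma swaps_of_injection n (pi : nat -> nat) :
  (forall r, r < n -> pi r < n) ->
  (forall r s, r < n -> s < n -> pi r = pi s -> r = s) ->
  exists2 t, all (fun i => i.+1 < n) t & forall r, r < n -> swaps_at t r = pi r.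
Proof.
elim: n pi => [|m IH] pi hpi inj; first by exists [::].
pose p := pi m; have hp : p <= m by rewrite -ltnS hpi.
pose c := rev (iota p (m - p)).
have hc : all (fun i => i.+1 < m.+1) c.
  by apply/allP => i; rewrite mem_rev mem_iota; lia.
have cp : swaps_at c p = m.
  rewrite /c -[in RHS](subnKC hp); elim: (m - p) => [|k IHk]; first by rewrite addn0.
  by rewrite -addn1 iotaD rev_cat /= IHk /swap_at eqxx addn1 addnS.
have crK : cancel (swaps_at (rev c)) (swaps_at c).
  by move=> q; rewrite -{1}[c]revK swaps_at_rev.
have lt r : r < m -> swaps_at c (pi r) < m.
  move=> hr; have := swaps_at_lt hc (hpi r (ltnW hr)).
  rewrite ltnS leq_eqVlt => /orP[/eqP|//]; rewrite -cp.
  move/(can_inj (swaps_at_rev c)) => E.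
  by have := inj r m (ltnW hr) (ltnSn m) E; lia.
have [r s hr hs|t ht Et] := IH (swaps_at c \o pi) lt.
  by move/(can_inj (swaps_at_rev c))/inj; apply; apply: ltnW.
exists (rev c ++ t).
  rewrite all_cat all_rev hc /=; apply: sub_all ht => i /=; lia.
move=> r; rewrite ltnS leq_eqVlt swaps_at_cat => /orP[/eqP ->|hr].
  have -> : swaps_at t m = m.
    elim: t ht {Et} => [|i t IHt] //= /andP[hi /IHt ->].
    by rewrite /swap_at !ifF //; lia.
  by rewrite -[X in swaps_at (rev c) X]cp swaps_at_rev.
by rewrite Et //= swaps_at_rev.
Qed.

(** * The product of two strand systems *)

Section PairStrand.
Variables (e : nat) (L : labels e) (Q R : strand L).

Definition pairY i : (Q * R)%type := (sY Q i, sY R i).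
Definition pairD k i c : (Q * R)%type := (sD Q k i c, sD R k i c).

Lemma pair_ysplit k i : ysplit e pairY k i = (ysplit e (sY Q) k i, ysplit e (sY R) k i).
Proof. by rewrite /ysplit; case: ifP. Qed.

Lemma pair_reval_word k i w : reval_word pairY pairD k i w =
  (reval_word (sY Q) (sD Q) k i w, reval_word (sY R) (sD R) k i w).
Proof.
elim: w => [|[[h a] c] w IH]; first by rewrite /reval_word !big_nil.
rewrite /reval_word !big_cons [X in (_ * X)%g = _]IH.
by rewrite /reval; case: c => [c|]; rewrite ?pair_ysplit.
Qed.

Lemma pair_axioms k : strand_axioms_at pairY pairD k.
Proof.
have [Q1 Q2 Q3 Q4 Q5] := sax Q k; have [R1 R2 R3 R4 R5] := sax R k.
split.
- move=> i j ij hj; rewrite !pair_ysplit.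
  by congr (_, _); [apply: Q1|apply: R1].
- move=> i j c ij hj; rewrite !pair_ysplit.
  by congr (_, _); [apply: Q2|apply: R2].
- move=> i j c ij hj; rewrite !pair_ysplit.
  by congr (_, _); [apply: Q3|apply: R3].
- by move=> i j c c' ij hj; congr (_, _); [apply: Q4|apply: R4].
move=> W u v i huv hi; rewrite !pair_reval_word.
by congr (_, _); [apply: Q5 huv hi|apply: R5 huv hi].
Qed.

Definition pair_strand := Strand pair_axioms.

End PairStrand.

Section StrandLetters.
Variables (e : nat) (L : labels e).

Definition letter := (nat + nat * nat * option (lab L))%type.

Definition valid_letter (l : letter) :=
  if l is inr (k, i, c) then i + width c <= (k * e).+1 else true.

Definition letter_value (Q : strand L) (l : letter) : Q :=
  match l with inl i => sY Q i | inr (k, i, c) => sD Q k i c end.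

Definition word_value (Q : strand L) (w : seq (letter * bool)) : Q :=
  (\prod_(a <- w) if a.2 then letter_value Q a.1 else (letter_value Q a.1)^-1)%g.

Lemma normal_form_word (Q : strand L) w : 0 < e ->
  all (fun a => valid_letter a.1) w -> normal_form (word_value Q w).
Proof.
move=> he; elim: w => [|[l b] w IH] /=.
  by rewrite /word_value big_nil => _; apply: normal_form1.
case/andP=> hl /IH hw; rewrite /word_value big_cons; apply: normal_formM => //=.
suff h : normal_form (letter_value Q l) by case: (b) => //; apply: normal_formV.
case: l hl => [i|[[k i] c]] /= hl; last exact: normal_formD.
by apply: (@normal_formY _ _ _ i.+1); rewrite mulSn; nia.
Qed.

Lemma pair_word_value (Q R : strand L) w :
  word_value (pair_strand Q R) w = (word_value Q w, word_value R w).
Proof.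
elim: w => [|[l b] w IH]; first by rewrite /word_value !big_nil.
rewrite /word_value !big_cons [X in (_ * X)%g = _]IH.
by case: b; case: l => [i|[[k i] c]].
Qed.

Lemma pair_path_value (Q R : strand L) k p :
  path_value (pair_strand Q R) k p = (path_value Q k p, path_value R k p).
Proof.
elim: p k => [|i p IH] k //=; rewrite IH pair_ysplit //.
Qed.

Lemma pair_swaps (Q R : strand L) k t :
  swaps (pair_strand Q R) k t = (swaps Q k t, swaps R k t).
Proof.
elim: t => [|i t IH]; first by rewrite /swaps !big_nil.
by rewrite !swaps_cons IH.
Qed.

Lemma pair_labs (Q R : strand L) k f :
  labs (pair_strand Q R) k f = (labs Q k f, labs R k f).
Proof.
rewrite /labs; elim: (_.+1) => [|n IH]; first by rewrite !big_nil.
by rewrite !big_nat_recr //= IH.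
Qed.

End StrandLetters.

Section Semantics.
Variables (X : finType) (G : (seq X -> seq X) -> Prop) (x0 : X).
Hypotheses (hX : 1 < #|X|) (hG : forall g, G g -> tree_aut g).
Variable (N : nucleus G).
Notation I := (ncl N).
Notation nu := (@nu X G N).
Notation e := #|X|.-1.

Definition letter_at r := nth x0 (enum X) r.
Definition rank (y : X) := index y (enum X).

Lemma rank_le y : rank y <= e.
Proof. by rewrite -ltnS prednK ?(ltnW hX) // cardE index_mem mem_enum. Qed.

Lemma rankK y : letter_at (rank y) = y.
Proof. by rewrite /letter_at nth_index // mem_enum. Qed.

Lemma letter_atK r : r <= e -> rank (letter_at r) = r.
Proof.
by rewrite -ltnS prednK ?(ltnW hX) // cardE => hr; rewrite /rank index_uniq ?enum_uniq.
Qed.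

Lemma letter_at_inj r s : r <= e -> s <= e -> letter_at r = letter_at s -> r = s.
Proof. by move=> hr hs E; rewrite -(letter_atK hr) E letter_atK. Qed.

Definition lab_mul (a b c : I) := forall v, nu a (nu b v) = nu c v.
Definition lab_perm (a : I) r := rank (npi a (letter_at r)).
Definition lab_sec (a : I) r := nsec a (letter_at r).
Definition lab_depth n (a b : I) := forall v, n <= size v ->
  exists c, forall w, nu a (nu b (v ++ w)) = nu a (nu b v) ++ nu c w.

Lemma nu_aut a : tree_aut (nu a). Proof. by apply: hG; apply: nuG. Qed.

Lemma size_nu a v : size (nu a v) = size v.
Proof. exact: size_tree_aut (nu_aut a). Qed.

Lemma lab_swaps_exist a : exists t, all (fun i => i < e) t /\
  forall r, r <= e -> swaps_at t r = lab_perm a r.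
Proof.
have [r hr|r s hr hs|t ht Et] := @swaps_of_injection e.+1 (lab_perm a).
- by rewrite ltnS rank_le.
- move/(congr1 letter_at); rewrite !rankK => /npi_inj.
  by apply: letter_at_inj; rewrite -ltnS.
by exists t; split => // r hr; apply: Et.
Qed.

Definition lab_swaps a := projT1 (cid (lab_swaps_exist a)).

Lemma lab_depth0 a b : lab_depth 0 a b -> exists c, lab_mul a b c.
Proof.
move=> /(_ [::] isT) [c hc]; exists c => v; rewrite -[v in LHS]cat0s hc.
by rewrite (size0nil (s := nu a _)) // !size_nu.
Qed.

Lemma lab_depthS n a b r : lab_depth n.+1 a b -> r <= e ->
  lab_depth n (lab_sec a (lab_perm b r)) (lab_sec b r).
Proof.
move=> h hr v hv; have [c hc] := h (letter_at r :: v) hv; exists c => w.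
by have := hc w; rewrite /lab_sec /lab_perm rankK /= !nu_cons /= => -[].
Qed.

Definition nucleus_labels : labels e.
Proof.
refine (@Labels e I (none N) (@ninv X G N) lab_mul lab_perm lab_swaps lab_sec
  lab_depth _ _ _ _ _ lab_depth0 lab_depthS (@nu_contract X G N)).
- by move=> v; rewrite !nu_none.
- by move=> a v; rewrite nu_inv nu_none.
- by move=> a; rewrite /lab_swaps; case: (cid _) => t [ht Et].
- by move=> a r; rewrite /lab_swaps; case: (cid _) => t [ht Et]; apply: Et.
- by move=> a r _; apply: rank_le.
Defined.

(** * Frames of the Cantor set and the homeomorphisms defined by them *)

Notation L := nucleus_labels.
Notation frame := (nat -> oseq X -> oseq X).

Lemma act_nu_cons a y w :
  act (nu a) (cat_seq [:: y] w) = cat_seq [:: npi a y] (act (nu (nsec a y)) w).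
Proof.
have h v : nu a (y :: v) = npi a y :: nu (nsec a y) v by exact: nu_cons.
have h0 : nu a [:: y] = [:: npi a y].
  by rewrite h (size0nil (s := nu _ [::])) // size_nu.
rewrite (act_cat_seq _ (nu_aut a) (nu_aut (nsec a y))) => [|v] /=.
  by rewrite h0.
by rewrite h0 h.
Qed.

Definition child_frame (phi : oseq X -> oseq X) r : oseq X -> oseq X :=
  fun w => phi (cat_seq [:: letter_at r] w).
Notation split := (split_at e child_frame).

Fixpoint vine_frame k : frame :=
  if k is k'.+1 then split (k' * e) (vine_frame k') else fun=> id.

Definition label_frame (f : nat -> I) (phi : frame) : frame :=
  fun q w => phi q (act (nu (f q)) w).

Definition deco_frame i (c : option I) (phi : frame) : frame :=
  if c is Some g then fun q w => if q == i then phi q (act (nu g) w) else phi q w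
  else fun q => phi (swap_at i q).

Definition covers n (phi : frame) :=
  (forall xi, exists q w, q < n /\ phi q w = xi) /\
  (forall q q' w w', q < n -> q' < n -> phi q w = phi q' w' -> q = q' /\ w = w').

Lemma act_nuV a w : act (nu a) (act (nu (ninv a)) w) = w.
Proof.
rewrite -act_comp; try exact: nu_aut.
by have -> : nu a \o nu (ninv a) = id; [apply: funext => v; apply: nu_inv|rewrite act_id].
Qed.

Lemma covers_split n j phi : j < n -> covers n phi -> covers (n + e) (split j phi).
Proof.
move=> hj [sur inj]; have he : 0 < e by lia.
split=> [xi|q q' w w' hq hq'].
  have [q [w [hq <-]]] := sur xi; case: (ltngtP q j) => hqj.
  - by exists q, w; split; [lia|rewrite /split_at hqj].
  - exists (q + e), w; split; first by lia.
    by rewrite /split_at !ifF ?addnK //; lia.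
  exists (j + rank (w 0)), (fun k => w (k + 1)); have := rank_le (w 0) => hr.
  split; first by lia.
  rewrite /split_at ifF ?ifT; [|lia..].
  by rewrite addKn /child_frame rankK hqj (cat_seq_mkseq w 1).
have arg p v : p < n + e -> split j phi p v =
    phi (origin e j p) (if j <= p < j + e.+1
      then cat_seq [:: letter_at (p - j)] v else v).
  move=> hp; rewrite /split_at /origin; case: (ltnP p j) => h1 //=.
  by case: ifP.
have ol p : p < n + e -> origin e j p < n.
  by move=> hp; rewrite /origin; do !case: ifP; lia.
rewrite !arg // => /(inj _ _ _ _ (ol _ hq) (ol _ hq')) [].
rewrite /origin; case: (ltnP q j) => h1; case: (ltnP q' j) => h2;
  rewrite ?andTb ?andFb;
  try (case: (ltnP q (j + e.+1)) => h3); try (case: (ltnP q' (j + e.+1)) => h4);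
  move=> Eq Ew; try (exfalso; lia); try (by split; [lia|]).
have [v Ev Ew'] := @cat_seq_comparable _ [:: _] [:: _] _ _ (leqnn 1) Ew.
have v0 : v = [::] by case: v Ev {Ew'} => // z v [].
rewrite v0 in Ev Ew'; case: Ev => Ev; split.
  have : q' - j = q - j by apply: letter_at_inj Ev; lia.
  lia.
by rewrite Ew' cat_seq_nil.
Qed.

Lemma covers_swap n i phi : i.+1 < n -> covers n phi ->
  covers n (fun q => phi (swap_at i q)).
Proof.
have sw q : i.+1 < n -> q < n -> swap_at i q < n.
  by rewrite /swap_at; do !case: eqP => //; lia.
move=> hi [sur inj]; split=> [xi|q q' w w' hq hq' E].
  have [q [w [hq <-]]] := sur xi.
  by exists (swap_at i q), w; rewrite swap_atK sw.
have [Eq Ew] := inj _ _ _ _ (sw _ hi hq) (sw _ hi hq') E.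
by split=> //; apply: (can_inj (swap_atK i)).
Qed.

Lemma covers_label n f phi : covers n phi -> covers n (label_frame f phi).
Proof.
move=> [sur inj]; split=> [xi|q q' w w' hq hq' E].
  have [q [w [hq <-]]] := sur xi.
  by exists q, (act (nu (ninv (f q))) w); rewrite /label_frame act_nuV.
have [Eq Ew] := inj _ _ _ _ hq hq' E; subst q'.
by split=> //; apply: act_inj Ew; apply: nu_aut.
Qed.

Lemma deco_frame_label i g phi : deco_frame i (Some g) phi =
  label_frame (fun q => if q == i then g else none N) phi.
Proof.
apply: funext => q; apply: funext => w; rewrite /= /label_frame.
by case: eqP => // _; rewrite nu_none act_id.
Qed.

Lemma covers_deco n i c phi : i + width (L := L) c <= n -> covers n phi ->
  covers n (deco_frame i c phi).
Proof.
case: c => [g|] hi hc; last by apply: covers_swap => //; move: hi => /=; lia.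
by rewrite deco_frame_label; apply: covers_label.
Qed.

Lemma covers_vine k : covers (k * e).+1 (vine_frame k).
Proof.
elim: k => [|k IH].
  split=> [xi|q q' w w']; first by exists 0, xi.
  by rewrite mul0n !ltnS !leqn0 => /eqP -> /eqP ->.
by rewrite mulSn addnC -addSn; apply: covers_split.
Qed.

(** A point has unique coordinates in each frame, and the bijection keeps the coordinates while
    changing the frame. *)
Lemma transport n phi phi' : covers n phi -> covers n phi' ->
  exists a : bijection (oseq X), forall q w, q < n -> fw a (phi q w) = phi' q w.
Proof.
have coord psi : covers n psi -> exists c : oseq X -> nat * oseq X,
    forall xi, (c xi).1 < n /\ psi (c xi).1 (c xi).2 = xi.
  case=> sur _.
  have h xi : exists p : nat * oseq X, p.1 < n /\ psi p.1 p.2 = xi.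
    by have [q [w h]] := sur xi; exists (q, w).
  by have [c hc] := choice h; exists c.
move=> h h'; have [c hc] := coord _ h; have [c' hc'] := coord _ h'.
case: h h' => [sur inj] [sur' inj'].
pose f xi := phi' (c xi).1 (c xi).2; pose f' xi := phi (c' xi).1 (c' xi).2.
have fK : cancel f f'.
  move=> xi; rewrite /f' /f; set xi' := phi' _ _.
  have [h1 h2] := hc' xi'; have [h3 h4] := hc xi.
  by have [-> ->] := inj' _ _ _ _ h1 h3 h2.
have f'K : cancel f' f.
  move=> xi; rewrite /f' /f; set xi' := phi _ _.
  have [h1 h2] := hc xi'; have [h3 h4] := hc' xi.
  by have [-> ->] := inj _ _ _ _ h1 h3 h2.
exists (Bijection fK f'K) => q w hq /=; rewrite /f.
have [h1 h2] := hc (phi q w).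
by have [-> ->] := inj _ _ _ _ h1 hq h2.
Qed.

(** A homeomorphism is recorded by the operation on frames that describes its effect on a vine. Two
    levels occur because a splitting changes the number of strands. *)
Definition realizes k k' (a : bijection (oseq X)) (M : frame -> frame) :=
  forall q w, q <= k' * e -> fw a (vine_frame k' q w) = M (vine_frame k) q w.

(** The operation acts on the source side of a frame, so it commutes with maps of the target. This
    is what lets operations be composed, in the order opposite to that of the homeomorphisms. *)
Definition natural_op n n' (M : frame -> frame) :=
  forall (h : oseq X -> oseq X) phi phi',
    (forall q w, q <= n -> h (phi q w) = phi' q w) ->
    forall q w, q <= n' -> h (M phi q w) = M phi' q w.

(** The frame of a vine covers the whole space. Every relation in [sem_axioms] is thereby reduced to
    an identity between operations on frames. *)
Lemma realizes_uniq k k' a b M M' : realizes k k' a M -> realizes k k' b M' ->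
  (forall q w, q <= k' * e -> M (vine_frame k) q w = M' (vine_frame k) q w) -> a = b.
Proof.
move=> ha hb E; apply: bijection_eq => xi.
have [sur _] := (covers_vine k'); have [q [w [hq <-]]] := sur xi.
by rewrite ha // hb // E.
Qed.

Lemma realizesM k k' k'' a b M M' : realizes k k' a M -> realizes k' k'' b M' ->
  natural_op (k' * e) (k'' * e) M' -> realizes k k'' (a * b)%g (M' \o M).
Proof.
by move=> ha hb nM q w hq; rewrite [LHS]/= hb //; apply: nM.
Qed.

Lemma realizes1 k : realizes k k 1%g id.
Proof. by []. Qed.

Lemma natural_split k j : j <= k * e -> natural_op (k * e) (k.+1 * e) (split j).
Proof.
move=> hj h phi phi' E q w hq; rewrite mulSn in hq.
by rewrite /split_at /child_frame; do !case: ifP => ?; apply: E; lia.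
Qed.

Lemma natural_deco n i c : i + width (L := L) c <= n.+1 -> natural_op n n (deco_frame i c).
Proof.
case: c => [g|] /= hi h phi phi' E q w hq /=.
  by case: ifP => _; apply: E.
by apply: E; rewrite /swap_at; do !case: eqP => //; lia.
Qed.

Lemma natural_comp n n' n'' M M' : natural_op n n' M -> natural_op n' n'' M' ->
  natural_op n n'' (M' \o M).
Proof.
by move=> hM hM' h phi phi' E q w hq; apply: hM' => // q' w' hq'; apply: hM.
Qed.

(** [(i %/ e).+1] is the least [k] with [i < k * e]. *)
Lemma semY_exists i :
  exists a, realizes (i %/ e).+1 (i %/ e).+2 a (split i).
Proof.
have he : 0 < e by lia.
have hi : i < ((i %/ e).+1 * e).+1 by rewrite ltnS ltnW // ltn_ceil.
have h := covers_split hi (covers_vine (i %/ e).+1).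
have [a ha] : exists a : bijection (oseq X), forall q w,
    q < ((i %/ e).+1 * e).+1 + e ->
    fw a (vine_frame (i %/ e).+2 q w) = split i (vine_frame (i %/ e).+1) q w.
  by apply: transport => //; have := covers_vine (i %/ e).+2; rewrite mulSn addnC addSn.
by exists a => q w hq; apply: ha; move: hq; rewrite [X in _ <= X]mulSn; lia.
Qed.

Definition semY i := projT1 (cid (semY_exists i)).

Lemma semD_exists k i c : exists a, i + width (L := L) c <= (k * e).+1 ->
  realizes k k a (deco_frame i c).
Proof.
have [hi|hi] := boolP (i + width (L := L) c <= (k * e).+1); last by exists 1%g.
have [a ha] := transport (covers_vine k) (covers_deco hi (covers_vine k)).
by exists a => _ q w hq; apply: ha.
Qed.

Definition semD k i c := projT1 (cid (semD_exists k i c)).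

Lemma realizesD k i c : i + width (L := L) c <= (k * e).+1 ->
  realizes k k (semD k i c) (deco_frame i c).
Proof. by rewrite /semD; case: (cid _). Qed.

(** Splitting the last strand commutes with splitting strand [i], so the map chosen at the least
    level serves at all higher levels. *)
Lemma realizesY k i : i < k * e -> realizes k k.+1 (semY i) (split i).
Proof.
have he : 0 < e by lia.
rewrite -ltn_divLR // => hk.
have -> : k = (i %/ e).+1 + (k - (i %/ e).+1) by lia.
elim: (k - _) => [|n IH]; first by rewrite addn0 /semY; case: (cid _).
rewrite !addnS; move: (_ + n) IH (leq_addr n (i %/ e).+1) => {hk}k IH hk.
have hik : i < k * e by rewrite -ltn_divLR.
have nats := natural_split (leqnn (k.+1 * e)).
move=> q w hq; rewrite [vine_frame k.+2]/= [vine_frame k.+1]/=.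
rewrite (nats _ _ (split i (vine_frame k))) //.
have E : k.+1 * e = k * e + e by rewrite mulSn addnC.
by rewrite E -(@split_atC e _ child_frame i (k * e) (vine_frame k) hik).
Qed.

Notation y := (ysplit e semY).

Lemma realizes_y k j : j <= k * e -> realizes k k.+1 (y k j) (split j).
Proof.
rewrite /ysplit; case: ltngtP => // [hj _|-> _]; first exact: realizesY.
by [].
Qed.

Definition swaps_frame t (phi : frame) : frame := fun q => phi (swaps_at t q).

Lemma realizes_swaps k t : all (fun i => i < k * e) t ->
  realizes k k (\prod_(i <- t) semD k i None)%g (swaps_frame t) /\
  natural_op (k * e) (k * e) (swaps_frame t).
Proof.
elim: t => [|i t IH] /=.
  by move=> _; rewrite big_nil; split => // h phi phi' E q w; apply: E.
case/andP=> hi /IH[hr hn]; rewrite big_cons; split.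
  have hw : i + width (L := L) None <= (k * e).+1 by rewrite addn2.
  exact: (realizesM (realizesD hw) hr hn).
have hw : i + width (L := L) None <= (k * e).+1 by rewrite addn2.
exact: (natural_comp (natural_deco hw) hn).
Qed.

Definition block_frame j n (f : nat -> I) (phi : frame) : frame :=
  fun q => if j <= q < j + n then fun w => phi q (act (nu (f (q - j))) w)
           else phi q.

Lemma realizes_block k j n f : j + n <= (k * e).+1 ->
  realizes k k (\prod_(r <- iota 0 n) semD k (j + r) (Some (f r)))%g (block_frame j n f) /\
  natural_op (k * e) (k * e) (block_frame j n f).
Proof.
elim: n => [|n IH] hn.
  rewrite big_nil /block_frame; split=> [q w hq|h phi phi' E q w hq].
    by rewrite ifF //; lia.
  by rewrite !ifF ?E //; lia.
have [hr hN] := IH ltac:(lia).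
have E phi : deco_frame (j + n) (Some (f n)) (block_frame j n f phi) =
    block_frame j n.+1 f phi.
  apply: funext => q; apply: funext => w /=; rewrite /block_frame.
  case: eqP => [->|ne]; first by rewrite ifF ?ifT ?addKn //; lia.
  by rewrite (_ : (j <= q < j + n.+1) = (j <= q < j + n)) //; lia.
have hw : j + n + width (L := L) (Some (f n)) <= (k * e).+1.
  by change (j + n + 1 <= (k * e).+1); lia.
rewrite -addn1 iotaD big_cat big_seq1; split.
  move=> q w hq; rewrite addn1 -E.
  by apply: (realizesM hr (realizesD hw)) => //; apply: natural_deco.
move=> h phi phi' Ep q w hq; rewrite addn1 -!E.
by apply: (natural_comp hN (natural_deco hw)) hq.
Qed.

Lemma swaps_at_iota i n q : swaps_at (iota i n) q =
  if q == i + n then i else if i <= q < i + n then q.+1 else q.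
Proof.
elim: n q => [|n IH] q.
  by rewrite addn0 [LHS]/=; case: (q =P i) => [->|_] //; case: ifP; lia.
rewrite -addn1 iotaD swaps_at_cat IH [swaps_at _ _]/= /swap_at.
case: (q =P i + n) => h1; [|case: (q =P (i + n).+1) => h2];
  by do 2![case: eqP => ?]; do ?[case: ifP => ?]; lia.
Qed.

Lemma split_deco_left j i c phi q w : j < i ->
  split j (deco_frame i c phi) q w = deco_frame (i + e) c (split j phi) q w.
Proof.
move=> ij; case: c => [g|].
  rewrite [LHS]/split_at; case: (ltnP q j) => h1.
    by rewrite /deco_frame /split_at h1 !ifF //; lia.
  case: (ltnP q (j + e.+1)) => h2.
    rewrite /child_frame /deco_frame ifF ?[RHS]ifF; [|lia..].
    by rewrite /split_at ltnNge h1 h2.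
  rewrite /deco_frame /split_at [q < j]ltnNge h1 [q < j + _]ltnNge h2.
  by rewrite (_ : (q - e == i) = (q == i + e)) //; lia.
rewrite /deco_frame /split_at; case: (ltnP q j) => h1.
  have -> : swap_at (i + e) q = q by rewrite /swap_at !ifF //; lia.
  by rewrite h1 /swap_at !ifF //; lia.
case: (ltnP q (j + e.+1)) => h2.
  have -> : swap_at (i + e) q = q by rewrite /swap_at !ifF //; lia.
  have -> : swap_at i j = j by rewrite /swap_at !ifF //; lia.
  by rewrite h2 ifF //; lia.
have h3 : swap_at (i + e) q = swap_at i (q - e) + e.
  by rewrite /swap_at; do !case: eqP; lia.
have h4 : j < swap_at i (q - e) by rewrite /swap_at; do !case: eqP; lia.
by rewrite h3 !ifF ?addnK //; lia.
Qed.

Lemma split_deco_right j i c phi q w : i + width (L := L) c <= j ->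
  split j (deco_frame i c phi) q w = deco_frame i c (split j phi) q w.
Proof.
case: c => [g|] ij.
  have {}ij : i < j by rewrite -addn1.
  rewrite [LHS]/split_at; case: (ltnP q j) => h1.
    by rewrite /deco_frame /split_at h1.
  case: (ltnP q (j + e.+1)) => h2.
    rewrite /child_frame /deco_frame ifF ?[RHS]ifF; [|lia..].
    by rewrite /split_at ltnNge h1 h2.
  rewrite /deco_frame /split_at [q < j]ltnNge h1 [q < j + _]ltnNge h2.
  by rewrite !ifF //; lia.
have {}ij : i.+1 < j by rewrite addn2 in ij.
rewrite /deco_frame /split_at; case: (ltnP q j) => h1.
  by rewrite ifT // /swap_at; do !case: eqP; lia.
have -> : swap_at i q = q by rewrite /swap_at !ifF //; lia.
have -> : swap_at i j = j by rewrite /swap_at !ifF //; lia.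
rewrite [q < j]ltnNge h1; case: (ltnP q (j + e.+1)) => // h2.
by congr (phi _ w); rewrite /swap_at !ifF //; lia.
Qed.

Lemma decoC i j c c' phi q w : i + width (L := L) c <= j ->
  deco_frame j c' (deco_frame i c phi) q w =
  deco_frame i c (deco_frame j c' phi) q w.
Proof.
case: c => [g|] ij; [have {}ij : i < j by rewrite -addn1
                   |have {}ij : i.+1 < j by rewrite addn2 in ij].
  case: c' => [g'|] /=.
    by case: (q =P j) => [->|_]; case: (_ =P i) => // ?; lia.
  by rewrite (_ : (swap_at j q == i) = (q == i)) // /swap_at; do !case: eqP; lia.
case: c' => [g'|] /=.
  by rewrite (_ : (swap_at i q == j) = (q == j)) // /swap_at; do !case: eqP; lia.
by congr (phi _ w); rewrite /swap_at; do !case: eqP; lia.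
Qed.

Lemma split_label i g phi q w : split i (deco_frame i (Some g) phi) q w =
  block_frame i e.+1 (lab_sec g)
    (swaps_frame [seq i + r | r <- lab_swaps g] (split i phi)) q w.
Proof.
have [ht Et] : all (fun r => r < e) (lab_swaps g) /\
    forall r, r <= e -> swaps_at (lab_swaps g) r = lab_perm g r.
  by split; [exact: (@lswaps_lt _ L)|exact: (@lswapsE _ L)].
rewrite /block_frame /swaps_frame.
case: (boolP (i <= q < i + e.+1)) => hq; last first.
  rewrite (swaps_at_out ht); last by lia.
  rewrite /split_at /deco_frame; case: (ltnP q i) => h1; first by rewrite ifF //; lia.
  by rewrite !ifF //; lia.
have [r hr ->] : exists2 r, r <= e & q = i + r by exists (q - i); lia.
have child_at psi p : p <= e -> split i psi (i + p) = child_frame (psi i) p.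
  by move=> hp; rewrite /split_at ifF ?ifT ?addKn //; lia.
rewrite swaps_at_shift Et // addKn !child_at ?rank_le // /child_frame.
by rewrite /deco_frame eqxx act_nu_cons /lab_perm rankK.
Qed.

Lemma sem_axioms k : strand_axioms_at (L := L) semY semD k.
Proof.
have le1 j n : j <= k * e -> n <= e -> j + n <= k.+1 * e.
  by rewrite mulSn; lia.
split.
- move=> i j ij hj.
  have hi := le1 i 0 ltac:(lia) isT; rewrite addn0 in hi.
  apply: (@realizes_uniq k k.+2 _ _ (split i \o split j)
                                    (split (j + e) \o split i)).
  + by apply: realizesM; [apply: realizes_y|apply: realizes_y|apply: natural_split].
  + by apply: realizesM; [apply: realizes_y; lia|apply: realizes_y|apply: natural_split];
      apply: le1.
  by move=> q w _ /=; rewrite split_atC.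
- move=> i j c ij hw.
  have hj : j <= k * e by case: (c) hw => [g|]; rewrite ?addn1 ?addn2; lia.
  have hw' : i + e + width (L := L) c <= (k.+1 * e).+1.
    by rewrite mulSn; move: hw; case: (c) => [g|]; rewrite ?addn1 ?addn2; lia.
  apply: (@realizes_uniq k k.+1 _ _ (split j \o deco_frame i c)
                                    (deco_frame (i + e) c \o split j)).
  + by apply: realizesM; [apply: realizesD|apply: realizes_y|apply: natural_split].
  + by apply: realizesM; [apply: realizes_y|apply: realizesD|apply: natural_deco].
  by move=> q w _; apply: split_deco_left.
- move=> i j c ij hj.
  have hw : i + width (L := L) c <= (k * e).+1 by lia.
  have hw' : i + width (L := L) c <= (k.+1 * e).+1 by rewrite mulSn; lia.
  apply: (@realizes_uniq k k.+1 _ _ (split j \o deco_frame i c)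
                                    (deco_frame i c \o split j)).
  + by apply: realizesM; [apply: realizesD|apply: realizes_y|apply: natural_split].
  + by apply: realizesM; [apply: realizes_y|apply: realizesD|apply: natural_deco].
  by move=> q w _; apply: split_deco_right.
- move=> i j c c' ij hj.
  have hi : i + width (L := L) c <= (k * e).+1 by lia.
  apply: (@realizes_uniq k k _ _ (deco_frame j c' \o deco_frame i c)
                                 (deco_frame i c \o deco_frame j c')).
  + by apply: realizesM; [apply: realizesD|apply: realizesD|apply: natural_deco].
  + by apply: realizesM; [apply: realizesD|apply: realizesD|apply: natural_deco].
  by move=> q w _; apply: decoC.
move=> W u v i; case=> [|g|||g|a b c hc]; rewrite ?addn1 ?addn2 ?addn3 => hi.
- rewrite /reval_word [LHS]big_cons big_seq1 big_cons !revalE !addn0 addn1.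
  have -> : (\prod_(l <- [seq @rS _ L 1 r | r <- iota 0 e.+1]) reval semY semD k i l =
      \prod_(r <- iota i e.+1) semD k.+1 r None)%g.
    have -> : iota i e.+1 = [seq i + r | r <- iota 0 e.+1] by rewrite -iotaDl addn0.
    by rewrite !big_map; apply: eq_bigr => r _; rewrite revalE addn1.
  have hs : all (fun r => r < k.+1 * e) (iota i e.+1).
    by apply/allP => r; rewrite mem_iota mulSn; lia.
  have [hr hn] := realizes_swaps hs.
  apply: (@realizes_uniq k k.+1 _ _ (split i \o deco_frame i None)
                           (swaps_frame (iota i e.+1) \o split i.+1)).
  + apply: realizesM; [apply: realizesD|apply: realizes_y; lia|apply: natural_split; lia].
    by rewrite addn2.
  + by apply: realizesM; [apply: realizes_y|exact: hr|exact: hn].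
  move=> q w _; rewrite [LHS]/comp [RHS]/comp /swaps_frame swaps_at_iota.
  have s1 : swap_at i i = i.+1 by rewrite /swap_at eqxx.
  rewrite /deco_frame /split_at /child_frame s1.
  case: (q =P i + e.+1) => [->|ne].
    have -> : (i + e.+1 < i) = false by lia.
    rewrite ltnn ltnSn; have -> : i + e.+1 - e = i.+1 by lia.
    by have -> : swap_at i i.+1 = i by rewrite /swap_at eqxx ifF //; lia.
  case: (ltnP q i) => h1.
    have -> : q < i.+1 by lia.
    by have -> : swap_at i q = q by rewrite /swap_at !ifF //; lia.
  case: (ltnP q (i + e.+1)) => h2; rewrite ?andbT ?andbF.
    have -> : (q.+1 < i.+1) = false by lia.
    have -> : q.+1 < i.+1 + e.+1 by lia.
    by rewrite subSS.
  have -> : (q < i.+1) = false by lia.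
  have -> : (q < i.+1 + e.+1) = false by lia.
  by have -> : swap_at i (q - e) = q - e by rewrite /swap_at !ifF //; lia.
- rewrite /reval_word [LHS]big_cons big_seq1 big_cons !revalE !addn0 big_cat.
  rewrite !big_map; set t := [seq i + r | r <- lab_swaps g].
  have -> : (\prod_(r <- lab_swaps g) reval semY semD k i (@rS _ L 1 r) =
      \prod_(r <- t) semD k.+1 r None)%g.
    by rewrite big_map; apply: eq_bigr => r _; rewrite revalE addn1.
  have -> : (\prod_(r <- iota 0 e.+1) reval semY semD k i (@rL _ L 1 r (lab_sec g r)) =
      \prod_(r <- iota 0 e.+1) semD k.+1 (i + r) (Some (lab_sec g r)))%g.
    by apply: eq_bigr => r _; rewrite revalE addn1.
  have ht : all (fun r => r < k.+1 * e) t.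
    apply/allP => r' /mapP[r /(allP (@lswaps_lt _ L g)) hr ->].
    by rewrite mulSn; lia.
  have [hr hn] := realizes_swaps ht.
  have hb : i + e.+1 <= (k.+1 * e).+1 by rewrite mulSn; lia.
  have [hr' hn'] := realizes_block (lab_sec g) hb.
  apply: (@realizes_uniq k k.+1 _ _ (split i \o deco_frame i (Some g))
    ((block_frame i e.+1 (lab_sec g) \o swaps_frame t) \o split i)).
  + apply: realizesM; [apply: realizesD|exact: realizes_y|exact: natural_split].
    by rewrite addn1.
  + apply: realizesM; [exact: realizes_y|exact: (realizesM hr hr' hn')|].
    exact: natural_comp hn hn'.
  by move=> q w _; apply: split_label.
- rewrite /reval_word big_cons big_seq1 big_nil !revalE !addn0.
  have hw : i + width (L := L) None <= (k * e).+1 by rewrite addn2.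
  apply: (@realizes_uniq k k _ _ (deco_frame i None \o deco_frame i None) id).
  + exact: realizesM (realizesD hw) (realizesD hw) (natural_deco hw).
  + exact: realizes1.
  by move=> q w _ /=; rewrite swap_atK.
- have hw : i + width (L := L) None <= (k * e).+1 by rewrite addn2; lia.
  have hw' : i.+1 + width (L := L) None <= (k * e).+1 by rewrite addn2; lia.
  rewrite /reval_word !big_cons !big_nil !revalE !mulg1 !addn0 !addn1.
  apply: (@realizes_uniq k k _ _
    ((deco_frame i None \o deco_frame i.+1 None) \o deco_frame i None)
    ((deco_frame i.+1 None \o deco_frame i None) \o deco_frame i.+1 None)).
  + apply: realizesM (realizesD hw) _ _; last first.
      exact: natural_comp (natural_deco hw') (natural_deco hw).
    exact: realizesM (realizesD hw') (realizesD hw) (natural_deco hw).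
  + apply: realizesM (realizesD hw') _ _; last first.
      exact: natural_comp (natural_deco hw) (natural_deco hw').
    exact: realizesM (realizesD hw) (realizesD hw') (natural_deco hw').
  move=> q w _; rewrite /comp /deco_frame; congr (vine_frame k _ w).
  exact: swap_at_braid.
- have hw : i + width (L := L) None <= (k * e).+1 by rewrite addn2; lia.
  have hg j : j <= k * e -> j + width (L := L) (Some g) <= (k * e).+1.
    by rewrite addn1.
  rewrite /reval_word !big_cons !big_nil !revalE !mulg1 !addn0 !addn1.
  apply: (@realizes_uniq k k _ _ (deco_frame i (Some g) \o deco_frame i None)
                                 (deco_frame i None \o deco_frame i.+1 (Some g))).
  + have hi' := hg i ltac:(lia).
    exact: realizesM (realizesD hw) (realizesD hi') (natural_deco hi').
  + have hi' := hg i.+1 ltac:(lia).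
    exact: realizesM (realizesD hi') (realizesD hw) (natural_deco hw).
  move=> q w _; rewrite /comp /deco_frame.
  by rewrite -[swap_at i q == i.+1](inj_eq (inv_inj (swap_atK i))) swap_atK swap_atR.
have hg x : i + width (L := L) (Some x) <= (k * e).+1 by rewrite addn1.
rewrite /reval_word !big_cons !big_nil !revalE !mulg1 !addn0.
apply: (@realizes_uniq k k _ _ (deco_frame i (Some b) \o deco_frame i (Some a))
                               (deco_frame i (Some c))).
- by apply: realizesM; [apply: realizesD|apply: realizesD|apply: natural_deco].
- exact: realizesD.
move=> q w _; rewrite /comp /deco_frame; case: eqP => // _.
have <- : nu a \o nu b = nu c by apply: funext => z; exact: hc.
by rewrite act_comp //; apply: nu_aut.
Qed.

(** * Normal forms evaluated as homeomorphisms *)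

Definition sem_strand := Strand sem_axioms.

Notation S := sem_strand.
Notation leaves := (split_path e (child letter_at)).
Notation root := (@root X).

Lemma realizes_path k p : valid_path e k p ->
  realizes k (k + size p) (path_value S k p) (fun phi => split_path e child_frame phi p) /\
  natural_op (k * e) ((k + size p) * e) (fun phi => split_path e child_frame phi p).
Proof.
elim: p k => [|i p IH] k.
  by move=> _; rewrite addn0; split => // h phi phi' E q w; apply: E.
rewrite [valid_path _ _ _]/= [size _]/= -addSnnS => /andP[hi /IH[hr hn]]; split.
  exact: realizesM (realizes_y hi) hr hn.
exact: natural_comp (natural_split hi) hn.
Qed.

Lemma cat_leaves A p : split_path e child_frame (fun q => cat_seq (A q)) p =
  fun q => cat_seq (leaves A p q).
Proof.
elim: p A => [|i p IH] A //; rewrite -[RHS]IH [LHS]/=; congr split_path.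
apply: funext => q; rewrite /split_at; do 2![case: ifP => // _].
by apply: funext => w; rewrite /child_frame /child -cats1 cat_seq_cat.
Qed.

Lemma leaf_frame p q w : valid_path e 0 p -> q <= size p * e ->
  fw (path_value S 0 p) (vine_frame (size p) q w) = cat_seq (leaves root p q) w.
Proof.
move=> hp hq; have [hr _] := realizes_path hp.
have E0 : vine_frame 0 = fun r => cat_seq (root r).
  by apply: funext => r; apply: funext => z; rewrite cat_seq_nil.
by rewrite hr // E0 cat_leaves.
Qed.

Lemma realizes_labs k f : realizes k k (labs S k f) (label_frame f) /\
  natural_op (k * e) (k * e) (label_frame f).
Proof.
have [hr _] := @realizes_block k 0 (k * e).+1 f (leqnn _).
split=> [q w hq|h phi phi' E q w hq]; last exact: E.
rewrite hr // /block_frame /label_frame ifT ?subn0 //.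
Qed.

Lemma normal_form_frame p t f q w : valid_path e 0 p ->
  valid_swaps e (size p) t -> q <= size p * e ->
  fw (path_value S 0 p * swaps S (size p) t * labs S (size p) f)%g
     (vine_frame (size p) q w) =
  cat_seq (leaves root p (swaps_at t q)) (act (nu (f q)) w).
Proof.
move=> hp ht hq; have [hr hn] := realizes_swaps ht.
have [hl _] := realizes_labs (size p) f.
rewrite -mulgA; rewrite [LHS]/=.
rewrite hl // /label_frame hr // /swaps_frame leaf_frame //.
by rewrite -ltnS swaps_at_lt // ltnS.
Qed.

(** If [v] properly extended [u], all values of [g] would begin with the same letter, against
    surjectivity; if [u] properly extended [v], all sequences would begin with the same letter. Both
    are impossible with two letters. *)
Lemma cat_act_inj (u v : seq X) g : tree_aut g ->
  (forall w, cat_seq u (act g w) = cat_seq v w) -> u = v /\ forall v', g v' = v'.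
Proof.
move=> hg E; have [y ny] : exists y, y != x0.
  move: hX; rewrite (cardD1 x0) inE ltnS => /card_gt0P[y].
  by rewrite !inE => /andP[ny _]; exists y.
have Euv : u = v.
  case: (leqP (size u) (size v)) => h.
    have [v' Ev _] := cat_seq_comparable h (E (fun=> x0)).
    case: v' Ev => [|z v'] Ev; first by rewrite Ev cats0.
    have zE w : act g w 0 = z.
      have := E w; rewrite Ev cat_seq_cat => /cat_seq_inj ->.
      by rewrite (cat_seq_lt _ _ x0).
    have [[g' gK g'K] _] := hg.
    pose z' := if z == x0 then y else x0.
    have hz : z' != z by rewrite /z'; case: (z =P x0) => [->|/eqP]; rewrite // eq_sym.
    have := zE (cat_seq (g' [:: z']) (fun=> x0)).
    have sz : size (g' [:: z']) = 1 by rewrite -(size_tree_aut _ hg) g'K.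
    have := mkseq_act (cat_seq (g' [:: z']) (fun=> x0)) 1 hg.
    rewrite -{2}sz mkseq_cat_seq0 g'K => -[->] zz.
    by rewrite zz eqxx in hz.
  have [u' Eu H] := cat_seq_comparable (ltnW h) (esym (E (fun=> x0))).
  exfalso; have sw w : w = cat_seq u' (act g w).
    by apply: (@cat_seq_inj _ v); rewrite -E Eu cat_seq_cat.
  case: u' Eu sw {H} => [|z u'] Eu sw; first by rewrite Eu cats0 ltnn in h.
  have zE w : w 0 = z by rewrite (sw w) (cat_seq_lt _ _ x0).
  by move/eqP: ny; apply; exact: etrans (zE (fun=> y)) (esym (zE (fun=> x0))).
split=> // v'; subst v.
have Ew : act g (cat_seq v' (fun=> x0)) = cat_seq v' (fun=> x0).
  by apply: (@cat_seq_inj _ u).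
by rewrite -[v' in g v'](mkseq_cat_seq0 v' (fun=> x0)) -(mkseq_act _ _ hg) Ew mkseq_cat_seq0.
Qed.

(** A normal form in the pair gives the same data in both factors. The homeomorphism being trivial,
    [cat_act_inj] compares leaves and labels, [leaves_perm_eq] identifies the trees and kills the
    permutation, and these facts transfer to [Q]. *)
Lemma word_value_trivial (Q : strand L) w :
  all (fun a => valid_letter a.1) w ->
  word_value S w = 1%g -> word_value Q w = 1%g.
Proof.
have he : 0 < e by lia.
move=> hw hS; have := normal_form_word (pair_strand Q S) he hw.
case=> p [q [t [f [hp hq spq ht]]]].
rewrite pair_word_value !pair_path_value pair_swaps pair_labs => -[EQ ES].
have {}ES : (path_value S 0 p * swaps S (size p) t * labs S (size p) f)%g =
    path_value S 0 q.
  by apply/divg1_eq; rewrite -ES.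
have key r : r <= size p * e ->
    leaves root p (swaps_at t r) = leaves root q r /\ forall v, nu (f r) v = v.
  move=> hr; apply: cat_act_inj; first exact: nu_aut.
  move=> v; rewrite -normal_form_frame // ES spq leaf_frame //.
  by rewrite -spq.
have [Epq triv] := leaves_perm_eq letter_at_inj Q hp hq spq ht (fun r hr => proj1 (key r hr)).
rewrite EQ Epq swaps_trivial // mulg1.
(* A label acting trivially need not be [none N], since indices may repeat elements; but it
   satisfies [lmul c c c], so the product of labels is idempotent. *)
have -> : labs Q (size p) f = 1%g.
  apply: (@mulgI _ (labs Q (size p) f)); rewrite mulg1; apply: labs_mul => r hr v.
  by have [_ E] := key r hr; rewrite !E.
by rewrite mulg1 mulgV.
Qed.

(** * Elements of V_G *)

Definition word_cover n (u : nat -> seq X) := covers n (fun q => cat_seq (u q)).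

Lemma word_cover_antichain n u : word_cover n u -> complete_antichain (mkseq u n).
Proof.
move=> [sur inj]; split; last split.
- apply/(uniqP [::]) => q q'; rewrite !inE size_mkseq => hq hq'.
  rewrite !nth_mkseq // => E.
  have H := inj q q' (fun=> x0) (fun=> x0) hq hq'; rewrite E in H.
  by case: (H erefl).
- move=> v v' /(nthP [::])[q + <-] /(nthP [::])[q' + <-]; rewrite !size_mkseq.
  move=> hq hq'; rewrite !nth_mkseq // => /prefixP[s Es].
  have [] := inj q q' (cat_seq s (fun=> x0)) (fun=> x0) hq hq'; last by move=> ->.
  by rewrite Es cat_seq_cat.
move=> xi; have [q [w [hq <-]]] := sur xi; exists (u q); last exact: mkseq_cat_seq0.
by apply/(nthP [::]); exists q; rewrite ?size_mkseq ?nth_mkseq.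
Qed.

Lemma word_cover_inj n u q q' : word_cover n u -> q < n -> q' < n ->
  u q = u q' -> q = q'.
Proof.
move=> [_ inj] hq hq' E.
have H := inj q q' (fun=> x0) (fun=> x0) hq hq'; rewrite E in H.
  by case: (H erefl).
Qed.

Lemma V_G_of_table (a : oseq X -> oseq X) n u u' (f : nat -> I) :
  word_cover n u -> word_cover n u' ->
  (forall q w, q < n -> a (cat_seq (u q) w) = cat_seq (u' q) (act (nu (f q)) w)) ->
  V_G G a.
Proof.
move=> hu hu' ha.
have mem (u0 : nat -> seq X) v : v \in mkseq u0 n -> exists2 q, q < n & v = u0 q.
  by move=> /(nthP [::])[q]; rewrite size_mkseq => hq <-; exists q; rewrite ?nth_mkseq.
have idx q : q < n -> index (u q) (mkseq u n) = q.
  move=> hq; rewrite -{1}(nth_mkseq [::] u hq) index_uniq ?size_mkseq //.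
  by have [] := word_cover_antichain hu.
exists (mkseq u n), (mkseq u' n), (fun v => u' (index v (mkseq u n))),
  (fun v => nu (f (index v (mkseq u n)))).
split; try exact: word_cover_antichain.
- split.
  + move=> v /mem[q hq ->]; rewrite idx //.
    by apply/(nthP [::]); exists q; rewrite ?size_mkseq ?nth_mkseq.
  + move=> v v' /mem[q hq ->] /mem[q' hq' ->]; rewrite !idx // => E.
    by rewrite (word_cover_inj hu' hq hq' E).
  + move=> v /mem[q hq ->]; exists (u q); rewrite ?idx //.
    by apply/(nthP [::]); exists q; rewrite ?size_mkseq ?nth_mkseq.
- by move=> v _; apply: nuG.
move=> v /mem[q hq ->] xi Exi i; rewrite idx // -ha //; congr (a _ i).
by rewrite -{1}(cat_seq_mkseq xi (size (u q))) Exi.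
Qed.

Lemma V_G_of_table_inv (a : bijection (oseq X)) n u u' (f : nat -> I) :
  word_cover n u -> word_cover n u' ->
  (forall q w, q < n -> fw a (cat_seq (u q) w) = cat_seq (u' q) (act (nu (f q)) w)) ->
  V_G G (bw a).
Proof.
move=> hu hu' ha; apply: (V_G_of_table hu' hu (f := fun q => ninv (f q))) => q w hq.
by rewrite -[w in LHS](act_nuV (f q)) -ha // fwK.
Qed.

Lemma vine_frameE k : vine_frame k = fun q => cat_seq (leaves root (vine e k) q).
Proof.
rewrite -cat_leaves; have -> : (fun q => cat_seq (root q)) = fun=> id.
  by apply: funext => r; apply: funext => z; rewrite cat_seq_nil.
by elim: k => [|k IH] //; rewrite vineS -cats1 split_path_cat -IH.
Qed.

Lemma vine_cover k : word_cover (k * e).+1 (leaves root (vine e k)).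
Proof. by rewrite /word_cover -vine_frameE; apply: covers_vine. Qed.

Lemma letter_table l : valid_letter l -> exists n u u' (f : nat -> I),
  [/\ word_cover n u, word_cover n u' & forall q w, q < n ->
    fw (letter_value S l) (cat_seq (u q) w) = cat_seq (u' q) (act (nu (f q)) w)].
Proof.
have he : 0 < e by lia.
case: l => [i _|[[k i] c] hv].
  have hi : i < i.+1 * e by rewrite mulSn; nia.
  exists (i.+2 * e).+1, (leaves root (vine e i.+2)),
    (leaves root (rcons (vine e i.+1) i)), (fun=> none N).
  have E : split i (vine_frame i.+1) =
      fun q => cat_seq (leaves root (rcons (vine e i.+1) i) q).
    by rewrite vine_frameE -!cat_leaves -cats1 split_path_cat.
  split; first exact: vine_cover.
    rewrite /word_cover -E; have := covers_split (n := (i.+1 * e).+1) _ (covers_vine i.+1).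
    by move=> /(_ _ (ltnW hi)); rewrite addSn addnC -mulSn.
  move=> q w hq; rewrite nu_none act_id.
  have := realizesY hi; move/(_ q w hq); rewrite vine_frameE => ->.
  by rewrite E.
case: c hv => [g|] hv.
  exists (k * e).+1, (leaves root (vine e k)), (leaves root (vine e k)),
    (fun q => if q == i then g else none N).
  split; try exact: vine_cover.
  move=> q w hq; have := realizesD hv; move/(_ q w hq); rewrite deco_frame_label.
  by rewrite vine_frameE.
exists (k * e).+1, (leaves root (vine e k)),
  (fun q => leaves root (vine e k) (swap_at i q)), (fun=> none N).
split; first exact: vine_cover.
  have := covers_deco (c := None) hv (covers_vine k); rewrite /word_cover.
  by rewrite /deco_frame vine_frameE.
move=> q w hq; rewrite nu_none act_id; have := realizesD hv.
by move/(_ q w hq); rewrite vine_frameE.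
Qed.

Lemma letter_V_G l : valid_letter l ->
  V_G G (fw (letter_value S l)) /\ V_G G (bw (letter_value S l)).
Proof.
move=> /letter_table[n [u [u' [f [hu hu' h]]]]]; split.
  exact: V_G_of_table hu hu' h.
exact: V_G_of_table_inv hu hu' h.
Qed.

Hypothesis hGV : forall g, G g -> exists2 h, G h & cancel g h /\ cancel h g.

Lemma act_surj g w : G g -> exists w', act g w' = w.
Proof.
move=> Gg; have [h Gh [_ K]] := hGV Gg; exists (act h w).
rewrite -act_comp; try exact: hG.
by have -> : g \o h = id; [apply: funext => v; apply: K|rewrite act_id].
Qed.

Lemma V_G_unfold f : V_G G f -> exists A1 A2 alpha gv,
  [/\ complete_antichain A1, complete_antichain A2,
      [/\ (forall v, v \in A1 -> alpha v \in A2),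
           {in A1 &, injective alpha} &
           (forall u, u \in A2 -> exists2 v, v \in A1 & alpha v = u)],
      (forall v, v \in A1 -> G (gv v)) &
      (forall v w, v \in A1 ->
        f (cat_seq v w) = cat_seq (alpha v) (act (gv v) w))].
Proof.
move=> [A1 [A2 [alpha [gv [h1 h2 h3 h4 h5]]]]]; exists A1, A2, alpha, gv; split=> //.
move=> v w hv; apply: funext => n; rewrite (h5 v hv) ?mkseq_cat_seq0 //.
by congr (cat_seq _ (act _ _) n); apply: funext => m; rewrite cat_seq_add.
Qed.

(** [V_G] is a predicate on plain functions, so bijectivity has to be derived: injectivity from
    comparability in the target antichain, surjectivity from its completeness. *)
Lemma V_G_bijective f : V_G G f -> injective f /\ forall w, exists xi, f xi = w.
Proof.
move/V_G_unfold => [A1 [A2 [alpha [gv [[_ [_ c1]] [_ [a2 c2]] [al inj sur] Ggv E]]]]].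
have dec xi : exists2 v, v \in A1 & exists w, xi = cat_seq v w.
  have [v hv Ev] := c1 xi; exists v => //; exists (fun k => xi (k + size v)).
  by rewrite -{1}(cat_seq_mkseq xi (size v)) Ev.
split=> [xi xi'|w].
  have [v hv [w ->]] := dec xi; have [v' hv' [w' ->]] := dec xi'.
  rewrite !E // => Ef; have Ealpha : alpha v = alpha v'.
    case: (leqP (size (alpha v)) (size (alpha v'))) => h.
      have [s Es _] := cat_seq_comparable h Ef.
      by apply: a2; rewrite ?al // Es prefix_prefix.
    have [s Es _] := cat_seq_comparable (ltnW h) (esym Ef).
    by apply/esym; apply: a2; rewrite ?al // Es prefix_prefix.
  have Ev : v = v' by apply: inj.
  subst v'; congr cat_seq; apply: (act_inj (hG (Ggv v hv))).
  exact: cat_seq_inj Ef.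
have [u hu Eu] := c2 w; have [v hv Ev] := sur u hu.
have [w' Ew'] := act_surj (fun k => w (k + size u)) (Ggv v hv).
exists (cat_seq v w'); rewrite E // Ew' Ev.
by rewrite -{2}(cat_seq_mkseq w (size u)) Eu.
Qed.

(** The tree is taken so deep that each leaf extends a word [v] of the source antichain far enough
    for the section of [gv v] to lie in the nucleus. *)
Lemma V_G_table f : V_G G f -> exists r (u : nat -> seq X) (c : nat -> I),
  valid_path e 0 r /\ forall q w, q <= size r * e ->
    f (cat_seq (leaves root r q) w) = cat_seq (u q) (act (nu (c q)) w).
Proof.
move/V_G_unfold => [A1 [A2 [alpha [gv [[_ [_ c1]] _ _ Ggv E]]]]].
have [dp hdp] : exists dp : seq X -> nat, forall v, v \in A1 -> forall s,
    dp v <= size s -> exists c, forall w, gv v (s ++ w) = gv v s ++ nu c w.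
  have H v : exists n, v \in A1 -> forall s,
      n <= size s -> exists c, forall w, gv v (s ++ w) = gv v s ++ nu c w.
    case: (boolP (v \in A1)) => hv; last by exists 0.
    by have [n hn] := nu_absorb N (Ggv v hv); exists n.
  by have [dp hdp] := choice H; exists dp.
pose m := \max_(v <- A1) (size v + dp v).
have hm v : v \in A1 -> size v + dp v <= m.
  by move=> hv; rewrite /m (big_rem v) //= leq_maxl.
have [r hr hd] := deep_path e letter_at m 0 root.
have H q : exists uc : seq X * I, q <= size r * e -> forall w,
    f (cat_seq (leaves root r q) w) = cat_seq uc.1 (act (nu uc.2) w).
  case: (leqP q (size r * e)) => hq; last by exists ([::], none N).
  set b := leaves root r q; have hb : m <= size b by apply: hd.
  have [v hv Ev] := c1 (cat_seq b (fun=> x0)).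
  have szv := hm v hv; have hs : size v <= size b by lia.
  have [s Eb] : exists s, b = v ++ s.
    have E' : cat_seq v (fun k => cat_seq b (fun=> x0) (k + size v)) =
        cat_seq b (fun=> x0) by rewrite -{1}Ev cat_seq_mkseq.
    by have [s Es _] := cat_seq_comparable hs E'; exists s.
  have [|c hc] := hdp v hv s; first by
    rewrite -(leq_add2l (size v)) -size_cat -Eb (leq_trans szv).
  exists (alpha v ++ gv v s, c) => _ w; rewrite Eb cat_seq_cat E // [RHS]cat_seq_cat.
  by rewrite (act_cat_seq _ (hG (Ggv v hv)) (nu_aut c) hc).
have [uc huc] := choice H.
by exists r, (fun q => (uc q).1), (fun q => (uc q).2); split=> // q w hq; apply: huc.
Qed.

Lemma leaves_cover k p A : valid_path e k p -> word_cover (k * e).+1 A ->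
  word_cover ((k + size p) * e).+1 (leaves A p).
Proof.
elim: p k A => [|i p IH] k A; first by rewrite addn0.
rewrite [valid_path _ _ _]/= [size _]/= -addSnnS => /andP[hi hp] hA.
apply: (IH k.+1 (split_at e (child letter_at) i A)) => //.
have E : split i (fun q => cat_seq (A q)) =
    fun q => cat_seq (split_at e (child letter_at) i A q) := cat_leaves A [:: i].
have := covers_split (n := (k * e).+1) hi hA; rewrite addSn addnC -mulSn.
by rewrite E.
Qed.

Lemma root_cover : word_cover (0 * e).+1 root.
Proof.
split=> [xi|q q' w w']; first by exists 0, xi; rewrite cat_seq_nil.
by rewrite mul0n !ltnS !leqn0 => /eqP -> /eqP -> /cat_seq_inj.
Qed.

(** Leaves that are not words of the cover are split, keeping the invariant that no word of the
    cover is a proper prefix of a leaf. The bound [m] on the lengths makes this stop. *)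
Lemma cover_tree n u : word_cover n u -> exists2 p, valid_path e 0 p &
  forall q, q <= size p * e -> exists2 q', q' < n & u q' = leaves root p q.
Proof.
move=> hu; pose m := \max_(q < n) size (u q).
have hm q : q < n -> size (u q) <= m by move=> hq; apply: (leq_bigmax (Ordinal hq)).
pose P k j := forall A : nat -> seq X, (forall q, j q = m - size (A q)) ->
  word_cover (k * e).+1 A ->
  (forall q q', q <= k * e -> q' < n -> prefix (u q') (A q) -> u q' = A q) ->
  exists2 p, valid_path e k p &
    forall q, q <= (k + size p) * e -> exists2 q', q' < n & u q' = leaves A p q.
have main k j : P k j.
  apply: (@refinement_ind e P) => {}k {}j IH A hj hA hpre.
  have [[i hi no]|all_in] := pselect (exists2 i, i <= k * e &
      ~ exists2 q', q' < n & u q' = A i); last first.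
    exists [::] => // q; rewrite addn0 => hq.
    by case: (pselect (exists2 q', q' < n & u q' = A q)) => // no; case: all_in; exists q.
  (* The word of the cover that contains a point below the leaf [A i] is not a prefix of it, hence
     is longer, so [A i] is shorter than [m]. *)
  have ji : 0 < j i.
    have [sur _] := hu; have [q' [w [hq' Ew]]] := sur (cat_seq (A i) (fun=> x0)).
    rewrite hj subn_gt0; apply: leq_trans (hm q' hq'); rewrite ltnNge.
    apply/negP => hs; case: no; exists q' => //; apply: hpre => //.
    by have [s -> _] := cat_seq_comparable hs Ew; apply: prefix_prefix.
  have [|||p hp hl] := IH i hi ji (split_at e (child letter_at) i A).
  - move=> q; rewrite /split_at /child; do 2!case: ifP => // _.
    by rewrite size_rcons hj subnS.
  - have := @leaves_cover k [:: i] A; rewrite /= hi addn1; exact.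
  - move=> q q' hq hq' hp.
    move: hp; rewrite /split_at; case: (ltnP q i) => h1.
      by apply: hpre => //; lia.
    case: (ltnP q (i + e.+1)) => h2; last first.
      by apply: hpre => //; move: hq; rewrite mulSn; lia.
    rewrite /child => hp.
    case: (leqP (size (u q')) (size (A i))) => hs; last first.
      by apply: prefix_size_eq => //; rewrite size_rcons.
    case: no; exists q' => //; apply: hpre => //.
    by move: hp; rewrite !prefixE -cats1 takel_cat.
  by exists (i :: p); [rewrite /= hi|move=> q hq; apply: hl; rewrite addSnnS].
have [|p hp hl] := main 0 _ root (fun q => erefl) root_cover.
  by move=> q q' _ _; rewrite prefixs0 => /eqP.
by exists p.
Qed.

Lemma V_G_normal_form f : V_G G f -> exists p r t c,
  [/\ valid_path e 0 p, valid_path e 0 r, size p = size r,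
     valid_swaps e (size p) t &
     f =1 (path_value S 0 p * swaps S (size p) t * labs S (size p) c
            / path_value S 0 r)%g].
Proof.
move=> Vf; have [finj fsur] := V_G_bijective Vf.
have [r [u [c [hr Ef]]]] := V_G_table Vf; pose n := (size r * e).+1.
have hb : word_cover n (leaves root r) := leaves_cover hr root_cover.
(* Being bijective, [f] sends the cones at the leaves of [r] onto the cones at the words [u q],
   which therefore partition the space again. *)
have hu : word_cover n u.
  case: hb => sur inj; split=> [xi|q q' w w' hq hq' E].
    have [w Ew] := fsur xi; have [q [w' [hq E]]] := sur w.
    by exists q, (act (nu (c q)) w'); split=> //; rewrite -Ef // E.
  have := inj q q' (act (nu (ninv (c q))) w) (act (nu (ninv (c q'))) w') hq hq'.
  case; first by apply: finj; rewrite !Ef // !act_nuV.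
  move=> Eq; subst q'; split => //; apply: cat_seq_inj E.
have [p hp hl] := cover_tree hu.
have hlp : word_cover (size p * e).+1 (leaves root p) := leaves_cover hp root_cover.
pose B := mkseq (leaves root p) (size p * e).+1; pose U := mkseq u n.
have [[uU _] [uB _]] := (word_cover_antichain hu, word_cover_antichain hlp).
have sBU : {subset B <= U}.
  move=> v /(nthP [::])[q]; rewrite size_mkseq => hq <-; rewrite nth_mkseq //.
  have [q' hq' <-] := hl q hq; apply/(nthP [::]); exists q'; rewrite ?size_mkseq //.
  by rewrite nth_mkseq.
have sUB : {subset U <= B}.
  move=> v /(nthP [::])[q']; rewrite size_mkseq => hq' <-; rewrite nth_mkseq //.
  case: (hlp) => sur _; have [q [w [hq Ew]]] := sur (cat_seq (u q') (fun=> x0)).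
  have [q'' hq'' Eu] := hl q hq; case: (hu) => _ inj.
  have [Eq _] : q'' = q' /\ w = (fun=> x0) by apply: inj => //; rewrite Eu Ew.
  apply/(nthP [::]); exists q; rewrite ?size_mkseq // nth_mkseq //.
  by rewrite -Eu Eq.
have sz : size B = size U.
  by apply/eqP; rewrite eqn_leq !uniq_leq_size.
have spr : size p = size r.
  have he : 0 < e by lia.
  move: sz; rewrite !size_mkseq /n => -[/eqP]; rewrite eqn_mul2r => /orP[|/eqP //].
  by move/eqP => e1; rewrite e1 in he.
have nE : (size p * e).+1 = n by rewrite spr.
(* The leaves of [p] are the words [u q] in another order; [pi] is the permutation of the normal
   form. *)
pose pi q := index (u q) B.
have hpi q : q < n -> pi q < n /\ leaves root p (pi q) = u q.
  move=> hq; have huB : u q \in B.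
    by apply: sUB; apply/(nthP [::]); exists q; rewrite ?size_mkseq ?nth_mkseq.
  have hlt : pi q < n.
    by rewrite -nE -[X in _ < X](size_mkseq (leaves root p)) index_mem.
  split=> //; rewrite -nE in hlt.
  by rewrite -(nth_mkseq [::] (leaves root p) hlt) nth_index.
have [q /hpi[]//|q q' hq hq' E|t ht Et] := @swaps_of_injection n pi.
  apply: (word_cover_inj hu) => //.
  by have [_ <-] := hpi q hq; have [_ <-] := hpi q' hq'; rewrite E.
exists p, r, t, c; split => //.
  by rewrite /valid_swaps spr.
move=> xi; have [sur _] := hb; have [q [w [hq <-]]] := sur xi.
rewrite ltnS in hq; rewrite Ef // [RHS]/= -(leaf_frame w hr hq) fwK.
have hq' : q <= size p * e by rewrite spr.
have ht' : all (fun i => i < size r * e) t by [].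
have := @normal_form_frame p t c q w hp _ hq'; rewrite /valid_swaps spr => /(_ ht') E.
symmetry; apply: etrans E _; rewrite Et //.
by have [_ ->] := hpi q hq.
Qed.

End Semantics.

(** * Existence of the nucleus *)

(** Repetitions and values outside [P] are allowed, which makes unions and subsets immediate. *)
Definition finite_pred (T : Type) (P : T -> Prop) :=
  exists (J : finType) (s : J -> T), forall h, P h -> exists i, s i = h.

Lemma finite_predU T (P P' : T -> Prop) :
  finite_pred P -> finite_pred P' -> finite_pred (fun h => P h \/ P' h).
Proof.
move=> [J [s hs]] [J' [s' hs']]; exists (J + J')%type.
exists (fun i => match i with inl j => s j | inr j => s' j end) => h [/hs|/hs'] [i <-].
  by exists (inl i).
by exists (inr i).
Qed.

Lemma finite_pred_bigU T (J : finType) (P : J -> T -> Prop) :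
  (forall j, finite_pred (P j)) -> finite_pred (fun h => exists j, P j h).
Proof.
move=> H; have [K hK] := choice H; pose s j := projT1 (cid (hK j)).
exists {j : J & K j}, (fun i => s (tag i) (tagged i)) => h [j hj].
have [i Ei] : exists i, s j i = h by rewrite /s; case: (cid _) => t /= /(_ h hj).
by exists (Tagged K i).
Qed.

Lemma finite_pred_sub T (P P' : T -> Prop) :
  (forall h, P h -> P' h) -> finite_pred P' -> finite_pred P.
Proof. by move=> H [J [s hs]]; exists J, s => h /H /hs. Qed.

Lemma finite_pred_In T (s : seq T) : finite_pred (fun h => List.In h s).
Proof.
elim: s => [|x s IH]; first by exists void, (@of_void T).
apply: (@finite_pred_sub _ _ (fun h => h = x \/ List.In h s)).
  by move=> h /= [->|]; [left|right].
by apply: finite_predU => //; exists unit, (fun=> x) => h ->; exists tt.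
Qed.

Section NucleusExists.
Variables (X : finType) (G : (seq X -> seq X) -> Prop) (x0 : X).
Hypotheses (ssG : self_similar G) (cG : contracting G).

Lemma G_aut g : G g -> tree_aut g. Proof. by case: ssG => -[h _] _ /h. Qed.

Lemma G_section g v : G g -> exists2 h, G h & forall w, g (v ++ w) = g v ++ h w.
Proof.
elim: v g => [|x v IH] g Gg.
  exists g => // w; rewrite (size0nil (s := g [::])) //.
  by rewrite (size_tree_aut _ (G_aut Gg)).
have [_ /(_ g x Gg)[h [y [Gh Eh]]]] := ssG.
have [h' Gh' Eh'] := IH h Gh.
by exists h' => // w; rewrite cat_cons !Eh Eh'.
Qed.

Definition is_section g v h := G h /\ forall w, g (v ++ w) = g v ++ h w.

Lemma is_section_uniq g v h h' : is_section g v h -> is_section g v h' -> h = h'.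
Proof.
move=> [_ E] [_ E']; apply: funext => w.
by have := E w; rewrite E' => /eqP; rewrite eqseq_cat // eqxx => /eqP.
Qed.

(** The set from [contracting] need not be closed, so all sections of its elements and of their
    inverses are taken. They are finitely many, because sections at long words fall back into the
    set. Closure under inverses is the formula that the inverse of a section of [g] at [u] is the
    section of the inverse of [g] at [g u]; the identity is its own section at a long word. *)
Lemma nucleus_exists : exists N : nucleus G, True.
Proof.
have [[_ [G1 [GM GV]]] _] := ssG.
have [N0 [N0G absorb]] := cG.
pose base g := List.In g N0 \/ exists2 g', List.In g' N0 & cancel g' g /\ cancel g g'.
have baseG g : base g -> G g.
  move=> [/N0G//|[g' /N0G Gg' [K K']]]; have [h Gh [Kh Kh']] := GV g' Gg'.
  by have -> : g = h by apply: funext => v; rewrite -{1}[v]Kh' K.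
pose P h := exists g v, base g /\ is_section g v h.
have finN0 : finite_pred (fun h => List.In h N0) by exact: finite_pred_In.
have finB : finite_pred base.
  apply: finite_predU => //; case: finN0 => J [s hs].
  have [t ht] : exists t : J -> seq X -> seq X, forall i g,
      cancel (s i) g -> cancel g (s i) -> g = t i.
    have H i : exists t : seq X -> seq X, forall g,
        cancel (s i) g -> cancel g (s i) -> g = t.
      have [[t [K K']]|no] := pselect (exists t, cancel (s i) t /\ cancel t (s i)).
        by exists t => g Kg Kg'; apply: funext => v; rewrite -{1}[v]K' Kg.
      by exists id => g Kg Kg'; case: no; exists g.
    by have [t ht] := choice H; exists t => i g; apply: ht.
  exists J, t => h [g' /hs[i <-] [K K']]; exists i.
  by rewrite -(ht i h).
have finP : finite_pred P.
  case: finB => J [s hs].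
  pose B (j : J) h := base (s j) /\ exists v, is_section (s j) v h.
  apply: (@finite_pred_sub _ _ (fun h => exists j, B j h)).
    by move=> h [g [v [bg sv]]]; have [i Ei] := hs g bg; exists i; rewrite /B Ei; split => //; exists v.
  apply: finite_pred_bigU => j.
  have [bj|nb] := pselect (base (s j)); last first.
    by exists void, (@of_void _) => h [].
  have [n hn] := absorb _ (baseG _ bj).
  have [sec hsec] : exists sec, forall v, is_section (s j) v (sec v).
    have H v : exists h, is_section (s j) v h.
      by have [h Gh Eh] := G_section v (baseG _ bj); exists h.
    by have [sec hsec] := choice H; exists sec.
  apply: (@finite_pred_sub _ _ (fun h => List.In h N0 \/
      exists m : 'I_n, exists t : m.-tuple X, h = sec t)).
    move=> h [_ [v sv]]; case: (leqP n (size v)) => hv.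
      have [h' [Nh' Eh']] := hn v hv; left.
      by rewrite (is_section_uniq sv (conj (N0G _ Nh') Eh')).
    right; exists (Ordinal hv), (in_tuple v).
    exact: is_section_uniq sv (hsec v).
  apply: finite_predU => //; apply: finite_pred_bigU => m.
  by exists {: m.-tuple X}, (fun t : m.-tuple X => sec t) => h [t ->]; exists t.
case: finP => J [s hs].
pose I : finType := {i : J | `[< P (s i) >]}.
pose nu (a : I) := s (val a).
have nuP a : P (nu a) by have /asboolP := valP a.
have nu_sur h : P h -> exists a, nu a = h.
  move=> Ph; have [i Ei] := hs h Ph.
  have Pi : `[< P (s i) >] by apply/asboolP; rewrite Ei.
  by exists (exist _ i Pi).
have nuG a : G (nu a) by have [g [v [_ []]]] := nuP a.
have N0P h : List.In h N0 -> P h.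
  move=> Nh; exists h, [::]; split; first by left.
  split; first exact: N0G.
  move=> w; rewrite (size0nil (s := h [::])) //.
  by rewrite (size_tree_aut _ (G_aut (N0G _ Nh))).
have [i1 Ei1] : exists a, nu a = id.
  have [n hn] := absorb _ G1; have [|h [Nh Eh]] := hn (nseq n x0).
    by rewrite size_nseq.
  have Eid : h = id.
    apply: funext => w; have /eqP := Eh w.
    by rewrite eqseq_cat // eqxx /= => /eqP.
  by apply: nu_sur; rewrite -Eid; apply: N0P.
have secP a v h : is_section (nu a) v h -> P h.
  move=> [Gh Eh]; have [g [u [bg [_ Eg]]]] := nuP a.
  exists g, (u ++ v); split=> //; split=> // w.
  by rewrite -catA !Eg Eh catA.
have invP a : exists b, cancel (nu a) (nu b) /\ cancel (nu b) (nu a).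
  have [g [u [bg [Ga Eg]]]] := nuP a.
  have [h Gh [K K']] := GV _ Ga.
  have [g' bg' [Kg Kg']] : exists2 g', base g' & cancel g g' /\ cancel g' g.
    case: bg => [Ng|[g' Ng' [Kg Kg']]]; last by exists g' => //; left.
    have [g' Gg' [Kg Kg']] := GV g (N0G _ Ng).
    by exists g' => //; right; exists g.
  have [b Eb] : exists b, nu b = h.
    apply: nu_sur; exists g', (g u); split => //; split => // w.
    by rewrite -{1}[w]K' -Eg !Kg.
  by exists b; rewrite Eb.
have [iv hiv] := choice invP.
have [sx hsx] : exists sx : I * X -> X * I, forall p w,
    nu p.1 (p.2 :: w) = (sx p).1 :: nu (sx p).2 w.
  have H (p : I * X) : exists r : X * I, forall w, nu p.1 (p.2 :: w) = r.1 :: nu r.2 w.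
    case: p => a y /=; have [_ /(_ _ y (nuG a))[h [z [Gh Eh]]]] := ssG.
    have [b Eb] : exists b, nu b = h.
      apply/nu_sur/(secP a [:: y]); split => // w.
      rewrite cat1s Eh Eh (size0nil (s := h [::])) //.
      by rewrite (size_tree_aut _ (G_aut Gh)).
    by exists (z, b); rewrite /= Eb.
  by have [sx hsx] := choice H; exists sx.
unshelve refine (ex_intro _ (@Nucleus X G I nu i1 iv (fun a y => (sx (a, y)).1)
  (fun a y => (sx (a, y)).2) nuG Ei1 _ _ _ _ _) Logic.I).
- by move=> a v; have [_ ->] := hiv a.
- by move=> a y v; have /= -> := hsx (a, y) v.
- move=> a y z E; have [/bij_inj inj _] := G_aut (nuG a).
  have n0 b : nu b [::] = [::].
    by apply: size0nil; rewrite (size_tree_aut _ (G_aut (nuG b))).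
  suff /inj[] : nu a [:: y] = nu a [:: z] by [].
  by have /= -> := hsx (a, y) [::]; have /= -> := hsx (a, z) [::]; rewrite !n0 E.
- move=> g Gg; have [n hn] := absorb g Gg; exists n => v hv.
  have [h [Nh Eh]] := hn v hv; have [c Ec] := nu_sur _ (N0P _ Nh).
  by exists c; rewrite Ec.
move=> a b; have [n hn] := absorb _ (GM _ _ (nuG a) (nuG b)); exists n => v hv.
have [h [Nh Eh]] := hn v hv; have [c Ec] := nu_sur _ (N0P _ Nh).
by exists c; rewrite Ec.
Qed.

End NucleusExists.

(** * Finite generation and finitely many relations *)

Section BaseLetters.
Variables (e : nat) (L : labels e) (J : nat).
Hypotheses (e0 : 0 < e) (J3 : 3 <= J).

Definition base_letter (l : letter L) := valid_letter l &&
  match l with inl i => i < J * e | inr (k, _, _) => k <= J end.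

Section Generation.
Variable Q : strand L.
Notation y := (ysplit e (sY Q)).
Notation D := (sD Q).

Lemma word_value_cat w w' :
  word_value Q (w ++ w') = (word_value Q w * word_value Q w')%g.
Proof. exact: big_cat. Qed.

Definition generated (a : Q) :=
  exists2 w, all (fun a => base_letter a.1) w & word_value Q w = a.

Lemma generated1 : generated 1%g.
Proof. by exists [::]; rewrite /word_value ?big_nil. Qed.

Lemma generatedM a b : generated a -> generated b -> generated (a * b)%g.
Proof.
move=> [w hw <-] [w' hw' <-]; exists (w ++ w'); first by rewrite all_cat hw.
by rewrite /word_value big_cat.
Qed.

Lemma generatedV a : generated a -> generated (a^-1)%g.
Proof.
move=> [w hw <-]; exists (rev [seq (x.1, ~~ x.2) | x <- w]).
  by rewrite all_rev all_map; apply: sub_all hw.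
elim: w {hw} => [|[l b] w IH]; first by rewrite /word_value !big_nil invg1.
rewrite map_cons rev_cons -cats1 word_value_cat IH /word_value big_seq1 big_cons.
by rewrite invgM; congr (_ * _)%g => /=; case: b; rewrite ?invgK.
Qed.

(** A letter of high level is a conjugate by [Y 0] of one of lower level or, near the left end,
    equal to one. *)
Lemma generated_letter l : valid_letter l -> generated (letter_value Q l).
Proof.
have base l' : base_letter l' -> generated (letter_value Q l').
  by move=> hl; exists [:: (l', true)]; rewrite /= ?hl // /word_value big_seq1.
have hJ : 3 * e <= J * e by rewrite leq_mul2r J3 orbT.
have g0 : generated (sY Q 0) by apply: (base (inl 0)); rewrite /base_letter /=; lia.
have conj a : generated a -> generated (a ^ sY Q 0)%g.
  move=> ha; rewrite conjgE; apply: generatedM; first exact: generatedV.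
  exact: generatedM.
case: l => [i _|[[k i] c]].
  elim/ltn_ind: i => i IH; case: (ltnP i (J * e)) => hi; first exact: (base (inl i)).
  have hie : i - e < i.+1 * e by nia.
  have := @yY e L Q i.+1 0 (i - e); rewrite subnK; last by lia.
  move=> /(_ ltac:(lia) (ltnW hie)).
  rewrite /ysplit hie !ifT; try nia.
  by move/conjg_eq; rewrite [letter_value _ _]/= => <-; apply: conj; apply: IH; lia.
elim: k i => [|k IH] i hv.
  by apply: (base (inr (0, i, c))); rewrite /base_letter hv.
case: (ltnP k J) => hk.
  by apply: (base (inr (k.+1, i, c))); rewrite /base_letter hv.
have hkk : J * e <= k * e by rewrite leq_mul2r hk orbT.
have w2 : 0 < width c <= 2 by case: (c).
move: hv; rewrite /valid_letter mulSn => hv.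
case: (ltnP e i) => hi.
  have hv' : i - e + width c <= (k * e).+1 by lia.
  have := @Dyl e L Q k (i - e) 0 c ltac:(lia) hv'.
  rewrite subnK; last by lia.
  rewrite /ysplit ifT; last by lia.
  by move/conjg_eq; rewrite [letter_value _ _]/= => <-; apply: conj; apply: IH.
have hv' : i + width c <= k * e by lia.
have := @Dyr e L Q k i (k * e) c hv' (leqnn _).
by rewrite /ysplit ltnn mulg1 mul1g [letter_value _ _]/= => <-; apply: IH; exact: leqW.
Qed.

Lemma generated_prod (T : eqType) (s : seq T) (F : T -> Q) :
  (forall x, x \in s -> generated (F x)) -> generated (\prod_(x <- s) F x)%g.
Proof.
elim: s => [|x s IH] h; first by rewrite big_nil; apply: generated1.
rewrite big_cons; apply: generatedM; first by apply: h; rewrite inE eqxx.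
by apply: IH => z hz; apply: h; rewrite inE hz orbT.
Qed.

Lemma generated_path k p : valid_path e k p -> generated (path_value Q k p).
Proof.
elim: p k => [|i p IH] k /=; first by move=> _; apply: generated1.
case/andP=> hi /IH hp; apply: generatedM => //; rewrite /ysplit.
by case: ifP => _; [apply: (generated_letter (l := inl i))|apply: generated1].
Qed.

Lemma generated_normal_form a : normal_form a -> generated a.
Proof.
move=> [p [q [t [f [hp hq _ ht ->]]]]].
apply: generatedM; last exact/generatedV/generated_path.
apply: generatedM; first apply: generatedM; first exact: generated_path.
  apply: generated_prod => i hi; apply: (generated_letter (l := inr (_, _, _))).
  by have := allP ht i hi; rewrite /=; lia.
apply: generated_prod => i; rewrite mem_index_iota => hi.
by apply: (generated_letter (l := inr (_, _, _))); rewrite /=; lia.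
Qed.

End Generation.

(* The longest relation is the splitting of a label. *)
Definition relation_bound := (\max_(g : lab L) size (lswaps g) + 2 * e + 12)%N.

Lemma local_rel_bound W (u v : seq (rletter L)) : local_rel W u v -> size u + size v <= relation_bound.
Proof.
have hg (g : lab L) : size (lswaps g) <= \max_(g : lab L) size (lswaps g).
  exact: leq_bigmax.
rewrite /relation_bound; case=> [|g|||g|a b c _];
  rewrite /= ?size_cat /= ?size_map ?size_iota; try lia.
by have := hg g; lia.
Qed.

(** Each axiom of level below [J] equates two short words, and their letters have level at most
    [k.+1 <= J], so they are base letters. Being true in [S], it is transferred by the
    hypothesis. *)
Lemma bounded_axioms (P S : groupType) (lP : letter L -> P) (lS : letter L -> S) :
  (forall k, strand_axioms_at (fun i => lS (inl i)) (fun k i c => lS (inr (k, i, c))) k) ->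
  (forall u v : seq (letter L), all base_letter u -> all base_letter v ->
     size u + size v <= relation_bound ->
     (\prod_(l <- u) lS l = \prod_(l <- v) lS l)%g ->
     (\prod_(l <- u) lP l = \prod_(l <- v) lP l)%g) ->
  forall k, k < J ->
    strand_axioms_at (fun i => lP (inl i)) (fun k i c => lP (inr (k, i, c))) k.
Proof.
move=> axS tr k hk; have [S1 S2 S3 S4 S5] := axS k.
(* A trivial splitting is represented by the empty word, since it is not a letter. *)
pose yw k i : seq (letter L) := if i < k * e then [:: inl i] else [::].
have ywE (R : groupType) (lR : letter L -> R) k' i :
    ysplit e (fun i => lR (inl i)) k' i = (\prod_(l <- yw k' i) lR l)%g.
  by rewrite /ysplit /yw; case: ifP => _; rewrite ?big_seq1 ?big_nil.
have DE (R : groupType) (lR : letter L -> R) l : lR l = (\prod_(l <- [:: l]) lR l)%g.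
  by rewrite big_seq1.
have yw_base k' i : k' <= J -> all base_letter (yw k' i).
  move=> hk'; rewrite /yw; case: ifP => //= hi; rewrite /base_letter /= andbT.
  by apply: leq_trans hi _; rewrite leq_mul2r hk' orbT.
have yw_size k' i : size (yw k' i) <= 1 by rewrite /yw; case: ifP.
have hb : 4 <= relation_bound by rewrite /relation_bound; lia.
have b1 k' i c : k' <= J -> i + width c <= (k' * e).+1 ->
    all base_letter [:: inr (k', i, c)].
  by move=> hk' hi; rewrite /= /base_letter /= hi hk'.
have hkJ : k <= J := ltnW hk.
split.
- move=> i j ij hj; have := S1 i j ij hj; rewrite !ywE -!big_cat; apply: tr.
  + by rewrite all_cat !yw_base.
  + by rewrite all_cat !yw_base.
  rewrite !size_cat; apply: leq_trans hb.
  have h1 := yw_size k j; have h2 := yw_size k.+1 i.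
  have h3 := yw_size k i; have h4 := yw_size k.+1 (j + e); lia.
- move=> i j c ij hi; have := S2 i j c ij hi.
  rewrite !ywE (DE _ lS (inr (k, i, c))) (DE _ lS (inr (k.+1, i + e, c))).
  rewrite (DE _ lP (inr (k, i, c))) (DE _ lP (inr (k.+1, i + e, c))) -!big_cat.
  apply: tr.
  + by rewrite all_cat yw_base // b1.
  + by rewrite all_cat yw_base // b1 // mulSn; lia.
  rewrite !size_cat ![size [:: _]]/=; apply: leq_trans hb.
  by have := yw_size k j; lia.
- move=> i j c ij hi; have := S3 i j c ij hi.
  rewrite !ywE (DE _ lS (inr (k, i, c))) (DE _ lS (inr (k.+1, i, c))).
  rewrite (DE _ lP (inr (k, i, c))) (DE _ lP (inr (k.+1, i, c))) -!big_cat.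
  apply: tr.
  + by rewrite all_cat yw_base // b1 //; lia.
  + by rewrite all_cat yw_base // b1 // mulSn; lia.
  rewrite !size_cat ![size [:: _]]/=; apply: leq_trans hb.
  by have := yw_size k j; lia.
- move=> i j c c' ij hi; have := S4 i j c c' ij hi.
  rewrite (DE _ lS (inr (k, i, c))) (DE _ lS (inr (k, j, c'))).
  rewrite (DE _ lP (inr (k, i, c))) (DE _ lP (inr (k, j, c'))) -!big_cat.
  by apply: tr; rewrite ?all_cat ?b1 //; lia.
move=> W u v i huv hi; have := S5 W u v i huv hi.
pose rw (l : rletter L) : seq (letter L) :=
  let: (h, a, c) := l in if c is Some c then [:: inr (k + h, i + a, c)]
  else yw (k + h) (i + a).
have rwE (R : groupType) (lR : letter L -> R) s :
    reval_word (fun i => lR (inl i)) (fun k i c => lR (inr (k, i, c))) k i s =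
    (\prod_(l <- flatten [seq rw l | l <- s]) lR l)%g.
  elim: s => [|[[h a] c] s IH]; first by rewrite /reval_word !big_nil.
  rewrite map_cons [flatten _]/= big_cat -IH /reval_word big_cons; congr (_ * _)%g.
  by rewrite /reval /rw; case: c => [c|]; rewrite ?ywE ?big_seq1.
have rw_base s : all (in_window W) s -> all base_letter (flatten [seq rw l | l <- s]).
  elim: s => [|[[h a] c] s IH] //= /andP[/andP[hh ha] /IH hs].
  have hm : (k + h) * e = k * e + h * e by rewrite mulnDl.
  rewrite all_cat hs andbT; case: c ha => [c|] ha; last by apply: yw_base; lia.
  by apply: b1; lia.
have rw_size s : size (flatten [seq rw l | l <- s]) <= size s.
  elim: s => [|[[h a] c] s IH] //=; rewrite size_cat -add1n leq_add //.
  by case: c => [c|] //; apply: yw_size.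
have [_ hu hv] := local_rel_window huv.
rewrite !rwE; apply: tr; try exact: rw_base.
by apply: leq_trans (local_rel_bound huv); apply: leq_add.
Qed.

End BaseLetters.

(** * Groups given by a presentation *)

Section PresentedGroup.
Variable R : seq gword.

Definition inv_word (w : gword) : gword := rev (map inv_letter w).

Lemma inv_letterK : involutive inv_letter.
Proof. by case=> i b; rewrite /inv_letter /= negbK. Qed.

Lemma inv_wordK : involutive inv_word.
Proof.
move=> w; rewrite /inv_word map_rev revK -map_comp -[RHS]map_id.
by apply: eq_map => a /=; apply: inv_letterK.
Qed.

Lemma pres_eq_cat u v a b : pres_eq R u v -> pres_eq R (a ++ u ++ b) (a ++ v ++ b).
Proof.
elim=> {u v} [w|u v _ IH|u v w _ IH _ IH'|u v l|u v r hr].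
- exact: pe_refl.
- exact: pe_sym.
- exact: pe_trans IH IH'.
- by have := pe_free R (a ++ u) (v ++ b) l; rewrite -!catA.
by have := pe_rel (a ++ u) (v ++ b) hr; rewrite -!catA.
Qed.

Lemma pres_eq_cat2 u v u' v' :
  pres_eq R u v -> pres_eq R u' v' -> pres_eq R (u ++ u') (v ++ v').
Proof.
move=> h h'; apply: (@pe_trans _ _ (v ++ u')).
  by have := pres_eq_cat [::] u' h.
by have := pres_eq_cat v [::] h'; rewrite !cats0.
Qed.

Lemma pres_eq_inv_r w : pres_eq R (w ++ inv_word w) [::].
Proof.
elim: w => [|a w IH]; first exact: pe_refl.
rewrite /inv_word map_cons rev_cons -cats1; apply: pe_trans (pe_free R [::] [::] a).
by have := pres_eq_cat [:: a] [:: inv_letter a] IH; rewrite -!catA.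
Qed.

Lemma pres_eq_inv_l w : pres_eq R (inv_word w ++ w) [::].
Proof. by rewrite -{2}[w]inv_wordK; apply: pres_eq_inv_r. Qed.

Lemma pres_eq_inv u v : pres_eq R u v -> pres_eq R (inv_word u) (inv_word v).
Proof.
move=> h; apply: (@pe_trans _ _ (inv_word u ++ (v ++ inv_word v))).
  have := pres_eq_cat2 (pe_refl R (inv_word u)) (pe_sym (pres_eq_inv_r v)).
  by rewrite cats0.
apply: (@pe_trans _ _ (inv_word u ++ (u ++ inv_word v))).
  apply: pres_eq_cat2; first exact: pe_refl.
  by apply: pres_eq_cat2; [exact: pe_sym|exact: pe_refl].
rewrite catA; have := pres_eq_cat2 (pres_eq_inv_l u) (pe_refl R (inv_word v)).
by [].
Qed.

(** A class is the predicate [pres_eq R w]; extensionality then turns equality of classes into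
    equivalence of words. *)
Definition presented_group := {c : gword -> Prop | exists w, c = pres_eq R w}.

Definition word_class w : presented_group := exist _ (pres_eq R w) (ex_intro _ w erefl).

Lemma word_classP u v : word_class u = word_class v <-> pres_eq R u v.
Proof.
split=> [/(congr1 sval) /= E|h].
  by rewrite E; apply: pe_refl.
have E : pres_eq R u = pres_eq R v.
  apply: funext => w; apply: propext; split; first exact/pe_trans/pe_sym.
  exact: pe_trans.
by apply: eq_exist.
Qed.

Lemma word_class_ex (c : presented_group) : exists w, c = word_class w.
Proof. by case: c => c [w E]; exists w; apply: eq_exist. Qed.

Definition class_word (c : presented_group) : gword := projT1 (cid (word_class_ex c)).

Lemma class_wordK c : word_class (class_word c) = c.
Proof. by rewrite /class_word; case: (cid _). Qed.

Lemma word_classK w : pres_eq R (class_word (word_class w)) w.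
Proof. by apply/word_classP/class_wordK. Qed.

Definition presented_mul c d := word_class (class_word c ++ class_word d).
Definition presented_inv c := word_class (inv_word (class_word c)).

Lemma presented_mulE u v : presented_mul (word_class u) (word_class v) = word_class (u ++ v).
Proof. by apply/word_classP/pres_eq_cat2; apply: word_classK. Qed.

Lemma presented_invE u : presented_inv (word_class u) = word_class (inv_word u).
Proof. by apply/word_classP/pres_eq_inv/word_classK. Qed.

Lemma presented_mulA : associative presented_mul.
Proof.
move=> a b c; have [[u ->] [v ->] [w ->]] := And3 (word_class_ex a) (word_class_ex b) (word_class_ex c).
by rewrite !presented_mulE catA.
Qed.

Lemma presented_mul1 : left_id (word_class [::]) presented_mul.
Proof. by move=> a; have [u ->] := word_class_ex a; rewrite presented_mulE. Qed.

Lemma presented_mulr1 : right_id (word_class [::]) presented_mul.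
Proof. by move=> a; have [u ->] := word_class_ex a; rewrite presented_mulE cats0. Qed.

Lemma presented_mulV : left_inverse (word_class [::]) presented_inv presented_mul.
Proof.
move=> a; have [u ->] := word_class_ex a; rewrite presented_invE presented_mulE.
exact/word_classP/pres_eq_inv_l.
Qed.

Lemma presented_mulrV : right_inverse (word_class [::]) presented_inv presented_mul.
Proof.
move=> a; have [u ->] := word_class_ex a; rewrite presented_invE presented_mulE.
exact/word_classP/pres_eq_inv_r.
Qed.

HB.instance Definition _ := gen_eqMixin presented_group.
HB.instance Definition _ := gen_choiceMixin presented_group.
HB.instance Definition _ := isGroup.Build presented_group presented_mulA
  presented_mul1 presented_mulr1 presented_mulV presented_mulrV.

Lemma word_classM u v : (word_class u * word_class v)%g = word_class (u ++ v).
Proof. exact: presented_mulE. Qed.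

Lemma word_classV u : ((word_class u)^-1)%g = word_class (inv_word u).
Proof. exact: presented_invE. Qed.

End PresentedGroup.

(** * A criterion for finite presentability by short relations *)

Section FinitePresentation.
Variables (T : Type) (H : (T -> T) -> Prop) (A : eqType) (S : groupType).
Variables (s : seq A) (a0 : A) (lS : A -> S) (f fi : S -> T -> T) (K : nat).
Hypotheses (f1 : f 1%g =1 id) (fM : forall a b, f (a * b)%g =1 f a \o f b)
  (f_inj : forall a b, f a =1 f b -> a = b) (fiE : forall a, fi a =1 f (a^-1)%g).

Definition signed_value (Q : groupType) (lQ : A -> Q) (w : seq (A * bool)) : Q :=
  (\prod_(a <- w) if a.2 then lQ a.1 else (lQ a.1)^-1)%g.

Hypotheses (HS : forall a, a \in s -> H (f (lS a)) /\ H (fi (lS a)))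
  (genS : forall h, H h -> exists2 w, all (fun x => x.1 \in s) w &
                                      f (signed_value lS w) =1 h).

Definition short_relations_hold (P : groupType) (lP : A -> P) :=
  forall u v, all (mem s) u -> all (mem s) v -> size u + size v <= K ->
    (\prod_(l <- u) lS l = \prod_(l <- v) lS l)%g ->
    (\prod_(l <- u) lP l = \prod_(l <- v) lP l)%g.

(** Applied to the presented group, this makes every relation of [S] a consequence of the
    relators. *)
Hypothesis short_enough : forall (P : groupType) (lP : A -> P),
  short_relations_hold lP -> forall w, all (fun x => x.1 \in s) w ->
    signed_value lS w = 1%g -> signed_value lP w = 1%g.

(** Free cancellation in [pres_eq] may introduce letters beyond the generators, so these need a
    value as well; 1 agrees with the default pair of identities in [finitely_presented]. *)
Definition letter_of (x : nat * bool) : S :=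
  let l := if x.1 < size s then lS (nth a0 s x.1) else 1%g in
  if x.2 then l else (l^-1)%g.

Definition gvalue (w : gword) : S := (\prod_(x <- w) letter_of x)%g.

Definition gvalid (w : gword) := all (fun x => x.1 < size s) w.

Lemma gvalue_cat u v : gvalue (u ++ v) = (gvalue u * gvalue v)%g.
Proof. exact: big_cat. Qed.

Lemma gvalue_inv_letter x : letter_of (inv_letter x) = ((letter_of x)^-1)%g.
Proof. by case: x => i []; rewrite /letter_of /= ?invgK. Qed.

Lemma gvalue_inv w : gvalue (inv_word w) = ((gvalue w)^-1)%g.
Proof.
elim: w => [|x w IH]; first by rewrite /gvalue !big_nil invg1.
rewrite /inv_word map_cons rev_cons -cats1 gvalue_cat -/(inv_word w) IH.
by rewrite /gvalue big_seq1 big_cons invgM gvalue_inv_letter.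
Qed.

Definition alphabet := ('I_(size s) * bool)%type.

Definition relators : seq gword :=
  [seq w <- flatten [seq [seq [seq (val x.1, x.2) | x <- val t] | t : n.-tuple alphabet]
             | n <- iota 0 K.+1] | gvalue w == 1%g].

Lemma mem_relators w : gvalid w -> size w <= K -> gvalue w = 1%g -> w \in relators.
Proof.
move=> vw szw w1; rewrite mem_filter w1 eqxx andTb.
apply/flattenP; exists [seq [seq (val x.1, x.2) | x <- val t] | t : (size w).-tuple alphabet].
  by apply/mapP; exists (size w) => //; rewrite mem_iota.
have [x [ux Ew]] : exists x : seq alphabet,
    size x = size w /\ w = [seq (val y.1, y.2) | y <- x].
  elim: (w) vw => [|[i b] w' IH] /=; first by exists [::].
  case/andP=> hi /IH[x [sx ->]]; exists ((Ordinal hi, b) :: x); rewrite /= sx.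
  by rewrite size_map sx.
apply/mapP; exists (tcast ux (in_tuple x)); first exact: mem_enum.
by rewrite {1}Ew; congr map; rewrite -[RHS]/(tval _) val_tcast.
Qed.

Lemma relator_valid w : w \in relators -> gvalid w /\ gvalue w = 1%g.
Proof.
rewrite mem_filter => /andP[/eqP -> /flattenP[? /mapP[n _ ->] /mapP[t _ ->]]].
by split=> //; apply/allP => ? /mapP[x _ ->] /=.
Qed.

Lemma pres_eq_gvalue u v : pres_eq relators u v -> gvalue u = gvalue v.
Proof.
elim=> {u v} [//|//|u v w _ -> _ -> //|u v x|u v r /relator_valid[_ hr]].
  rewrite !gvalue_cat /gvalue !big_cons gvalue_inv_letter.
  by rewrite mulVKg.
by rewrite !gvalue_cat hr mul1g.
Qed.

Definition class_letter (l : A) := word_class relators [:: (index l s, true)].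

Definition index_word (w : seq (A * bool)) : gword := [seq (index x.1 s, x.2) | x <- w].

(** A true equality of [u] and [v] provides the relator formed by [u] and the inverse of [v], whose
    length is [size u + size v]. *)
Lemma class_letter_short : short_relations_hold class_letter.
Proof.
have pE u : (\prod_(l <- u) class_letter l)%g =
    word_class relators [seq (index l s, true) | l <- u].
  elim: u => [|l u IH]; first by rewrite big_nil.
  by rewrite big_cons IH word_classM.
have vE u : all (mem s) u ->
    gvalue [seq (index l s, true) | l <- u] = (\prod_(l <- u) lS l)%g.
  elim: u => [|l u IH] /=; first by rewrite /gvalue !big_nil.
  case/andP=> hl /IH{}IH; rewrite /gvalue !big_cons -/(gvalue _) IH.
  by rewrite /letter_of /= index_mem hl nth_index.
have gv u : all (mem s) u -> gvalid [seq (index l s, true) | l <- u].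
  by rewrite /gvalid all_map; apply: sub_all => l /=; rewrite index_mem.
move=> u v hu hv hK E; rewrite !pE; apply/divg1_eq; rewrite word_classV word_classM.
apply/word_classP; rewrite -[X in pres_eq _ X]cats0 -[X in pres_eq _ X]cat0s.
apply: (pe_rel [::] [::]); apply: mem_relators.
- rewrite /gvalid all_cat; apply/andP; split; first exact: gv.
  by rewrite /inv_word all_rev all_map; apply: gv hv.
- by rewrite size_cat /inv_word size_rev !size_map.
by rewrite gvalue_cat gvalue_inv !vE // E mulgV.
Qed.

Lemma signed_index (w : seq (A * bool)) :
  signed_value class_letter w = word_class relators (index_word w).
Proof.
rewrite /signed_value; elim: w => [|[l b] w IH]; first by rewrite big_nil.
rewrite big_cons IH /index_word /=; case: b; first by rewrite word_classM.
by rewrite word_classV word_classM.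
Qed.

Lemma gvalue_index w : all (fun x => x.1 \in s) w ->
  gvalue (index_word w) = signed_value lS w.
Proof.
elim: w => [|[l b] w IH] /=; first by rewrite /gvalue /signed_value !big_nil.
case/andP=> hl /IH{}IH; rewrite /gvalue /signed_value !big_cons.
rewrite -/(gvalue _) -/(signed_value _ _) IH.
by rewrite /letter_of /= index_mem hl nth_index.
Qed.

Lemma finitely_presented_of_short_relations : uniq s ->
  finitely_presented H (fun g h => g \o h) id (fun g h => g =1 h).
Proof.
move=> us; pose gens := [seq (f (lS l), fi (lS l)) | l <- s].
exists gens, relators; rewrite /=.
have fV a : f a \o fi a =1 id /\ fi a \o f a =1 id.
  split=> t; rewrite /= fiE; first by rewrite -[LHS]fM mulgV f1.
  by rewrite -[LHS]fM mulVg f1.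
have nthE i : i < size s -> nth (id, id) gens i = (f (lS (nth a0 s i)), fi (lS (nth a0 s i))).
  by move=> hi; rewrite (nth_map a0).
have evE w : foldr (fun x t => (if x.2 then (nth (id, id) gens x.1).1
    else (nth (id, id) gens x.1).2) \o t) id w =1 f (gvalue w).
  elim: w => [|[i b] w IH] t /=; first by rewrite /gvalue big_nil f1.
  rewrite [gvalue _]/gvalue big_cons -/(gvalue w) fM /= IH /letter_of /=.
  case: (ltnP i (size s)) => hi.
    by rewrite nthE //=; case: b => //=; rewrite fiE.
  by rewrite nth_default ?size_map //=; case: b; rewrite ?invg1 f1.
split; rewrite ?size_map.
- move=> i hi; rewrite nthE //=; have [h1 h2] := HS (mem_nth a0 hi).
  by have [h3 h4] := fV (lS (nth a0 s i)); split.
- move=> h /genS[w hw Ew]; exists (index_word w).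
    by rewrite all_map; apply: sub_all hw => x /=; rewrite index_mem.
  by move=> t; rewrite evE gvalue_index.
- by apply/allP => r /relator_valid[].
move=> w vw; split=> [E|E]; last first.
  by move=> t; rewrite evE (pres_eq_gvalue E) /gvalue big_nil f1.
pose w' := [seq (nth a0 s x.1, x.2) | x <- w].
have hw' : all (fun x => x.1 \in s) w'.
  by rewrite all_map; apply: sub_all vw => x /=; apply: mem_nth.
have iw : index_word w' = w.
  rewrite /index_word -map_comp -[RHS]map_id; apply/eq_in_map => -[i b] hx /=.
  by rewrite index_uniq //; exact: (allP vw _ hx).
have w1 : signed_value lS w' = 1%g.
  rewrite -gvalue_index // iw; apply: f_inj => t; rewrite f1 -[RHS]E.
  by rewrite evE.
have := short_enough class_letter_short hw' w1.
by rewrite signed_index iw => /word_classP.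
Qed.

End FinitePresentation.

Definition base_letters e (L : labels e) J : seq (letter L) :=
  undup [seq l <- [seq inl i | i <- iota 0 (J * e)] ++
    [seq inr p | p <- [seq (q, c) | q <- [seq (k, i) | k <- iota 0 J.+1,
                                                   i <- iota 0 (J * e).+1],
                                 c <- enum {: option (lab L)}]] | base_letter J l].

Lemma mem_base_letters e (L : labels e) J l : (l \in base_letters L J) = base_letter J l.
Proof.
rewrite mem_undup mem_filter; case: (boolP (base_letter J l)) => // hl.
rewrite andTb mem_cat; case: l hl => [i|[[k i] c]] /andP[hv hb]; apply/orP; [left|right].
  by apply: map_f; rewrite mem_iota.
apply: map_f; apply: (allpairs_f (fun q c => (q, c))); last by rewrite mem_enum.
apply: (allpairs_f (fun k i => (k, i))); rewrite mem_iota //.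
have h1 : k * e <= J * e by rewrite leq_mul2r hb orbT.
have h2 : 0 < width c by case: (c).
by move: hv; rewrite /valid_letter; lia.
Qed.

Theorem theorem5p6 (X : finType) (hX : 2 <= #|X|)
    (G : (seq X -> seq X) -> Prop) :
  self_similar G -> contracting G ->
  finitely_presented (V_G G) (fun f g => f \o g) id (@ext_eq X).
Proof.
move=> ssG cG; have [x0 _] : exists x0 : X, true.
  by have /card_gt0P[x0 _] : 0 < #|X| by lia; exists x0.
have [N _] := nucleus_exists x0 ssG cG.
have hG g : G g -> tree_aut g := @G_aut X G ssG g.
have hGV g : G g -> exists2 h, G h & cancel g h /\ cancel h g.
  by case: ssG => -[_ [_ [_ h]]] _; apply: h.
pose e := #|X|.-1; have e0 : 0 < e by rewrite /e; lia.
pose S := sem_strand x0 hX hG N.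
set L := nucleus_labels x0 hX hG N in S.
have -> : @ext_eq X = (fun g h => g =1 h).
  apply: funext => g; apply: funext => h; apply: propext; split=> E xi.
    by apply: funext => n; apply: E.
  by move=> n; rewrite E.
(* 8 is the least level bound that [extension] accepts. *)
pose s := base_letters L 8.
have baseE w : all (fun x : letter L * bool => x.1 \in s) w =
    all (fun x => base_letter 8 x.1) w.
  by apply: eq_all => x; rewrite mem_base_letters.
apply: (@finitely_presented_of_short_relations (oseq X) (V_G G) (letter L) S s
  (inl 0) (letter_value S) (@fw _) (@bw _) (relation_bound L)) => //.
- exact: bijection_eq.
- by move=> l; rewrite mem_base_letters => /andP[hl _]; apply: letter_V_G.
- move=> h /(@V_G_normal_form X G x0 hX hG N hGV)[p [r [t [c [hp hr spr ht E]]]]].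
  have [w hw Ew] := @generated_normal_form e L 8 e0 isT S _
    (ex_intro _ p (ex_intro _ r (ex_intro _ t (ex_intro _ c
      (And5 hp hr spr ht erefl))))).
  exists w; first by rewrite baseE.
  by move=> xi; rewrite E -Ew.
- move=> P lP hP w hw w1.
  have ax k : k < 8 -> strand_axioms_at (fun i => lP (inl i)) (fun k i c => lP (inr (k, i, c))) k.
    apply: (@bounded_axioms e L 8 e0 isT P S lP (letter_value S)); first exact: sax S.
    have bs u : all (base_letter 8) u -> all (mem s) u.
      by apply: sub_all => l hl; rewrite [mem s l]mem_base_letters.
    by move=> u v /bs hu /bs hv; apply: hP.
  (* [P] becomes a full strand system with the same base letters, so a word in these letters can be
     compared with its value in [V_G]. *)
  rewrite baseE in hw; pose Q := @extension e L P _ _ 8 e0 isT ax.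
  have vw : all (fun a : letter L * bool => valid_letter a.1) w.
    by apply: sub_all hw => x /andP[].
  rewrite -[RHS](@word_value_trivial X G x0 hX hG N Q w vw w1).
  rewrite /signed_value /word_value big_seq [RHS]big_seq; apply: eq_bigr => -[l b] /(allP hw).
  have -> : letter_value Q l = if base_letter 8 l then lP l else letter_value Q l.
    case: ifP => // /andP[hv]; case: (l) hv => [i|[[k i] c]] hv hb /=.
      by rewrite extY_base.
    by rewrite extD_base.
  by move=> /= ->.
exact: undup_uniq.
Qed.
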